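(* Let $A(\lambda)$, $B(\lambda)$ be the autoregressive and moving average polynomials of the context, let $F(\lambda)=A(\lambda)^{-1}B(\lambda)$ be irreducible, and let $R_1,\ldots,R_p\in\mathbb{C}^{d\times d}$ be a complete set of regular right solvents of $A(\lambda)$. Suppose $\mathbb{E}\|L(1)\|^2<\infty$ and $\mathbb{E}L(1)=0_m$. Let $Y(t)=\sum_{k=1}^pY_k(t)$, $t\ge0$, be the $\mathbb{R}^d$-valued MCARMA$(p,q)$ process given by $$Y_k(t)=e^{R_kt}Y_k(0)+\int_0^te^{R_k(t-u)}\,\mathrm{Res}[F,R_k]\,\mathrm{d}L(u),\qquad t\ge0,\ k=1,\ldots,p,$$ with initial conditions $Y_k(0)$ in $\mathbb{C}^d$ such that $V(R_1,\ldots,R_p)[Y_1(0)^\top,\ldots,Y_p(0)^\top]^\top\in\mathbb{R}^{pd}$. Fix $h>0$, write $Y_n^{(h)}:=Y(nh)$, let $\Phi_1,\ldots,\Phi_p\in\mathbb{C}^{d\times d}$ be the matrices defined in the context, and let $(U_n^{(h)})_{n\ge p}$ be the $d$-dimensional time series $$U_n^{(h)}:=Y_n^{(h)}-\Phi_1Y_{n-1}^{(h)}-\ldots-\Phi_pY_{n-p}^{(h)},\qquad n\ge p,$$ with autocovariance function $(\gamma_{U^{(h)}}(l))_{l\in\mathbb{Z}}=(\mathrm{Cov}(U_{n+l}^{(h)},U_n^{(h)}))_{l\in\mathbb{Z}}$. Then for $l=0,\ldots,p-1$, $$\gamma_{U^{(h)}}(l)=\sum_{\nu=1}^pe^{hlR_\nu}\left[\sum_{r=0}^{p-l-1}\sum_{\mu=1}^p\bigg(e^{hrR_\nu}-\sum_{j=1}^{r+l}\Phi_je^{h(r-j)R_\nu}\bigg)\Sigma_{\nu,\mu}^{(h)}\bigg(e^{hrR_\mu}-\sum_{j=1}^{r}\Phi_je^{h(r-j)R_\mu}\bigg)^{\mathsf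 H}\right],$$ and $\gamma_{U^{(h)}}(l)=0_{d\times d}$ for $l\ge p$, where $$\Sigma_{\nu,\mu}^{(h)}:=\mathrm{Cov}\big(N_{\nu,1}^{(h)},N_{\mu,1}^{(h)}\big)=\int_0^he^{R_\nu u}\,\mathrm{Res}[F,R_\nu]\,\Sigma_L\,\mathrm{Res}[F,R_\mu]^{\mathsf H}\,e^{R_\mu^{\mathsf H}u}\,\mathrm{d}u$$ and $N_{k,n}^{(h)}=\int_{(n-1)h}^{nh}e^{R_k(nh-u)}\,\mathrm{Res}[F,R_k]\,\mathrm{d}L(u)$.
   Context: Let $d,m\ge 1$ be integers and $p>q$ positive integers. $L=(L(t))_{t\ge0}$ is an $\mathbb{R}^m$-valued Lévy process: $L(0)=0_m$ a.s., stationary and independent increments, càdlàg paths. $\Sigma_L$ denotes the covariance matrix of $L(1)$. Let $$A(\lambda)=I_d\lambda^p+A_1\lambda^{p-1}+\ldots+A_p,\qquad B(\lambda)=B_0\lambda^q+\ldots+B_{q-1}\lambda+B_q,$$ with $A_1,\ldots,A_p\in\mathbb{R}^{d\times d}$, $B_0,\ldots,B_q\in\mathbb{R}^{d\times m}$. MCARMA$(p,q)$ process: an $\mathbb{R}^d$-valued process $Y=(Y(t))_{t\ge0}$ given by the state space equations $Y(t)=C^*X(t)$, $\mathrm{d}X(t)=A^*X(t)\,\mathrm{d}t+B^*\,\mathrm{d}L(t)$, where $A^*\in\mathbb{R}^{pd\times pd}$ is the block companion matrix with blocks $I_d$ on the first block superdiagonal, last block row $(-A_p,-A_{p-1},\ldots,-A_1)$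 and zero blocks elsewhere, $C^*=(I_d,0_{d\times d},\ldots,0_{d\times d})\in\mathbb{R}^{d\times pd}$, and $B^*=(\beta_1^{\mathsf T}\cdots\beta_p^{\mathsf T})^{\mathsf T}\in\mathbb{R}^{pd\times m}$ with $\beta_1=\ldots=\beta_{p-q-1}=0_{d\times m}$ and $\beta_{p-j}=-\sum_{i=1}^{p-j-1}A_i\beta_{p-j-i}+B_{q-j}$ for $j=0,\ldots,q$. Solvents: $\sigma(A(\cdot))=\{\lambda\in\mathbb{C}:\det A(\lambda)=0\}$ (and likewise for other square matrix polynomials), and $\sigma(R)$ is the set of eigenvalues of a matrix $R$. A matrix $R\in\mathbb{C}^{d\times d}$ is a right solvent of $A(\lambda)$ if $R^p+A_1R^{p-1}+\ldots+A_{p-1}R+A_p=0_{d\times d}$. It is regular if $\sigma(R)\cap\sigma(A^{(1)}(\cdot))=\emptyset$, where $A^{(1)}(\lambda)$ is the monic matrix polynomial of degree $p-1$ with $A(\lambda)=A^{(1)}(\lambda)(\lambda I_d-R)$. A set of right solvents $R_1,\ldots,R_p$ is complete if $\sigma(A(\cdot))=\bigcup_{k=1}^p\sigma(R_k)$. $F(\lambda)=A(\lambda)^{-1}B(\lambda)$ is irreducible if $A(\lambda)$ and $B(\lambda)$ are left coprime. For a regular right solvent $R$, the residue is $\mathrm{Res}[F,R]=\frac{1}{2\pi i}\oint_{\Gamma_R}F(\lambda)\,\mathrm{d}\lambda\in\mathbb{C}^{d\times m}$, where $\Gamma_R$ is a simple closed contour with $\sigma(R)$ in its interior and $\sigma(A(\cdot))\setminus\sigma(R)$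 in its exterior. For $S_1,\ldots,S_p\in\mathbb{C}^{d\times d}$, $V(S_1,\ldots,S_p)\in\mathbb{C}^{pd\times pd}$ is the block Vandermonde matrix whose $(i,k)$ block is $S_k^{i-1}$, $i,k=1,\ldots,p$, and $V^{-1}(S_1,\ldots,S_p)$ is its inverse. The matrices $\Phi_j$: put $\Psi_0:=I_d$, $[\Psi_p,\ldots,\Psi_1]:=-[e^{-phR_1},\ldots,e^{-phR_p}]\,V^{-1}(e^{-hR_1},\ldots,e^{-hR_p})\in\mathbb{C}^{d\times pd}$ and $\Phi_j:=-\Psi_p^{-1}\Psi_{p-j}$ for $j=1,\ldots,p$. $Z^{\mathsf H}$ denotes the complex conjugate transpose of a matrix $Z$, and $\mathrm{Cov}(U,W)=\mathbb{E}[(U-\mathbb{E}U)(W-\mathbb{E}W)^{\mathsf H}]$ for random vectors $U,W$.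
   Formalization: The displayed formula is false for d ≥ 2, l ≥ 1: the factor e^{hlR_ν} is moved from the left of the outer bracket to just right of the first bracket, before Σ_{ν,μ}; V(e^{-hR_1},…,e^{-hR_p}) is assumed invertible so that the Φ_j are defined. *)

(* Defs.v *)
From mathcomp Require Import all_boot all_order all_algebra.
From mathcomp Require Import spectral complex.
From mathcomp Require Import all_classical all_reals all_analysis.

Set Implicit Arguments.
Unset Strict Implicit.
Unset Printing Implicit Defensive.

Import Order.TTheory GRing.Theory Num.Theory.
Import numFieldNormedType.Exports.

Local Open Scope classical_set_scope.
Local Open Scope ring_scope.
Local Open Scope sesquilinear_scope.

(** ** Complex scalars, vectors and matrices *)

Definition Cmx (R : realType) (m n : nat) (M : 'M[R]_(m, n)) : 'M[R[i]]_(m, n) :=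
  map_mx (real_complex R) M.

Definition cintegral (d : measure_display) (T : measurableType d) (R : realType)
    (mu : {measure set T -> \bar R}) (D : set T) (f : T -> R[i]) : R[i] :=
  Complex (\int[mu]_(x in D) complex.Re (f x)) (\int[mu]_(x in D) complex.Im (f x)).

Definition mx_integral (d : measure_display) (T : measurableType d) (R : realType)
    (mu : {measure set T -> \bar R}) (D : set T) (m n : nat)
    (F : T -> 'M[R[i]]_(m, n)) : 'M[R[i]]_(m, n) :=
  \matrix_(i, j) cintegral mu D (fun x => F x i j).

Definition expm (R : realType) (n : nat) (M : 'M[R[i]]_n) : 'M[R[i]]_n :=
  let S N := \sum_(k < N) ((k`!)%:R^-1 : R[i]) *: M ^+ k in
  \matrix_(i, j) Complex (limn (fun N => complex.Re (S N i j)))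
                         (limn (fun N => complex.Im (S N i j))).

(** ** Matrix polynomials and solvents *)

(* Coefficients are indexed as in the text: A 1, ..., A p and B 0, ..., B q;
   the other values of A and B are never used. *)
Definition ARpoly (R : realType) (d p : nat) (A : nat -> 'M[R[i]]_d) :
    'M[{poly R[i]}]_d :=
  ('X^p)%:M + \sum_(1 <= j < p.+1) 'X^(p - j) *: map_mx polyC (A j).

Definition MApoly (R : realType) (d m q : nat) (B : nat -> 'M[R[i]]_(d, m)) :
    'M[{poly R[i]}]_(d, m) :=
  \sum_(j < q.+1) 'X^(q - j) *: map_mx polyC (B j).

Definition mxeval (R : realType) (m n : nat) (Q : 'M[{poly R[i]}]_(m, n))
    (z : R[i]) : 'M[R[i]]_(m, n) :=
  map_mx (fun q : {poly R[i]} => q.[z]) Q.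

Definition pspectrum (R : realType) (d : nat) (Q : 'M[{poly R[i]}]_d) : set R[i] :=
  [set z | \det (mxeval Q z) = 0].

Definition mxspectrum (R : realType) (d : nat) (M : 'M[R[i]]_d) : set R[i] :=
  [set z | eigenvalue M z].

Definition right_solvent (R : realType) (d p : nat) (A : nat -> 'M[R[i]]_d)
    (M : 'M[R[i]]_d) : Prop :=
  M ^+ p + \sum_(1 <= j < p.+1) A j *m M ^+ (p - j) = 0.

Definition regular_solvent (R : realType) (d p : nat) (A : nat -> 'M[R[i]]_d)
    (M : 'M[R[i]]_d) : Prop :=
  right_solvent p A M /\
  exists A1 : nat -> 'M[R[i]]_d,
    ARpoly p A = ARpoly p.-1 A1 *m ('X%:M - map_mx polyC M) /\
    mxspectrum M `&` pspectrum (ARpoly p.-1 A1) = set0.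

Definition complete_solvents (R : realType) (d p : nat) (A : nat -> 'M[R[i]]_d)
    (S : 'I_p -> 'M[R[i]]_d) : Prop :=
  (forall k, right_solvent p A (S k)) /\
  pspectrum (ARpoly p A) = \bigcup_(k in [set: 'I_p]) mxspectrum (S k).

(* Every common left divisor is unimodular, i.e. invertible over R[i][X]. *)
Definition left_coprime (R : realType) (d m : nat)
    (Q : 'M[{poly R[i]}]_d) (Q' : 'M[{poly R[i]}]_(d, m)) : Prop :=
  forall (D Q1 : 'M[{poly R[i]}]_d) (Q1' : 'M[{poly R[i]}]_(d, m)),
    Q = D *m Q1 -> Q' = D *m Q1' -> D \in unitmx.

Definition transfer (R : realType) (d m p q : nat) (A : nat -> 'M[R[i]]_d)
    (B : nat -> 'M[R[i]]_(d, m)) (z : R[i]) : 'M[R[i]]_(d, m) :=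
  invmx (mxeval (ARpoly p A) z) *m mxeval (MApoly q B) z.

(** ** Contours and residues *)

Definition C1_fun (R : realType) (f : R -> R) : Prop :=
  (forall x, derivable f x 1) /\ continuous (derive1 f).

Definition piecewise_C1 (R : realType) (g : R -> R[i]) : Prop :=
  exists2 s : seq R, itv_partition 0 1 s &
    forall i, (i < size s)%N -> exists g1 : R -> R[i],
      [/\ C1_fun (fun t => complex.Re (g1 t)), C1_fun (fun t => complex.Im (g1 t)) &
          forall t, nth 1 (0 :: s) i <= t <= nth 1 (0 :: s) i.+1 -> g t = g1 t].

Definition simple_closed_contour (R : realType) (g : R -> R[i]) : Prop :=
  [/\ piecewise_C1 g, g 0 = g 1 &
      forall s t, 0 <= s < 1 -> 0 <= t < 1 -> g s = g t -> s = t].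

(* The derivative of a piecewise C^1 contour may fail to exist at finitely many
   parameters, which are ignored by the Lebesgue integral. *)
Definition contour_integral (R : realType) (g : R -> R[i]) (f : R[i] -> R[i]) : R[i] :=
  cintegral (@lebesgue_measure R) `[0, 1]
    (fun t => f (g t) * Complex (derive1 (fun s => complex.Re (g s)) t)
                                (derive1 (fun s => complex.Im (g s)) t)).

Definition two_pi_i (R : realType) : R[i] := Complex 0 (2 * pi).

Definition winding_number (R : realType) (g : R -> R[i]) (z : R[i]) : R[i] :=
  (two_pi_i R)^-1 * contour_integral g (fun w => (w - z)^-1).

(* Winding number 1 selects the bounded component of the complement of a simple
   closed contour and, at the same time, its positive orientation. *)
Definition contour_interior (R : realType) (g : R -> R[i]) : set R[i] :=
  [set z | ~ (g @` `[0, 1]) z /\ winding_number g z = 1].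

Definition contour_exterior (R : realType) (g : R -> R[i]) : set R[i] :=
  [set z | ~ (g @` `[0, 1]) z /\ winding_number g z = 0].

Definition solvent_contour (R : realType) (d p : nat) (A : nat -> 'M[R[i]]_d)
    (M : 'M[R[i]]_d) (g : R -> R[i]) : Prop :=
  [/\ simple_closed_contour g,
      mxspectrum M `<=` contour_interior g &
      pspectrum (ARpoly p A) `\` mxspectrum M `<=` contour_exterior g].

Definition residue (R : realType) (d m : nat) (F : R[i] -> 'M[R[i]]_(d, m))
    (g : R -> R[i]) : 'M[R[i]]_(d, m) :=
  (two_pi_i R)^-1 *: \matrix_(i, j) contour_integral g (fun z => F z i j).

(** ** Block Vandermonde matrix and the discrete-time coefficients *)

Definition block_vandermonde (R : realType) (d p : nat) (S : 'I_p -> 'M[R[i]]_d) :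
    'M[R[i]]_(\sum_(i < p) d) :=
  \mxblock_(i < p, k < p) (S k ^+ i).

(* The row [Psi_p, ..., Psi_1]. *)
Definition Psi_row (R : realType) (d p : nat) (h : R) (S : 'I_p -> 'M[R[i]]_d) :
    'M[R[i]]_(d, \sum_(i < p) d) :=
  - (\mxrow_(k < p) expm (real_complex R (- (p%:R * h)) *: S k)) *m
    invmx (block_vandermonde (fun k => expm (real_complex R (- h) *: S k))).

(* For 1 <= j <= p, Psi_j is the block of index p - j (counting from 0) of the
   row; values for j > p are never used. *)
Definition Psi (R : realType) (d p : nat) (h : R) (S : 'I_p -> 'M[R[i]]_d)
    (j : nat) : 'M[R[i]]_d :=
  if j == 0%N then 1%:M
  else oapp (fun i : 'I_p => submxrow (Psi_row h S) i) 0 (insub (p - j)%N).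

Definition Phi (R : realType) (d p : nat) (h : R) (S : 'I_p -> 'M[R[i]]_d)
    (j : nat) : 'M[R[i]]_d :=
  - (invmx (Psi h S p) *m Psi h S (p - j)).

(* The bracket  e^{h r M} - sum_{j=1}^{r+l} Phi_j e^{h (r-j) M}.
   The coefficient with which the noise of index n - r enters U_{n+l} is
     e^{h (r+l) M} - sum_{j=1}^{r+l} Phi_j e^{h (r+l-j) M} = MAcoef r l M *m e^{h l M},
   with e^{h l M} on the right: it does not commute with the Phi_j in general,
   so it cannot be moved to the left of the bracket unless d = 1 or l = 0. *)
Definition MAcoef (R : realType) (d p : nat) (h : R) (S : 'I_p -> 'M[R[i]]_d)
    (r l : nat) (M : 'M[R[i]]_d) : 'M[R[i]]_d :=
  expm (real_complex R (h * r%:R) *: M) -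
  \sum_(1 <= j < (r + l).+1)
    Phi h S j *m expm (real_complex R (h * (r%:R - j%:R)) *: M).

(** ** Random vectors and covariances *)

Section Probability.
Context {dT : measure_display} {T : measurableType dT} {R : realType}.
Variable P : probability T R.

Definition rvec (n : nat) (X : T -> 'cV[R]_n) : Prop :=
  forall i, measurable_fun [set: T] (fun w => X w i 0).

Definition crvec (n : nat) (X : T -> 'cV[R[i]]_n) : Prop :=
  forall i, measurable_fun [set: T] (fun w => complex.Re (X w i 0)) /\
            measurable_fun [set: T] (fun w => complex.Im (X w i 0)).

Definition cvec_L2 (n : nat) (X : T -> 'cV[R[i]]_n) : Prop :=
  crvec X /\
  forall i, (\int[P]_w ((Normc.normc (X w i 0)) ^+ 2)%:E < +oo)%E.

Definition cexpect (n : nat) (X : T -> 'cV[R[i]]_n) : 'cV[R[i]]_n :=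
  mx_integral P [set: T] X.

Definition ccov (m n : nat) (U : T -> 'cV[R[i]]_m) (W : T -> 'cV[R[i]]_n) :
    'M[R[i]]_(m, n) :=
  mx_integral P [set: T]
    (fun w => (U w - cexpect U) *m (W w - cexpect W) ^t*).

(* "Cov(U, W) exists and equals G": Lebesgue integrals are total functions, so
   square integrability is part of the assertion. *)
Definition has_cov (m n : nat) (U : T -> 'cV[R[i]]_m) (W : T -> 'cV[R[i]]_n)
    (G : 'M[R[i]]_(m, n)) : Prop :=
  [/\ cvec_L2 U, cvec_L2 W & ccov U W = G].

(** ** Levy processes *)

Definition borel_cV (n : nat) : set (set 'cV[R]_n) :=
  <<s [set B | exists (i : 'I_n) (D : set R),
         measurable D /\ B = [set x : 'cV[R]_n | D (x i 0)]] >>.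

Definition independent_rvecs (n m : nat) (X : 'I_n -> T -> 'cV[R]_m) : Prop :=
  forall B : 'I_n -> set 'cV[R]_m, (forall k, borel_cV (B k)) ->
    P [set w | forall k, B k (X k w)] = (\prod_(k < n) P (X k @^-1` B k))%E.

Definition cadlag (f : R -> R) : Prop :=
  (forall t, 0 <= t -> f s @[s --> t^'+] --> f t) /\
  (forall t, 0 < t -> cvg (f s @[s --> t^'-])).

Definition levy_process (m : nat) (L : R -> T -> 'cV[R]_m) : Prop :=
  [/\ forall t, 0 <= t -> rvec (L t),
      {ae P, forall w, L 0 w = 0},
      forall s t (B : set 'cV[R]_m), 0 <= s -> 0 <= t -> borel_cV B ->
        P [set w | B (L (s + t) w - L s w)] = P [set w | B (L t w)],
      forall (n : nat) (t : nat -> R), 0 <= t 0%N ->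
        (forall k, t k <= t k.+1) ->
        independent_rvecs (fun (k : 'I_n) w => L (t k.+1) w - L (t k) w) &
      forall w i, cadlag (fun t => L t w i 0)].

Definition cov_mx (m : nat) (X : T -> 'cV[R]_m) : 'M[R]_m :=
  \matrix_(i, j) fine (covariance P (fun w => X w i 0) (fun w => X w j 0)).

(** ** Integration of deterministic functions *)

Definition mesh (a : R) (s : seq R) (b : R) : R :=
  \big[Num.max/0]_(i < size s) (nth b (a :: s) i.+1 - nth b (a :: s) i).

Definition riemann_sum (d m : nat) (f : R -> 'M[R[i]]_(d, m))
    (L : R -> T -> 'cV[R]_m) (a b : R) (s : seq R) (w : T) : 'cV[R[i]]_d :=
  \sum_(i < size s) f (nth b (a :: s) i) *m
    Cmx (L (nth b (a :: s) i.+1) w - L (nth b (a :: s) i) w).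

(* I is a version of int_a^b f dL: the limit in probability of the Riemann sums
   as the mesh of the partition tends to 0.  For continuous f this agrees with
   the other usual constructions, and it determines I up to null sets. *)
Definition is_stoch_integral (d m : nat) (f : R -> 'M[R[i]]_(d, m))
    (L : R -> T -> 'cV[R]_m) (a b : R) (I : T -> 'cV[R[i]]_d) : Prop :=
  crvec I /\
  forall (i : 'I_d) (e1 e2 : R), 0 < e1 -> 0 < e2 ->
    exists2 eta : R, 0 < eta &
      forall s, itv_partition a b s -> mesh a s b < eta ->
        (P [set w | (e1 <=
             Normc.normc ((riemann_sum f L a b s w - I w) i 0))%R]
           <= e2%:E)%E.

(** ** MCARMA processes *)

Definition companion (d p : nat) (A : nat -> 'M[R]_d) : 'M[R]_(\sum_(i < p) d) :=
  \mxblock_(i < p, j < p)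
    (if i.+1 == p then - A (p - j)%N
     else if j == i.+1 :> nat then 1%:M else 0 : 'M[R]_d).

Definition Cstar (d p : nat) : 'M[R]_(d, \sum_(i < p) d) :=
  \mxrow_(j < p) (if j == 0%N :> nat then 1%:M else 0 : 'M[R]_d).

Definition is_beta (d m p q : nat) (A : nat -> 'M[R]_d) (B : nat -> 'M[R]_(d, m))
    (beta : nat -> 'M[R]_(d, m)) : Prop :=
  (forall k, (1 <= k)%N -> (k <= p - q - 1)%N -> beta k = 0) /\
  (forall j, (j <= q)%N ->
     beta (p - j)%N =
       - (\sum_(1 <= i < p - j) A i *m beta (p - j - i)%N) + B (q - j)%N).

Definition Bstar (d m p : nat) (beta : nat -> 'M[R]_(d, m)) :
    'M[R]_(\sum_(i < p) d, m) :=
  \mxcol_(i < p) beta i.+1.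

(* The state equation is understood in integrated form,
   X(t) = X(0) + int_0^t A* X(s) ds + B* (L(t) - L(0)). *)
Definition MCARMA (d m p q : nat) (A : nat -> 'M[R]_d) (B : nat -> 'M[R]_(d, m))
    (L : R -> T -> 'cV[R]_m) (Y : R -> T -> 'cV[R]_d) : Prop :=
  (forall t, 0 <= t -> rvec (Y t)) /\
  exists (beta : nat -> 'M[R]_(d, m)) (X : R -> T -> 'cV[R]_(\sum_(i < p) d)),
    [/\ is_beta p q A B beta,
        forall t, 0 <= t -> rvec (X t),
        forall w i, cadlag (fun t => X t w i 0),
        forall t, 0 <= t -> {ae P, forall w,
          X t w = X 0 w
            + (\col_i \int[@lebesgue_measure R]_(s in `[0, t])
                 (companion p A *m X s w) i 0)
            + Bstar p beta *m (L t w - L 0 w)} &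
        forall t, 0 <= t -> {ae P, forall w, Y t w = Cstar d p *m X t w}].

End Probability.

(* Main.v *)
From HB Require Import structures.
Require Import Defs.
From mathcomp Require Import all_boot all_order all_algebra.
From mathcomp Require Import spectral complex ring lra.
From mathcomp Require Import all_classical all_reals all_analysis.
From mathcomp Require Import measurable_realfun.

(** The process Y_k solves a linear recursion between multiples of h: splitting its
    stochastic integral at time nh gives, almost surely,
    Y_k((n+1)h) = e^{hR_k} Y_k(nh) + N_{k,n+1}.

    The matrices Phi_j annihilate the deterministic part of all these recursions at
    once. By the definition of the Psi_j through the inverse Vandermonde matrix, the sum
    of Psi_j e^{jhR_k} over j = 0, ..., p vanishes for every k ([Psi_relation]). The same
    invertibility makes Psi_p invertible ([Psi_unit]), and dividing by Psi_p shows that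
    e^{phR_k} is the sum of Phi_j e^{(p-j)hR_k} ([Phi_relation]). Filtering the
    recursions with the Phi_j therefore removes the state at time (n-p)h and leaves
    U_n as a moving average: the sum over k and r < p of G_k(r) N_{k,n-r}, where
    G_k(r) = e^{hrR_k} - sum_{j <= r} Phi_j e^{h(r-j)R_k} ([ARfilter]).

    What remains are the covariances of the noises ([vcip_moving_average]): noises of
    different times are uncorrelated, and those of equal times have the covariance
    Sigma_{nu,mu}, whatever the time. So only the pairs with s = r + l contribute to the
    covariance of U_{n+l} and U_n, and none if l >= p.

    These covariances are the isometry of the stochastic integral. An integral is only
    given as a limit in probability of Riemann sums. For Lipschitz integrands the
    Riemann sums on refined uniform partitions form a Cauchy sequence in L2, and a Fatou
    lemma for convergence in probability ([cvg_prob_fatou]) shows that the limit is also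
    one in L2 ([wiener_l2]). Covariances of Riemann sums are Riemann sums of the
    covariance integrand ([ip_wsum], [stoch_isometry]) as soon as the increments of L
    over [s, t] have mean 0 and covariance (t - s) Sigma_L.

    This last fact comes from L(1) alone. Square integrability at other times holds
    because independent summands of a square-integrable sum are square integrable
    ([indep_sqint_add]). Covariances are additive and locally bounded functions of time,
    hence linear ([cvar_linear]). The mean is additive, vanishes at rational times, and
    vanishes everywhere by right continuity at 0 ([mean0]). *)

Set Implicit Arguments.
Unset Strict Implicit.
Unset Printing Implicit Defensive.

Import Order.TTheory GRing.Theory Num.Theory.
Import numFieldNormedType.Exports.

Local Open Scope classical_set_scope.
Local Open Scope ring_scope.
Local Open Scope sesquilinear_scope.

(** * Square-integrable random variables *)

Section L2.
Context {dT : measure_display} {T : measurableType dT} {R : realType}.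
Variable P : probability T R.
Implicit Types X Y Z : T -> R.

Definition sqint X : Prop :=
  measurable_fun [set: T] X /\ P.-integrable [set: T] (EFin \o (X * X)%R).

Definition ip X Y : R := \int[P]_w (X w * Y w).

Lemma integrable_dominated (f : T -> R) (g : T -> R) :
  measurable_fun [set: T] f -> (forall w, `|f w| <= g w) ->
  P.-integrable [set: T] (EFin \o g) -> P.-integrable [set: T] (EFin \o f).
Proof.
move=> mf fg; apply: le_integrable => //; first exact/measurable_EFinP.
by move=> w _ /=; rewrite lee_fin (le_trans (fg w))// ler_norm.
Qed.

(** Because |x y| <= x^2 + y^2. *)
Lemma sqint_mul X Y : sqint X -> sqint Y ->
  P.-integrable [set: T] (EFin \o (X * Y)%R).
Proof.
move=> [mX iX] [mY iY].
apply: (@integrable_dominated _ (X * X + Y * Y)).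
- exact: measurable_funM.
- by move=> w; rewrite !fctE; case: (ler0P (X w * Y w)) => _; nra.
- by rewrite (_ : _ \o _ = (EFin \o (X * X)%R) \+ (EFin \o (Y * Y)%R))%E //; exact: integrableD.
Qed.

Lemma sqintD X Y : sqint X -> sqint Y -> sqint (X + Y).
Proof.
move=> sX sY; split; first by apply: measurable_funD; [case: sX | case: sY].
apply: (@integrable_dominated _ ((X * X + X * Y) + (X * Y + Y * Y))).
- by apply: measurable_funM; apply: measurable_funD; by [case: sX | case: sY].
- by move=> w; rewrite !fctE ger0_norm ?sqr_ge0 -?expr2 ?sqr_ge0//; nra.
- rewrite (_ : _ \o _ = (((EFin \o (X * X)%R) \+ (EFin \o (X * Y)%R)) \+
     ((EFin \o (X * Y)%R) \+ (EFin \o (Y * Y)%R))))%E //.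
  by do 2![apply: integrableD => //]; exact: sqint_mul.
Qed.

Lemma sqintZ a X : sqint X -> sqint (a *: X).
Proof.
move=> [mX iX]; split; first exact: measurable_funM.
rewrite (_ : _ \o _ = (fun w => (a ^+ 2)%:E * (EFin \o (X * X)%R) w))%E.
  exact: integrableZl.
by apply/funext => w /=; rewrite -EFinM !fctE /= /GRing.scale /=; congr EFin; ring.
Qed.

Lemma sqintN X : sqint X -> sqint (- X).
Proof. by move=> sX; rewrite -scaleN1r; exact: sqintZ. Qed.

Lemma sqintB X Y : sqint X -> sqint Y -> sqint (X - Y).
Proof. by move=> sX sY; apply: sqintD => //; exact: sqintN. Qed.

Lemma sqint_cst (a : R) : sqint (cst a).
Proof.
split; first exact: measurable_cst.
by rewrite (_ : _ \o _ = EFin \o cst (a * a)) //; exact: finite_measure_integrable_cst.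
Qed.

Lemma sqint_sum (I : Type) (r : seq I) (Q : pred I) (F : I -> T -> R) :
  (forall i, Q i -> sqint (F i)) -> sqint (\sum_(i <- r | Q i) F i).
Proof.
move=> sF; elim/big_rec: _ => [|i X Qi sX]; first exact: (sqint_cst 0).
by apply: sqintD => //; exact: sF.
Qed.

Lemma sqint_integrable X : sqint X -> P.-integrable [set: T] (EFin \o X).
Proof.
move=> sX; rewrite -[X]mulr1; apply: sqint_mul => //; exact: (sqint_cst 1).
Qed.

Lemma ipC X Y : ip X Y = ip Y X.
Proof. by apply: eq_Rintegral => w _; rewrite mulrC. Qed.

Lemma ipDl X Y Z : sqint X -> sqint Y -> sqint Z ->
  ip (X + Y) Z = ip X Z + ip Y Z.
Proof.
move=> sX sY sZ; rewrite /ip -RintegralD//; try exact: sqint_mul.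
by apply: eq_Rintegral => w _; rewrite !fctE mulrDl.
Qed.

Lemma ipDr X Y Z : sqint X -> sqint Y -> sqint Z ->
  ip Z (X + Y) = ip Z X + ip Z Y.
Proof. by move=> sX sY sZ; rewrite ipC ipDl// !(ipC _ Z). Qed.

Lemma ipZl a X Y : sqint X -> sqint Y -> ip (a *: X) Y = a * ip X Y.
Proof.
move=> sX sY; rewrite /ip -RintegralZl//; last exact: sqint_mul.
by apply: eq_Rintegral => w _; rewrite !fctE /GRing.scale /= mulrA.
Qed.

Lemma ipZr a X Y : sqint X -> sqint Y -> ip X (a *: Y) = a * ip X Y.
Proof. by move=> sX sY; rewrite ipC ipZl// ipC. Qed.

Lemma ipNl X Y : sqint X -> sqint Y -> ip (- X) Y = - ip X Y.
Proof. by move=> sX sY; rewrite -scaleN1r ipZl// mulN1r. Qed.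

Lemma ipBl X Y Z : sqint X -> sqint Y -> sqint Z ->
  ip (X - Y) Z = ip X Z - ip Y Z.
Proof. by move=> sX sY sZ; rewrite ipDl ?ipNl//; exact: sqintN. Qed.

Lemma ipBr X Y Z : sqint X -> sqint Y -> sqint Z ->
  ip Z (X - Y) = ip Z X - ip Z Y.
Proof. by move=> sX sY sZ; rewrite ipC ipBl// !(ipC _ Z). Qed.

Lemma ip0l X : ip 0 X = 0.
Proof.
rewrite /ip (_ : (fun w => _) = cst 0) ?Rintegral_cst ?mul0r//.
by apply/funext => w; rewrite fctE mul0r.
Qed.

Lemma ip_suml (I : Type) (r : seq I) (Q : pred I) (F : I -> T -> R) Z :
  (forall i, Q i -> sqint (F i)) -> sqint Z ->
  ip (\sum_(i <- r | Q i) F i) Z = \sum_(i <- r | Q i) ip (F i) Z.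
Proof.
move=> sF sZ.
suff [] : sqint (\sum_(i <- r | Q i) F i) /\
    ip (\sum_(i <- r | Q i) F i) Z = \sum_(i <- r | Q i) ip (F i) Z by [].
elim/big_rec2: _ => [|i a X Qi [sX eX]]; first by split; [exact: (sqint_cst 0)|exact: ip0l].
by split; [apply: sqintD => //; exact: sF | rewrite ipDl ?eX//; exact: sF].
Qed.

Lemma ip_sumr (I : Type) (r : seq I) (Q : pred I) (F : I -> T -> R) Z :
  (forall i, Q i -> sqint (F i)) -> sqint Z ->
  ip Z (\sum_(i <- r | Q i) F i) = \sum_(i <- r | Q i) ip Z (F i).
Proof.
by move=> sF sZ; rewrite ipC ip_suml//; apply: eq_bigr => i _; rewrite ipC.
Qed.

Lemma ip_ge0 X : 0 <= ip X X.
Proof. by apply: Rintegral_ge0 => w _; rewrite -expr2 sqr_ge0. Qed.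

Lemma ip_sqrDZ a X Y : sqint X -> sqint Y ->
  ip (X + a *: Y) (X + a *: Y) = ip X X + 2 * a * ip X Y + a ^+ 2 * ip Y Y.
Proof.
move=> sX sY; have sZ := sqintZ a sY.
rewrite ipDl ?ipDr ?ipZl ?ipZr//; last exact: sqintD.
by rewrite (ipC Y X); ring.
Qed.

(** The polynomial t |-> ip (X + t Y) (X + t Y) is nonnegative. It is evaluated at
    its minimum or, when ip Y Y = 0, at the t that would give it the value -1. *)
Lemma ip_cauchy_schwarz X Y : sqint X -> sqint Y ->
  (ip X Y) ^+ 2 <= ip X X * ip Y Y.
Proof.
move=> sX sY.
have quad (t : R) : 0 <= ip X X + 2 * t * ip X Y + t ^+ 2 * ip Y Y.
  by have := ip_ge0 (X + t *: Y); rewrite ip_sqrDZ.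
have Y0 := ip_ge0 Y.
have [Yp|Y_0] := ltP 0 (ip Y Y).
  (* the minimum of the polynomial *)
  have := quad (- ip X Y / ip Y Y).
  rewrite -(pmulr_lge0 _ Yp) => /le_trans; move: Yp; set c := ip Y Y.
  set b := ip X Y; set a := ip X X => c0 H.
  rewrite -subr_ge0; apply: H; rewrite le_eqVlt; apply/orP; left; apply/eqP; field.
  by rewrite gt_eqF.
have Ye : ip Y Y = 0 by apply/le_anti; rewrite Y_0 Y0.
rewrite Ye mulr0; have [->|b0] := eqVneq (ip X Y) 0; first by rewrite expr0n.
have := quad (- (ip X X + 1) / (2 * ip X Y)); rewrite Ye mulr0 addr0.
suff -> : 2 * (- (ip X X + 1) / (2 * ip X Y)) * ip X Y = - (ip X X + 1) by lra.
by field.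
Qed.

Lemma ip_ae X X' Y Y' :
  measurable_fun [set: T] X -> measurable_fun [set: T] X' ->
  measurable_fun [set: T] Y -> measurable_fun [set: T] Y' ->
  {ae P, forall w, X w = X' w} -> {ae P, forall w, Y w = Y' w} ->
  ip X Y = ip X' Y'.
Proof.
move=> mX mX' mY mY' eX eY; congr fine; apply: ae_eq_integral => //.
- by apply/measurable_EFinP; exact: measurable_funM.
- by apply/measurable_EFinP; exact: measurable_funM.
- by move: eX eY; apply: filterS2 => w eX eY _; rewrite eX eY.
Qed.

Lemma sqint_ae X X' : measurable_fun [set: T] X' ->
  {ae P, forall w, X w = X' w} -> sqint X -> sqint X'.
Proof.
move=> mX' eX [mX iX]; split => //.
have m1 : measurable_fun [set: T] (EFin \o (X' * X')%R).
  by apply/measurable_EFinP; exact: measurable_funM.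
have m2 : measurable_fun [set: T] (EFin \o (X * X)%R).
  by apply/measurable_EFinP; exact: measurable_funM.
apply/integrableP; split => //.
move/integrableP : iX => [_]; congr (_ < _)%E.
apply: ae_eq_integral => //; try exact: measurableT_comp.
by move: eX; apply: filterS => w eX _; rewrite /= !fctE eX.
Qed.

Definition l2cvg (S : nat -> T -> R) X : Prop :=
  ip (S K - X) (S K - X) @[K --> \oo] --> (0 : R).

Lemma cvg0_sqr (u v : nat -> R) : (forall n, u n ^+ 2 <= v n) ->
  v @ \oo --> 0 -> u @ \oo --> 0.
Proof.
move=> uv v0; apply/norm_cvg0P.
have sv : (fun n => Num.sqrt (v n)) @ \oo --> 0.
  rewrite -[X in _ --> X]sqrtr0; apply: continuous_cvg => //; exact: sqrt_continuous.
apply: (squeeze_cvgr _ (cvg_cst 0) sv); near=> n.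
by rewrite normr_ge0 /= -sqrtr_sqr ler_wsqrtr.
Unshelve. all: by end_near. Qed.

(** Continuity of the inner product: every covariance of stochastic integrals is
    computed as a limit of covariances of Riemann sums through this lemma. *)
Lemma l2cvg_ip S S' X Y :
  (forall K, sqint (S K)) -> (forall K, sqint (S' K)) -> sqint X -> sqint Y ->
  l2cvg S X -> l2cvg S' Y ->
  ip (S K) (S' K) @[K --> \oo] --> ip X Y.
Proof.
move=> sS sS' sX sY cS cS'.
have -> : (fun K => ip (S K) (S' K)) = (fun K => ip (S K - X) (S' K - Y) +
    ip (S K - X) Y + ip X (S' K - Y) + ip X Y).
  apply/funext => K; have s1 := sS K; have s2 := sS' K.
  have s3 := sqintB s1 sX; have s4 := sqintB s2 sY.
  by rewrite !ipBl ?ipBr//; ring.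
rewrite -[X in _ --> X]add0r; apply: cvgD; last exact: cvg_cst.
rewrite -[X in _ --> X]addr0 -[X in _ --> X + _]addr0.
apply: cvgD; [apply: cvgD|].
- apply: (@cvg0_sqr _ (fun K => ip (S K - X) (S K - X) * ip (S' K - Y) (S' K - Y))).
    by move=> n; apply: ip_cauchy_schwarz; exact: sqintB.
  by rewrite -(mulr0 0); exact: cvgM.
- apply: (@cvg0_sqr _ (fun K => ip (S K - X) (S K - X) * ip Y Y)).
    by move=> n; apply: ip_cauchy_schwarz => //; exact: sqintB.
  by rewrite -(mul0r (ip Y Y)); apply: cvgM => //; exact: cvg_cst.
- apply: (@cvg0_sqr _ (fun K => ip X X * ip (S' K - Y) (S' K - Y))).
    by move=> n; apply: ip_cauchy_schwarz => //; exact: sqintB.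
  by rewrite -(mulr0 (ip X X)); apply: cvgM => //; exact: cvg_cst.
Qed.

End L2.

(** * Convergence in probability *)

Section ConvergenceInProbability.
Context {dT : measure_display} {T : measurableType dT} {R : realType}.
Variable P : probability T R.
Implicit Types X Y Z : T -> R.

Definition cvg_prob (S : nat -> T -> R) X : Prop :=
  forall e1 e2 : R, 0 < e1 -> 0 < e2 -> exists K0 : nat, forall K, (K0 <= K)%N ->
    (P [set w | (e1 <= `|S K w - X w|)%R] <= e2%:E)%E.

Lemma measurable_ge_set (f : T -> R) (e : R) : measurable_fun [set: T] f ->
  measurable [set w | e <= f w].
Proof.
move=> mf; rewrite -[X in measurable X]setTI.
by apply: measurable_fun_ler => //; exact: measurable_cst.
Qed.

Lemma measurable_dist_set (X Y : T -> R) (e : R) :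
  measurable_fun [set: T] X -> measurable_fun [set: T] Y ->
  measurable [set w | e <= `|X w - Y w| ].
Proof.
move=> mX mY; apply: measurable_ge_set.
by apply: measurableT_comp => //; exact: measurable_funB.
Qed.

(** Off the event |S K - X| >= e1 one has X^2 <= (1 + d) (S K)^2 + (1 + 1/d) e1^2,
    and on this event, of probability at most e2, the truncation is at most c.
    The numbers d, e1 and e2 make each of the three errors at most e/3. *)
Lemma cvg_prob_sqr_le S X (C : R) : (forall K, sqint P (S K)) ->
  measurable_fun [set: T] X -> cvg_prob S X -> (forall K, ip P (S K) (S K) <= C) ->
  forall c : R, 0 <= c -> \int[P]_w Num.min (X w ^+ 2) c <= C.
Proof.
move=> sS mX SX SC c c0.
have C0 : 0 <= C by apply: le_trans (SC 0%N); exact: ip_ge0.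
apply/ler_addgt0Pr => e e0.
(* d * C <= e / 3; one is added because C may be 0, and likewise to c in e2 *)
pose d := e / (3 * (C + 1)).
have d0 : 0 < d by rewrite divr_gt0 ?mulr_gt0//; lra.
pose e1 := Num.sqrt (e / 3 / (1 + d^-1)).
have dV0 : 0 < d^-1 by rewrite invr_gt0.
have e1sq : (1 + d^-1) * e1 ^+ 2 = e / 3.
  rewrite sqr_sqrtr ?divr_ge0//; try lra.
  rewrite mulrC divfK//; lra.
have e10 : 0 < e1 by rewrite sqrtr_gt0 !divr_gt0//; lra.
pose e2 := e / (3 * (c + 1)).
have e20 : 0 < e2 by rewrite divr_gt0 ?mulr_gt0//; lra.
have [K /(_ K (leqnn K)) HK] := SX _ _ e10 e20.
pose D := [set w | e1 <= `|S K w - X w| ].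
have mS : measurable_fun [set: T] (S K) by case: (sS K).
have mD : measurable D by exact: measurable_dist_set.
have iS : P.-integrable [set: T] (EFin \o (fun w => (1 + d) * (S K w * S K w))).
  rewrite (_ : _ \o _ = (fun w => (1 + d)%:E * (EFin \o (S K * S K)%R) w)%E).
    by apply: integrableZl => //; case: (sS K).
  by apply/funext => w /=.
have iE : P.-integrable [set: T] (EFin \o cst (e / 3)).
  exact: finite_measure_integrable_cst.
have iD : P.-integrable [set: T] (EFin \o (fun w => c * \1_D w)).
  rewrite (_ : _ \o _ = (fun w => c%:E * (EFin \o \1_D) w)%E).
    by apply: integrableZl => //; exact: integrable_indic.
  by apply/funext => w /=.
have iSE : P.-integrable [set: T]
    (EFin \o (fun w => (1 + d) * (S K w * S K w) + e / 3)).
  exact: (@integrableD _ _ _ _ _ _ (EFin \o (fun w => (1 + d) * (S K w * S K w)))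
    (EFin \o cst (e / 3))).
have iSED : P.-integrable [set: T]
    (EFin \o (fun w => (1 + d) * (S K w * S K w) + e / 3 + c * \1_D w)).
  exact: (@integrableD _ _ _ _ _ _ (EFin \o (fun w => (1 + d) * (S K w * S K w) + e / 3))
    (EFin \o (fun w => c * \1_D w))).
have iX : P.-integrable [set: T] (EFin \o (fun w => Num.min (X w ^+ 2) c)).
  apply: (integrable_dominated _ _ (finite_measure_integrable_cst P c measurableT)).
    by apply: measurable_minr => //; exact: measurable_funX.
  by move=> w; rewrite ger0_norm ?ge_min ?lexx ?orbT// le_min c0 sqr_ge0.
have H : \int[P]_w Num.min (X w ^+ 2) c <=
    \int[P]_w ((1 + d) * (S K w * S K w) + e / 3 + c * \1_D w).
  apply: le_Rintegral => // w _; rewrite ge_min; apply/orP.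
  have S2 := sqr_ge0 (S K w).
  have [wD|wD] := leP e1 `|S K w - X w|.
    by right; rewrite indicE mem_set// mulr1 -expr2; nra.
  left; rewrite indicE memNset ?mulr0 ?addr0; last by rewrite /D/= leNgt wD.
  have wD2 : (S K w - X w) ^+ 2 <= e1 ^+ 2.
    by rewrite -real_normK ?num_real// lerXn2r ?nnegrE// ?ltW.
  rewrite -e1sq.
  have k1 : d * d^-1 = 1 by rewrite mulfV// gt_eqF.
  have k2 : 0 <= d^-1 * (d * S K w - (X w - S K w)) ^+ 2 by rewrite mulr_ge0 ?sqr_ge0// ltW.
  have k3 : d^-1 * (d * S K w - (X w - S K w)) ^+ 2 =
     d * d^-1 * d * S K w ^+ 2 - 2 * (d * d^-1) * S K w * (X w - S K w) + d^-1 * (X w - S K w) ^+ 2 by ring.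
  rewrite k3 k1 in k2.
  have k4 : (1 + d^-1) * (S K w - X w) ^+ 2 <= (1 + d^-1) * e1 ^+ 2 by rewrite ler_pM2l//; lra.
  nra.
apply: (le_trans H).
rewrite !RintegralD// RintegralZl//; last exact: integrable_indic.
rewrite RintegralZl//; last exact: (sS K).2.
have P1 : fine (P setT) = 1 by rewrite probability_setT.
rewrite Rintegral_cst// [fine (_ setT)]P1 mulr1.
have -> : \int[P]_w \1_D w = fine (P D) by rewrite /Rintegral integral_indic// setIT.
have PD : fine (P D) <= e2 by rewrite -lee_fin fineK// fin_num_measure.
have q1 : (1 + d) * \int[P]_w (S K w * S K w) <= C + e / 3.
  have : (1 + d) * \int[P]_w (S K w * S K w) <= (1 + d) * C.
    by rewrite ler_pM2l//; [exact: SC | lra].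
  suff : d * C <= e / 3 by lra.
  have dE : d * (C + 1) = e / 3 by rewrite /d; field; lra.
  lra.
have q2 : c * fine (P D) <= e / 3.
  apply: (@le_trans _ _ (c * e2)); first by rewrite ler_wpM2l.
  have e2E : e2 * (c + 1) = e / 3 by rewrite /e2; field; lra.
  lra.
lra.
Qed.

(** A Fatou lemma for limits in probability: the truncation level c of
    [cvg_prob_sqr_le] tends to infinity. This replaces the extraction of almost
    surely convergent subsequences. *)
Lemma cvg_prob_fatou S X (C : R) : (forall K, sqint P (S K)) ->
  measurable_fun [set: T] X -> cvg_prob S X -> (forall K, ip P (S K) (S K) <= C) ->
  sqint P X /\ ip P X X <= C.
Proof.
move=> sS mX SX SC.
have C0 : 0 <= C by apply: le_trans (SC 0%N); exact: ip_ge0.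
have bd := cvg_prob_sqr_le sS mX SX SC.
pose g n := fun w => (Num.min (X w ^+ 2) n%:R)%:E.
have mg n : measurable_fun [set: T] (g n).
  apply/measurable_EFinP; apply: measurable_minr => //; exact: measurable_funX.
have cg w : g n w @[n --> \oo] --> (X w ^+ 2)%:E.
  apply: cvg_near_cst; near=> n; congr EFin; apply/min_idPl.
  near: n; exists (Num.bound (X w ^+ 2)) => // n /= Hn.
  apply: (le_trans (ltW (archi_boundP _))); first exact: sqr_ge0.
  by rewrite ler_nat.
have gC n : (\int[P]_w g n w <= C%:E)%E.
  have := bd n%:R (ler0n _ n); rewrite -lee_fin /Rintegral fineK//.
  apply: integrable_fin_num => //.
  apply: (integrable_dominated _ _ (finite_measure_integrable_cst P n%:R measurableT)).
    by apply: measurable_minr => //; exact: measurable_funX.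
  by move=> w; rewrite ger0_norm ?ge_min ?lexx ?orbT// le_min ler0n sqr_ge0.
have XC : (\int[P]_w (X w ^+ 2)%:E <= C%:E)%E.
  have -> : (\int[P]_w (X w ^+ 2)%:E = \int[P]_w (limn (g ^~ w)))%E.
    by apply: eq_integral => w _; apply/esym/cvg_lim => //; exact: cg.
  rewrite monotone_convergence//.
  - apply: lime_le; last by apply: nearW => n; exact: gC.
    apply: ereal_nondecreasing_is_cvgn => a b ab; apply: ge0_le_integral => //.
    + by move=> w _; rewrite lee_fin le_min sqr_ge0 ler0n.
    + by move=> w _; rewrite lee_fin le_min !ge_min lexx /= ler_nat ab orbT.
  - by move=> n w _; rewrite lee_fin le_min sqr_ge0 ler0n.
  - by move=> w _ a b ab; rewrite lee_fin le_min !ge_min lexx /= ler_nat ab orbT.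
have iX : P.-integrable [set: T] (EFin \o (X * X)%R).
  apply/integrableP; split; first by apply/measurable_EFinP; exact: measurable_funM.
  apply: le_lt_trans (ltry C); apply: le_trans XC.
  by rewrite le_eqVlt; apply/orP; left; apply/eqP; apply: eq_integral => w _;
    rewrite /= !fctE -expr2 ger0_norm ?sqr_ge0.
split; first by split.
rewrite -lee_fin /ip /Rintegral fineK; last exact: integrable_fin_num.
exact: XC.
Unshelve. all: by end_near. Qed.

Lemma cvg_prob_cst X : cvg_prob (fun _ => X) X.
Proof.
move=> e1 e2 e10 e20; exists 0%N => K _.
rewrite (_ : [set _ | _] = set0) ?measure0 ?lee_fin ?ltW//.
by apply/seteqP; split => // w /=; rewrite subrr normr0 leNgt e10.
Qed.

Lemma cvg_probD S S' X Y :
  (forall K, measurable_fun [set: T] (S K)) -> (forall K, measurable_fun [set: T] (S' K)) ->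
  measurable_fun [set: T] X -> measurable_fun [set: T] Y ->
  cvg_prob S X -> cvg_prob S' Y -> cvg_prob (fun K => S K + S' K) (X + Y).
Proof.
move=> mS mS' mX mY SX SY e1 e2 e10 e20.
have h1 : 0 < e1 / 2 by lra.
have h2 : 0 < e2 / 2 by lra.
have [K1 H1] := SX _ _ h1 h2; have [K2 H2] := SY _ _ h1 h2.
exists (maxn K1 K2) => K; rewrite geq_max => /andP[/H1 {}H1 /H2 {}H2].
pose D1 := [set w | e1 / 2 <= `|S K w - X w| ].
pose D2 := [set w | e1 / 2 <= `|S' K w - Y w| ].
have mD1 : measurable D1 by exact: measurable_dist_set.
have mD2 : measurable D2 by exact: measurable_dist_set.
apply: (@le_trans _ _ (P (D1 `|` D2))).
  apply: le_measure; rewrite ?inE//.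
  - by apply: measurable_dist_set; exact: measurable_funD.
  - exact: measurableU.
  - move=> w /= Hw; apply: contrapT => /not_orP[/negP + /negP].
    rewrite -!ltNge => a b; move: Hw; apply/negP; rewrite -ltNge !fctE.
    rewrite (_ : _ - _ = (S K w - X w) + (S' K w - Y w)); last ring.
    by apply: (le_lt_trans (ler_normD _ _)); lra.
apply: (le_trans (measureU2 _ mD1 mD2)).
rewrite (_ : e2 = e2 / 2 + e2 / 2); last lra.
by rewrite EFinD leeD.
Qed.

Lemma cvg_probZ a S X : cvg_prob S X -> cvg_prob (fun K => a *: S K) (a *: X).
Proof.
move=> SX e1 e2 e10 e20.
have [->|a0] := eqVneq a 0.
  exists 0%N => K _; rewrite (_ : [set _ | _] = set0) ?measure0 ?lee_fin ?ltW//.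
  by apply/seteqP; split => // w /=; rewrite !scale0r subrr normr0 leNgt e10.
have a1 : 0 < `|a| by rewrite normr_gt0.
have [K0 HK] := SX (e1 / `|a|) e2 (divr_gt0 e10 a1) e20.
exists K0 => K /HK; congr (P _ <= _)%E; apply/seteqP; split => w /=;
  by rewrite !fctE /GRing.scale /= -mulrBr normrM ler_pdivrMr// mulrC.
Qed.

Lemma cvg_probB S S' X Y :
  (forall K, measurable_fun [set: T] (S K)) -> (forall K, measurable_fun [set: T] (S' K)) ->
  measurable_fun [set: T] X -> measurable_fun [set: T] Y ->
  cvg_prob S X -> cvg_prob S' Y -> cvg_prob (fun K => S K - S' K) (X - Y).
Proof.
move=> mS mS' mX mY SX SY.
rewrite -(scaleN1r Y) (_ : (fun K => _) = (fun K => S K + (-1) *: S' K)).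
  apply: cvg_probD => //; last exact: cvg_probZ.
  - by move=> K; exact: measurable_funM.
  - exact: measurable_funM.
by apply/funext => K; rewrite scaleN1r.
Qed.

Lemma cvg_prob_sum (I : Type) (r : seq I) (S : I -> nat -> T -> R) (X : I -> T -> R) :
  (forall i K, measurable_fun [set: T] (S i K)) ->
  (forall i, measurable_fun [set: T] (X i)) ->
  (forall i, cvg_prob (S i) (X i)) ->
  cvg_prob (fun K => \sum_(i <- r) S i K) (\sum_(i <- r) X i).
Proof.
move=> mS mX SX; elim: r => [|i r IH].
  rewrite big_nil (_ : (fun K => _) = fun=> 0); first exact: cvg_prob_cst.
  by apply/funext => K; rewrite big_nil.
rewrite big_cons (_ : (fun K => _) = (fun K => S i K + \sum_(j <- r) S j K)).
  apply: cvg_probD => //.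
  - by move=> K; rewrite fct_sumE; exact: measurable_sum.
  - by rewrite fct_sumE; exact: measurable_sum.
by apply/funext => K; rewrite big_cons.
Qed.

Lemma cvg_prob_subseq S X (f : nat -> nat) : (forall n, (n <= f n)%N) ->
  cvg_prob S X -> cvg_prob (S \o f) X.
Proof.
move=> nf SX e1 e2 e10 e20; have [K0 HK] := SX _ _ e10 e20.
by exists K0 => K KK; apply: HK; exact: (leq_trans KK).
Qed.

Lemma ip_eq0_ae X : sqint P X -> ip P X X = 0 -> {ae P, forall w, X w = 0}.
Proof.
move=> [mX iX] X0.
have mXX : measurable_fun [set: T] (EFin \o (X * X)%R).
  by apply/measurable_EFinP; exact: measurable_funM.
have [+ _] := @ae_eq_integral_abs _ _ _ P setT measurableT _ mXX.
have -> : (\int[P]_x `|(EFin \o (X * X)%R) x| = \int[P]_x ((EFin \o (X * X)%R) x))%E.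
  by apply: eq_integral => w _; rewrite /= !fctE -expr2 ger0_norm ?sqr_ge0.
have XX0 : (\int[P]_x ((EFin \o (X * X)%R) x) = 0)%E.
  rewrite -[LHS]fineK; last exact: integrable_fin_num.
  by rewrite -[RHS]/(0%:E) -X0.
move=> /(_ XX0); apply: filterS => w /(_ I) [] /eqP; rewrite !fctE mulf_eq0 => /orP[]/eqP //.
Qed.

(** The difference of two limits is a limit in probability of the zero sequence, so
    Fatou's lemma gives it second moment 0. *)
Lemma cvg_prob_unique S X Y :
  (forall K, measurable_fun [set: T] (S K)) ->
  measurable_fun [set: T] X -> measurable_fun [set: T] Y ->
  cvg_prob S X -> cvg_prob S Y -> {ae P, forall w, X w = Y w}.
Proof.
move=> mS mX mY SX SY; have H := cvg_probB mS mS mX mY SX SY.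
have [K|||sZ Z0] := @cvg_prob_fatou _ (X - Y) 0 _ _ H.
- by rewrite subrr; exact: (sqint_cst P 0).
- exact: measurable_funB.
- by move=> K; rewrite subrr ip0l.
have : ip P (X - Y) (X - Y) = 0 by apply/le_anti; rewrite Z0 ip_ge0.
by move=> /(ip_eq0_ae sZ); apply: filterS => w /eqP; rewrite subr_eq0 => /eqP.
Qed.

End ConvergenceInProbability.

(** * Independence and equality in law *)

Section Independence.
Context {dT : measure_display} {T : measurableType dT} {R : realType}.
Variable P : probability T R.
Implicit Types X Y Z : T -> R.

Definition indep X Y : Prop := forall D1 D2 : set R, measurable D1 -> measurable D2 ->
  P (X @^-1` D1 `&` Y @^-1` D2) = (P (X @^-1` D1) * P (Y @^-1` D2))%E.

Definition same_law X Y : Prop := forall D : set R, measurable D ->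
  P (X @^-1` D) = P (Y @^-1` D).

Lemma same_law_integral X Y (f : R -> \bar R) :
  measurable_fun [set: T] X -> measurable_fun [set: T] Y -> same_law X Y ->
  measurable_fun [set: R] f -> (forall x, 0 <= f x)%E ->
  (\int[P]_w f (X w) = \int[P]_w f (Y w))%E.
Proof.
move=> mX mY XY mf f0.
pose mX' := isMeasurableFun.Build _ _ _ _ _ mX.
pose mY' := isMeasurableFun.Build _ _ _ _ _ mY.
pose X' : {mfun T >-> R} := HB.pack X mX'.
pose Y' : {mfun T >-> R} := HB.pack Y mY'.
have := @ge0_integral_pushforward _ _ _ _ R _ mX P setT f measurableT mf (fun y _ => f0 y).
have := @ge0_integral_pushforward _ _ _ _ R _ mY P setT f measurableT mf (fun y _ => f0 y).
rewrite !preimage_setT => <- <-.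
apply: (@eq_measure_integral _ _ _ _ (distribution P Y') (distribution P X')) => D mD _.
exact: XY.
Qed.

(** The joint law of (X, Y) agrees with the product of the two laws on rectangles,
    hence on all measurable sets; the claim is then Tonelli's theorem. *)
Lemma indep_integral X Y (f g : R -> \bar R) :
  measurable_fun [set: T] X -> measurable_fun [set: T] Y -> indep X Y ->
  measurable_fun [set: R] f -> measurable_fun [set: R] g ->
  (forall x, 0 <= f x)%E -> (forall x, 0 <= g x)%E ->
  (\int[P]_w (f (X w) * g (Y w)) =
     (\int[P]_w f (X w)) * (\int[P]_w g (Y w)))%E.
Proof.
move=> mX mY XY mf mg f0 g0.
pose mX' := isMeasurableFun.Build _ _ _ _ _ mX.
pose mY' := isMeasurableFun.Build _ _ _ _ _ mY.
pose X' : {mfun T >-> R} := HB.pack X mX'.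
pose Y' : {mfun T >-> R} := HB.pack Y mY'.
have mZ : measurable_fun [set: T] (fun w => (X w, Y w)) by exact: measurable_fun_pair.
pose mZ' := isMeasurableFun.Build _ _ _ _ _ mZ.
pose Z' : {mfun T >-> (R * R)%type} := HB.pack (fun w => (X w, Y w)) mZ'.
pose F := fun z : R * R => (f z.1 * g z.2)%E.
have mF : measurable_fun setT F.
  by apply: emeasurable_funM; exact: measurableT_comp.
have F0 z : (0 <= F z)%E by exact: mule_ge0.
have := @ge0_integral_pushforward _ _ _ _ R _ mZ P setT F measurableT mF (fun y _ => F0 y).
rewrite preimage_setT /= => <-.
rewrite -(@eq_measure_integral _ _ _ _ (distribution P Z')
  (product_measure1 (distribution P X') (distribution P Y'))); last first.
  move=> D mD _; apply: product_measure_unique => //; exact: XY.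
rewrite fubini_tonelli1//.
have -> : (\int[P]_w f (X w) = \int[distribution P X']_x f x)%E.
  by rewrite (@ge0_integral_pushforward _ _ _ _ R _ mX P setT f measurableT mf (fun y _ => f0 y)).
have -> : (\int[P]_w g (Y w) = \int[distribution P Y']_x g x)%E.
  by rewrite (@ge0_integral_pushforward _ _ _ _ R _ mY P setT g measurableT mg (fun y _ => g0 y)).
rewrite -ge0_integralZr//; last exact: integral_ge0.
by apply: eq_integral => x _; rewrite /F /fubini_F /= ge0_integralZl.
Qed.

Lemma same_law_sqint X Y : measurable_fun [set: T] Y -> same_law X Y ->
  sqint P X -> sqint P Y /\ ip P X X = ip P Y Y.
Proof.
move=> mY XY [mX iX].
have e : (\int[P]_w ((X w * X w)%:E) = \int[P]_w ((Y w * Y w)%:E))%E.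
  apply: (same_law_integral mX mY XY (f := fun x => (x * x)%:E)).
    by apply/measurable_EFinP; exact: measurable_funM.
  by move=> x; rewrite lee_fin -expr2 sqr_ge0.
split; last by rewrite /ip /Rintegral e.
split => //; apply/integrableP; split.
  by apply/measurable_EFinP; exact: measurable_funM.
move/integrableP : iX => [_].
under eq_integral do rewrite /= !fctE ger0_norm -?expr2 ?sqr_ge0// expr2.
rewrite e => H; under eq_integral do rewrite /= !fctE ger0_norm -?expr2 ?sqr_ge0// expr2.
exact: H.
Qed.

Definition pospart (x : R) := Num.max x 0.

(** The mean is read off from the second moments of X and of X + 1. *)
Lemma same_law_mean X Y : measurable_fun [set: T] Y -> same_law X Y ->
  sqint P X -> ip P X (cst 1) = ip P Y (cst 1).
Proof.
move=> mY XY sX; have mX := sX.1; have [sY e0] := same_law_sqint mY XY sX.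
have m1 : measurable_fun [set: R] (fun x : R => x + 1).
  by apply: measurable_funD => //; exact: measurable_cst.
have XY1 : same_law (X + cst 1) (Y + cst 1).
  move=> D mD; have mD' : measurable ((fun x : R => x + 1) @^-1` D).
    by rewrite -[X in measurable X]setTI; exact: m1.
  exact: XY mD'.
have mY1 : measurable_fun [set: T] (Y + cst 1).
  by apply: measurable_funD => //; exact: measurable_cst.
have s1 := sqint_cst P 1.
have [_] := same_law_sqint mY1 XY1 (sqintD sX s1).
rewrite !ipDl ?ipDr//; try exact: sqintD.
rewrite e0 !(ipC P (cst 1)); lra.
Qed.

Lemma measurable_pospart : measurable_fun [set: R] pospart.
Proof. by apply: measurable_maxr => //; exact: measurable_cst. Qed.

Lemma pospart_ge0 x : 0 <= pospart x. Proof. by rewrite le_max lexx orbT. Qed.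

Lemma pospart_sub x : pospart x - pospart (- x) = x.
Proof. by rewrite /pospart; case: (lerP x 0); case: (lerP (- x) 0) => *; lra. Qed.

Lemma sqint_comp X (s : R -> R) : measurable_fun [set: R] s ->
  (forall x, `|s x| <= `|x| ) -> sqint P X -> sqint P (s \o X).
Proof.
move=> ms hs [mX iX]; have m : measurable_fun [set: T] (s \o X) by exact: measurableT_comp.
split => //.
apply: integrable_dominated iX; first exact: measurable_funM.
move=> w; rewrite !fctE /= normrM -expr2 -[leRHS]expr2 -(real_normK (num_real (X w))).
by rewrite lerXn2r ?nnegrE.
Qed.

Lemma indep_ip_ge0 X Y (f g : R -> R) : sqint P X -> sqint P Y -> indep X Y ->
  measurable_fun [set: R] f -> measurable_fun [set: R] g ->
  (forall x, 0 <= f x) -> (forall x, 0 <= g x) ->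
  sqint P (f \o X) -> sqint P (g \o Y) ->
  ip P (f \o X) (g \o Y) = ip P (f \o X) (cst 1) * ip P (g \o Y) (cst 1).
Proof.
move=> sX sY XY mf mg f0 g0 sf sg.
rewrite /ip /Rintegral; under eq_integral do rewrite EFinM.
rewrite (indep_integral (f := EFin \o f) (g := EFin \o g) sX.1 sY.1 XY).
- under [in RHS]eq_integral do rewrite mulr1.
  under [X in _ = _ * fine X]eq_integral do rewrite mulr1.
  rewrite fineM//; exact: integrable_fin_num (sqint_integrable _).
- exact/measurable_EFinP.
- exact/measurable_EFinP.
- by move=> x; rewrite lee_fin.
- by move=> x; rewrite lee_fin.
Qed.

(** Tonelli's theorem applies to the products of positive and negative parts. *)
Lemma indep_ip X Y : sqint P X -> sqint P Y -> indep X Y ->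
  ip P X Y = ip P X (cst 1) * ip P Y (cst 1).
Proof.
move=> sX sY XY.
pose neg := fun x : R => pospart (- x).
have mp := measurable_pospart.
have mn : measurable_fun [set: R] neg by exact: measurableT_comp.
have hp x : `|pospart x| <= `|x| by rewrite /pospart; case: (lerP x 0) => *; rewrite ?normr0 ?normr_ge0.
have hn x : `|neg x| <= `|x| by rewrite -(normrN x); exact: hp.
have s1 := sqint_cst P 1.
have eX : X = (pospart \o X) - (neg \o X) by apply/funext => w; rewrite !fctE /= pospart_sub.
have eY : Y = (pospart \o Y) - (neg \o Y) by apply/funext => w; rewrite !fctE /= pospart_sub.
have a1 := sqint_comp mp hp sX; have a2 := sqint_comp mn hn sX.
have b1 := sqint_comp mp hp sY; have b2 := sqint_comp mn hn sY.
rewrite eX eY !ipBl ?ipBr//; try exact: sqintB.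
have n0 x : 0 <= neg x by exact: pospart_ge0.
rewrite !indep_ip_ge0 //; try exact: pospart_ge0.
by ring.
Qed.

(** For some n the event |Y| <= n has positive probability; on it
    X^2 <= 2 (X + Y)^2 + 2 n^2, and by independence it carries the fraction
    P(|Y| <= n) of the second moment of X, which is therefore finite. *)
Lemma indep_sqint_add X Y : measurable_fun [set: T] X -> measurable_fun [set: T] Y ->
  indep X Y -> sqint P (X + Y) -> sqint P X.
Proof.
move=> mX mY XY sXY.
(* Some D n has positive probability, as P (Y \in D n) tends to 1 *)
pose D (n : nat) : set R := [set y | `|y| <= n%:R].
have mD n : measurable (D n).
  rewrite (_ : D n = `[- n%:R, n%:R]%classic); first exact: measurable_itv.
  by apply/seteqP; split => y; rewrite /D /= in_itv /= ler_norml.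
have PD : P (Y @^-1` D n) @[n --> \oo] --> 1%E.
  rewrite -(probability_setT P) (_ : setT = \bigcup_n (Y @^-1` D n)).
    apply: nondecreasing_cvg_mu.
    - by move=> n; rewrite -[X in measurable X]setTI; exact: mY.
    - by apply: bigcup_measurable => n _; rewrite -[X in measurable X]setTI; exact: mY.
    - move=> a b ab; apply/subsetPset => w; rewrite /D /= => /le_trans; apply.
      by rewrite ler_nat.
  apply/seteqP; split => // w _; exists (Num.bound `|Y w|) => //=.
  by rewrite /D/=; apply: ltW; exact: archi_boundP.
have [n Pn] : exists n, (0 < P (Y @^-1` D n))%E.
  apply/not_existsP => H; have Z : forall n, P (Y @^-1` D n) = 0%E.
    by move=> n; apply/eqP; rewrite -measure_le0 leNgt; apply/negP; exact: H.
  have : (fun n => P (Y @^-1` D n)) @ \oo --> 0%E.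
    by rewrite (_ : (fun n => _) = cst 0%E); [exact: cvg_cst|apply/funext].
  move=> P0; have := cvg_lim (@ereal_hausdorff R) PD.
  rewrite (cvg_lim (@ereal_hausdorff R) P0) => /(_ _)[] /esym/eqP.
  by rewrite oner_eq0.
split => //; apply/integrableP; split.
  by apply/measurable_EFinP; exact: measurable_funM.
under eq_integral do rewrite /= !fctE ger0_norm -?expr2 ?sqr_ge0//.
have mYD : measurable (Y @^-1` D n) by rewrite -[X in measurable X]setTI; exact: mY.
have H := indep_integral (f := fun x => (x ^+ 2)%:E) (g := EFin \o \1_(D n)) mX mY XY.
rewrite -ge0_fin_numE; last by apply: integral_ge0 => w _; rewrite lee_fin sqr_ge0.
apply/negPn/negP; rewrite ge0_fin_numE; last by apply: integral_ge0 => w _; rewrite lee_fin sqr_ge0.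
rewrite -leNgt leye_eq => /eqP Xoo.
have : (\int[P]_w ((X w ^+ 2)%:E * (EFin \o \1_(D n)) (Y w)) = +oo)%E.
  rewrite H.
  - rewrite Xoo (_ : (\int[P]_w (EFin \o \1_(D n)) (Y w) = P (Y @^-1` D n))%E).
      by rewrite gt0_mulye.
    by rewrite -[in RHS](setIT (Y @^-1` D n)) -integral_indic.
  - by apply/measurable_EFinP; exact: measurable_funX.
  - by apply/measurable_EFinP; exact: measurable_indic.
  - by move=> x; rewrite lee_fin sqr_ge0.
  - by move=> x; rewrite /= lee_fin.
apply/eqP; rewrite lt_eqF//.
have iB : P.-integrable [set: T]
    (EFin \o (fun w => 2 * ((X + Y) w * (X + Y) w) + 2 * n%:R ^+ 2)).
  apply: (@integrableD _ _ _ _ _ _ (EFin \o (fun w => 2 * ((X + Y) w * (X + Y) w)))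
    (EFin \o cst (2 * n%:R ^+ 2))) => //; last exact: finite_measure_integrable_cst.
  rewrite (_ : _ \o _ = (fun w => 2%:E * (EFin \o ((X + Y) * (X + Y))%R) w)%E).
    by apply: integrableZl => //; exact: sXY.2.
  by apply/funext.
have : P.-integrable [set: T] (EFin \o (fun w => X w ^+ 2 * \1_(D n) (Y w))).
  apply: integrable_dominated iB.
    apply: measurable_funM; first exact: measurable_funX.
    by rewrite (_ : (fun w => _) = \1_(Y @^-1` D n)).
  move=> w; rewrite !fctE; have y2 := sqr_ge0 (X w); have z2 := sqr_ge0 (X w + Y w).
  have n2 := sqr_ge0 (n%:R : R).
  rewrite ger0_norm; last by rewrite mulr_ge0.
  have [wD|wD] := pselect (D n (Y w)); last by rewrite indicE memNset// mulr0; nra.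
  rewrite indicE mem_set// mulr1.
  have Yn : Y w ^+ 2 <= n%:R ^+ 2 by move: wD; rewrite /D /= ler_norml; move: (n%:R : R) (Y w) => c y /andP[? ?]; nra.
  have := sqr_ge0 (X w + 2 * Y w); nra.
move/integrableP => [_]; congr (_ < _)%E; apply: eq_integral => w _.
by rewrite /= ger0_norm ?EFinM// mulr_ge0 ?sqr_ge0.
Qed.

End Independence.

(** * Second moments of the increments of a Levy process *)

(** The function g t = f t - t f 1 is additive and vanishes at the integers, so it is
    bounded on the whole half-line, whereas g (n t) = n g t. *)
Lemma additive_bounded_linear (R : realType) (f : R -> R) (C : R) :
  (forall s t, 0 <= s -> 0 <= t -> f (s + t) = f s + f t) ->
  (forall t, 0 <= t <= 1 -> `|f t| <= C) ->
  forall t, 0 <= t -> f t = t * f 1.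
Proof.
move=> fD fC.
pose g t := f t - t * f 1.
have gD s t : 0 <= s -> 0 <= t -> g (s + t) = g s + g t.
  by move=> s0 t0; rewrite /g fD//; ring.
have gn n t : 0 <= t -> g (n%:R * t) = n%:R * g t.
  move=> t0; elim: n => [|n IH].
    by rewrite !mul0r; have := gD 0 0 (lexx 0) (lexx 0); rewrite addr0; lra.
  by rewrite -natr1 !mulrDl !mul1r gD ?IH// mulr_ge0.
have g1 : g 1 = 0 by rewrite /g; ring.
have gnat n : g n%:R = 0 by rewrite -[n%:R]mulr1 gn// g1 mulr0.
have gC t : 0 <= t -> `|g t| <= C + `|f 1|.
  move=> t0; have /andP[h1 h2] := truncn_itv t0.
  set n := Num.trunc t in h1 h2.
  have tn0 : 0 <= t - n%:R by rewrite subr_ge0.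
  have -> : g t = g (t - n%:R).
    by have := gD _ _ tn0 (ler0n R n); rewrite subrK gnat addr0.
  have r01 : 0 <= t - n%:R <= 1.
    by move: h2; rewrite -natr1 => h2; apply/andP; split; lra.
  apply: (le_trans (ler_normB _ _)); rewrite lerD ?fC// normrM ler_piMl//.
  by rewrite ger0_norm; case/andP: r01.
have g0 t : 0 <= t -> g t = 0.
  move=> t0; apply/eqP; rewrite -normr_le0; apply/ler_addgt0Pl => e e0; rewrite addr0.
  have B0 : 0 <= C + `|f 1| by apply: le_trans (gC _ t0).
  pose n := (Num.bound ((C + `|f 1|) / e)).
  have hn : (C + `|f 1|) / e < n%:R by apply: archi_boundP; rewrite divr_ge0// ltW.
  have n0 : 0 < n%:R :> R by apply: le_lt_trans hn; rewrite divr_ge0// ltW.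
  rewrite -(ler_pM2l n0) -[X in X * `|_|](ger0_norm (ltW n0)) -normrM -gn//.
  apply: (le_trans (gC _ _)); first by rewrite mulr_ge0 // ltW.
  by rewrite -ler_pdivrMr// ltW.
by move=> t t0; have := g0 t t0; rewrite /g; lra.
Qed.

Section LevyMoments.
Context {dT : measure_display} {T : measurableType dT} {R : realType}.
Variables (P : probability T R) (m : nat) (L : R -> T -> 'cV[R]_m).
Hypothesis levyL : levy_process P L.
Implicit Types (s t : R) (j k : 'I_m).

Definition incr s t j : T -> R := fun w => (L t w - L s w) j 0.

Lemma incrD s t u j : incr s u j = incr s t j + incr t u j.
Proof. by apply/funext => w; rewrite fctE /incr !mxE; ring. Qed.

Lemma measurable_incr s t j : 0 <= s -> 0 <= t -> measurable_fun [set: T] (incr s t j).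
Proof.
move=> s0 t0; case: levyL => /= mL _ _ _ _.
rewrite (_ : incr s t j = (fun w => L t w j 0 - L s w j 0)).
  by apply: measurable_funB; exact: mL.
by apply/funext => w; rewrite /incr !mxE.
Qed.

Lemma borel_cylinder j (D : set R) : measurable D ->
  borel_cV [set x : 'cV[R]_m | D (x j 0)].
Proof. by move=> mD; apply: sub_sigma_algebra; exists j, D. Qed.

Lemma borel_setT : borel_cV [set: 'cV[R]_m].
Proof.
rewrite -(setD0 setT); apply: sigma_algebraCD; exact: sigma_algebra0.
Qed.

(** The coordinates are measurable for the sigma-algebra that the cylinders generate,
    so their linear combinations are. The law of such combinations determines all
    covariances by polarization. *)
Lemma borel_combination j k (a : R) (D : set R) : measurable D ->
  borel_cV [set x : 'cV[R]_m | D (x j 0 + a * x k 0)].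
Proof.
move=> mD.
(* The cylinders generate a measurable structure on the column vectors *)
pose PT : pointedType := HB.pack 'cV[R]_m (isPointed.Build 'cV[R]_m 0).
pose G : set (set PT) := [set B | exists (i : 'I_m) (D : set R),
         measurable D /\ B = [set x : 'cV[R]_m | D (x i 0)]].
pose GT : measurableType _ := g_sigma_algebraType G.
have mc i : measurable_fun [set: GT] (fun x : 'cV[R]_m => x i 0).
  by move=> _ E mE; rewrite setTI; exact: borel_cylinder.
have mf : measurable_fun [set: GT] (fun x : 'cV[R]_m => x j 0 + a * x k 0).
  apply: measurable_funD => //; apply: measurable_funM => //; exact: measurable_cst.
by have := mf measurableT _ mD; rewrite setTI.
Qed.

(** The intervals need not be adjacent: the increment over [t, u] between them is
    constrained to the whole space. *)
Lemma levy_indep s t u v j k : 0 <= s -> s <= t -> t <= u -> u <= v ->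
  indep P (incr s t j) (incr u v k).
Proof.
move=> s0 st tu uv D1 D2 mD1 mD2.
case: levyL => /= _ _ _ indL _.
pose tt (i : nat) := nth v [:: s; t; u] i.
have tt0 : 0 <= tt 0%N by [].
have ttle i : tt i <= tt i.+1 by rewrite /tt; case: i => [|[|[|i]]] //=; rewrite nth_nil.
pose B (i : 'I_3) : set 'cV[R]_m :=
  if i == 0 then [set x | D1 (x j 0)] else
  if i == 1 then setT else [set x | D2 (x k 0)].
have mB i : borel_cV (B i).
  rewrite /B; case: ifP => _; first exact: borel_cylinder.
  by case: ifP => _; [exact: borel_setT|exact: borel_cylinder].
have := indL 3%N tt tt0 ttle B mB.
rewrite !big_ord_recl big_ord0 mule1 /B /= preimage_setT probability_setT mul1e => <-.
congr (P _); apply/seteqP; split => w /=.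
  by move=> [d1 d2] [[|[|[|i]]] Hi]//=.
move=> H; split; first by have := H ord0.
by have := H (lift ord0 (lift ord0 ord0)).
Qed.

Lemma levy_same_law s t j k (a : R) : 0 <= s -> 0 <= t ->
  same_law P (incr 0 t j + a *: incr 0 t k)
    (incr s (s + t) j + a *: incr s (s + t) k).
Proof.
move=> s0 t0 D mD; case: levyL => /= _ _ stat _ _.
have := stat s t _ s0 t0 (borel_combination j k a mD).
rewrite -(stat 0 t _ (lexx 0) t0 (borel_combination j k a mD)) add0r => H.
have E u v : incr u v j + a *: incr u v k =
  (fun w => (L v w - L u w) j 0 + a * (L v w - L u w) k 0).
  by apply/funext => w; rewrite -[LHS]/(incr u v j w + a * incr u v k w).
by rewrite !E; apply/esym; exact: H.
Qed.

Hypothesis sq1 : forall j, sqint P (incr 0 1 j).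

Lemma stationary_sqint s t j : 0 <= s -> 0 <= t -> sqint P (incr 0 t j) ->
  sqint P (incr s (s + t) j).
Proof.
move=> s0 t0 sX; have H := levy_same_law j j 0 s0 t0.
rewrite !scale0r !addr0 in H.
by have [] := same_law_sqint (measurable_incr j s0 (addr_ge0 s0 t0)) H sX.
Qed.

(** At integer times by adding increments with the law of L(1) - L(0); at a time t <= n
    because the increment over [0, n] is the sum of the independent increments over
    [0, t] and [t, n]. *)
Lemma sqint_incr0 t j : 0 <= t -> sqint P (incr 0 t j).
Proof.
move=> t0.
have sn n : sqint P (incr 0 n%:R j).
  elim: n => [|n IH].
    rewrite (_ : incr _ _ _ = cst 0); first exact: sqint_cst.
    by apply/funext => w; rewrite /incr subrr mxE.
  rewrite (incrD _ n%:R) -natr1; apply: sqintD => //.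
  exact: stationary_sqint.
have h : t <= (Num.bound t)%:R by apply/ltW/archi_boundP.
have n0 : 0 <= (Num.bound t)%:R :> R by [].
apply: (indep_sqint_add (Y := incr t (Num.bound t)%:R j)).
- exact: measurable_incr.
- exact: measurable_incr.
- exact: levy_indep.
- by rewrite -incrD.
Qed.

Lemma sqint_incr s t j : 0 <= s -> s <= t -> sqint P (incr s t j).
Proof.
move=> s0 st; rewrite -[t](subrKC s) ; apply: stationary_sqint; rewrite ?subr_ge0//.
by apply: sqint_incr0; rewrite subr_ge0.
Qed.

Let mean t j := ip P (incr 0 t j) (cst 1).
Let cvar t j k := ip P (incr 0 t j) (incr 0 t k) - mean t j * mean t k.

Lemma mean_incr s t j : 0 <= s -> s <= t ->
  ip P (incr s t j) (cst 1) = mean (t - s) j.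
Proof.
move=> s0 st; have t0 : 0 <= t - s by rewrite subr_ge0.
have H := levy_same_law j j 0 s0 t0.
rewrite !scale0r !addr0 subrKC in H.
have t0' := le_trans s0 st.
by rewrite -(same_law_mean (measurable_incr j s0 t0') H (sqint_incr0 j t0)).
Qed.

(** Polarization, from the second moments of the sum and the difference. *)
Lemma stationary_ip s t j k : 0 <= s -> s <= t ->
  ip P (incr s t j) (incr s t k) = ip P (incr 0 (t - s) j) (incr 0 (t - s) k).
Proof.
move=> s0 st; have t0 : 0 <= t - s by rewrite subr_ge0.
have t0' := le_trans s0 st.
have H a : ip P (incr s t j + a *: incr s t k) (incr s t j + a *: incr s t k) =
    ip P (incr 0 (t - s) j + a *: incr 0 (t - s) k)
         (incr 0 (t - s) j + a *: incr 0 (t - s) k).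
  have := levy_same_law j k a s0 t0; rewrite subrKC => /same_law_sqint [].
  - apply: measurable_funD; first exact: measurable_incr.
    by apply: measurable_funM; [exact: measurable_cst|exact: measurable_incr].
  - by apply: sqintD; [|apply: sqintZ]; exact: sqint_incr0.
  - by move=> _ ->.
have sj := sqint_incr j s0 st; have sk := sqint_incr k s0 st.
have uj := sqint_incr0 j t0; have uk := sqint_incr0 k t0.
have := H 1; have := H (-1); rewrite !(ip_sqrDZ _ sj sk) !(ip_sqrDZ _ uj uk).
repeat match goal with |- context [ip ?Q ?X ?Y] => generalize (ip Q X Y); intro end.
lra.
Qed.

Lemma indep_incr_ip s t u v j k : 0 <= s -> s <= t -> t <= u -> u <= v ->
  ip P (incr s t j) (incr u v k) = mean (t - s) j * mean (v - u) k.
Proof.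
move=> s0 st tu uv; have u0 := le_trans s0 (le_trans st tu).
rewrite indep_ip ?mean_incr//; try exact: sqint_incr.
exact: levy_indep.
Qed.

Lemma meanD s t j : 0 <= s -> 0 <= t -> mean (s + t) j = mean s j + mean t j.
Proof.
move=> s0 t0; rewrite /mean (incrD _ s) ipDl.
- by rewrite [X in _ + X]mean_incr ?lerDl// addrAC subrr add0r.
- exact: sqint_incr0.
- by apply: sqint_incr => //; rewrite lerDl.
- exact: sqint_cst.
Qed.

Lemma cvarD s t j k : 0 <= s -> 0 <= t -> cvar (s + t) j k = cvar s j k + cvar t j k.
Proof.
move=> s0 t0; rewrite /cvar !meanD// !(incrD 0 s (s + t)).
have st : s <= s + t by rewrite lerDl.
have sj := sqint_incr0 j s0; have sk := sqint_incr0 k s0.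
have uj := sqint_incr j s0 st; have uk := sqint_incr k s0 st.
have e1 i i' : ip P (incr 0 s i) (incr s (s + t) i') = mean s i * mean t i'.
  by rewrite indep_incr_ip// subr0 addrAC subrr add0r.
have e2 : ip P (incr s (s + t) j) (incr s (s + t) k) = ip P (incr 0 t j) (incr 0 t k).
  by rewrite stationary_ip// addrAC subrr add0r.
rewrite !ipDl ?ipDr//; try exact: sqintD.
rewrite (ipC P (incr s (s + t) j) (incr 0 s k)) !e1 e2.
repeat match goal with |- context [ip ?Q ?X ?Y] => generalize (ip Q X Y); intro end.
ring.
Qed.

Lemma cvar_center t j k : 0 <= t -> cvar t j k =
  ip P (incr 0 t j - cst (mean t j)) (incr 0 t k - cst (mean t k)).
Proof.
move=> t0; have sj := sqint_incr0 j t0; have sk := sqint_incr0 k t0.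
have c1 a : cst a = a *: cst 1 :> (T -> R).
  by apply/funext => w; rewrite -[RHS]/(a * 1) mulr1.
have s1 := sqint_cst P 1; have sc a := sqintZ a s1.
rewrite (c1 (mean t j)) (c1 (mean t k)) !ipBl ?ipBr//; try exact: sqintB.
rewrite !ipZl ?ipZr// (ipC P (cst 1) (incr 0 t k)) -!/(mean _ _) /cvar.
have -> : ip P (cst 1) (cst 1) = 1.
  rewrite /ip; under eq_Rintegral do rewrite mulr1.
  have P1 : fine (P setT) = 1 by rewrite probability_setT.
  by rewrite Rintegral_cst// [fine (_ setT)]P1 mulr1.
ring.
Qed.

(** Covariances are additive in time. On [0, 1] they are bounded through the
    Cauchy-Schwarz inequality by the variances at time 1, as variances increase. *)
Lemma cvar_linear t j k : 0 <= t -> cvar t j k = t * cvar 1 j k.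
Proof.
have c0 i u : 0 <= u -> 0 <= cvar u i i by move=> u0; rewrite cvar_center// ip_ge0.
(* cvar 1 = cvar u + cvar (1 - u), and the last term is nonnegative *)
have cb i u : 0 <= u <= 1 -> cvar u i i <= cvar 1 i i.
  move=> /andP[u0 u1]; have u1' : 0 <= 1 - u by rewrite subr_ge0.
  by rewrite -[1](subrKC u) cvarD// lerDl c0.
move=> t0; apply: (additive_bounded_linear (f := fun t => cvar t j k)
    (C := 1 + cvar 1 j j * cvar 1 k k)) => //; first by move=> *; exact: cvarD.
move=> u u01; have /andP[u0 u1] := u01.
have H : cvar u j k ^+ 2 <= cvar 1 j j * cvar 1 k k.
  rewrite cvar_center//; apply: (le_trans (ip_cauchy_schwarz _ _)).
  - by apply: sqintB; [exact: sqint_incr0|exact: sqint_cst].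
  - by apply: sqintB; [exact: sqint_incr0|exact: sqint_cst].
  - by rewrite -!cvar_center//; apply: ler_pM; rewrite ?c0 ?cb.
apply: le_trans (_ : _ <= 1 + cvar u j k ^+ 2) _; last by rewrite lerD2l.
by case: (ler0P (cvar u j k)) => _; nra.
Qed.

Hypothesis mean1 : forall j, mean 1 j = 0.

Lemma mean_rat (a b : nat) j : mean (a%:R / b.+1%:R) j = 0.
Proof.
have mn n t : 0 <= t -> mean (n%:R * t) j = n%:R * mean t j.
  move=> t0; elim: n => [|n IH].
    by rewrite !mul0r; have := meanD j (lexx 0) (lexx 0); rewrite addr0; lra.
  by rewrite -natr1 !mulrDl !mul1r meanD ?IH// mulr_ge0.
have b0 : 0 <= b.+1%:R^-1 :> R by rewrite invr_ge0.
have : mean 1 j = b.+1%:R * mean b.+1%:R^-1 j.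
  by rewrite -mn// mulfV.
rewrite mean1 mn// => /esym/eqP; rewrite mulf_eq0 pnatr_eq0 /= => /eqP ->.
by rewrite mulr0.
Qed.

(** Additivity alone does not make the mean linear: a discontinuous additive drift has
    stationary independent increments. Right continuity at 0 excludes it. Let r be
    the largest multiple of 1/(n+1) that is at most t. The mean vanishes at r, so the increment
    over [0, t - r] still has mean (mean t), while its variance is O(1/n) and it tends
    to 0 pointwise. Fatou's lemma then bounds (mean t)^2 by 0. *)
Lemma mean0 t j : 0 <= t -> mean t j = 0.
Proof.
move=> t0.
(* The largest multiple of 1/(n+1) that is at most t *)
pose r (n : nat) := (Num.trunc (n.+1%:R * t))%:R / n.+1%:R : R.
have n0 n : 0 < n.+1%:R :> R by [].
have rt n : 0 <= t - r n < n.+1%:R^-1.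
  have /andP[h1 h2] := truncn_itv (mulr_ge0 (ltW (n0 n)) t0).
  rewrite /r subr_ge0 ler_pdivrMr// (mulrC t) h1 /= ltrBlDr -(ltr_pM2l (n0 n)).
  by rewrite mulrDr mulfV ?gt_eqF// mulrCA mulfV ?gt_eqF// mulr1 addrC natr1.
pose s n := t - r n.
have s0 n : 0 <= s n by case/andP: (rt n).
have ms n : mean (s n) j = mean t j.
  have mr : mean (r n) j = 0 by exact: mean_rat.
  have r0 : 0 <= r n by rewrite /r divr_ge0.
  by have := meanD j (s0 n) r0; rewrite mr addr0 subrK.
pose X n := incr 0 (s n) j - cst (mean t j).
have sX n : sqint P (X n) by apply: sqintB; [exact: sqint_incr0|exact: sqint_cst].
have XX n : ip P (X n) (X n) = s n * cvar 1 j j.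
  by rewrite /X -{1 2}(ms n) -cvar_center// cvar_linear.
have scvg : s n @[n --> \oo] --> 0.
  apply: (squeeze_cvgr _ (cvg_cst 0) (@cvg_harmonic R)).
  by apply: nearW => n; case/andP: (rt n) => -> /ltW.
have XX0 : ip P (X n) (X n) @[n --> \oo] --> 0.
  under eq_fun do rewrite XX.
  by rewrite -(mul0r (cvar 1 j j)); apply: cvgM => //; exact: cvg_cst.
have Xw w : X n w @[n --> \oo] --> - mean t j.
  rewrite -[X in _ --> X]add0r; apply: cvgB; last exact: cvg_cst.
  apply/cvgrPdist_lt => e e0.
  case: levyL => /= _ _ _ _ /(_ w j) [/(_ 0 (lexx 0)) + _].
  move=> /cvgrPdist_lt /(_ e e0) [d /= d0 Hd].
  have := scvg => /cvgrPdist_lt /(_ d d0); apply: filterS => n.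
  rewrite sub0r normrN ger0_norm// => snd; rewrite sub0r normrN /incr !mxE.
  have [->|sn] := eqVneq (s n) 0; first by rewrite subrr normr0.
  rewrite distrC; apply: Hd; rewrite /= ?sub0r ?normrN ?ger0_norm//.
  by rewrite lt_neqAle eq_sym sn s0.
have F : (\int[P]_w ((mean t j) ^+ 2)%:E <= 0)%E.
  have := @fatou _ _ _ P setT measurableT (fun n w => ((X n w) ^+ 2)%:E).
  have -> : (\int[P]_w limn_einf (fun n => ((X n w) ^+ 2)%:E) =
      \int[P]_w ((mean t j) ^+ 2)%:E)%E.
    apply: eq_integral => w _; have H : ((X n w) ^+ 2)%:E @[n --> \oo] --> ((mean t j) ^+ 2)%:E.
      apply: cvg_EFin; first exact: nearW.
      rewrite (_ : _ \o _ = fun n => X n w * X n w); last by apply/funext.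
      by rewrite -sqrrN expr2; apply: cvgM.
    rewrite is_cvg_limn_einfE; last by apply/cvg_ex; eexists; exact: H.
    exact: cvg_lim H.
  have -> : limn_einf (fun n => \int[P]_w ((X n w) ^+ 2)%:E)%E = 0%E.
    have H : (\int[P]_w ((X n w) ^+ 2)%:E)%E @[n --> \oo] --> 0%E.
      have -> : (fun n => (\int[P]_w ((X n w) ^+ 2)%:E)%E) =
          (fun n => (ip P (X n) (X n))%:E).
        apply/funext => n; rewrite /ip /Rintegral fineK//.
        exact: integrable_fin_num (sX n).2.
      by apply: cvg_EFin; first exact: nearW.
    rewrite is_cvg_limn_einfE; last by apply/cvg_ex; eexists; exact: H.
    exact: cvg_lim H.
  apply.
  - move=> n; apply/measurable_EFinP; apply: measurable_funX; exact: (sX n).1.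
  - by move=> n w _; rewrite lee_fin sqr_ge0.
have P1 : P setT = 1%E by exact: probability_setT.
move: F; rewrite integral_cst// [X in (_ * X)%E]P1 mule1 lee_fin => F.
by apply/eqP; rewrite -sqrf_eq0 eq_le F sqr_ge0.
Qed.

Lemma levy_incr_mean s t j : 0 <= s -> s <= t -> ip P (incr s t j) (cst 1) = 0.
Proof. by move=> s0 st; rewrite mean_incr// mean0// subr_ge0. Qed.

Lemma levy_incr_orth s t u v j k : 0 <= s -> s <= t -> t <= u -> u <= v ->
  ip P (incr s t j) (incr u v k) = 0.
Proof. by move=> s0 st tu uv; rewrite indep_incr_ip// mean0 ?mul0r// subr_ge0. Qed.

Lemma levy_incr_cov s t j k : 0 <= s -> s <= t ->
  ip P (incr s t j) (incr s t k) = (t - s) * ip P (incr 0 1 j) (incr 0 1 k).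
Proof.
move=> s0 st; rewrite stationary_ip//; have := @cvar_linear (t - s) j k.
by rewrite /cvar !mean0 ?subr_ge0// !mul0r !subr0 => ->.
Qed.

End LevyMoments.

(** * Integrals of deterministic functions against a Levy process *)

Section WienerIntegral.
Context {dT : measure_display} {T : measurableType dT} {R : realType}.
Variables (P : probability T R) (m : nat) (L : R -> T -> 'cV[R]_m).
Hypothesis levyL : levy_process P L.
Hypothesis sq1 : forall j : 'I_m, sqint P (incr L 0 1 j).
Hypothesis mean1 : forall j : 'I_m, ip P (incr L 0 1 j) (cst 1) = 0.
Variable h : R.
Hypothesis h0 : 0 < h.

(** All integrals run between multiples of h, so one grid with K cells in each interval
    of length h serves them simultaneously. *)
Definition grid (K i : nat) : R := i%:R * (h / K%:R).

(** The integral of the step function equal to c i on the i-th cell. *)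
Definition wsum (K a b : nat) (c : nat -> 'I_m -> R) : T -> R :=
  \sum_(a <= i < b) \sum_j c i j *: incr L (grid K i) (grid K i.+1) j.

Definition cov1 (j k : 'I_m) : R := ip P (incr L 0 1 j) (incr L 0 1 k).

Definition cform (x y : 'I_m -> R) : R := \sum_j \sum_k x j * y k * cov1 j k.

Lemma hK_ge0 K : 0 <= h / K%:R.
Proof. by rewrite divr_ge0// ltW. Qed.

Lemma grid_ge0 K i : 0 <= grid K i.
Proof. by rewrite mulr_ge0// hK_ge0. Qed.

Lemma grid_le K i i' : (i <= i')%N -> grid K i <= grid K i'.
Proof. by move=> ii'; rewrite ler_wpM2r ?hK_ge0// ler_nat. Qed.

Lemma sqint_dL K i j : sqint P (incr L (grid K i) (grid K i.+1) j).
Proof. by apply: sqint_incr => //; [exact: grid_ge0|exact: grid_le]. Qed.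

Lemma sqint_cdL K i (c : 'I_m -> R) :
  sqint P (\sum_j c j *: incr L (grid K i) (grid K i.+1) j).
Proof. by apply: sqint_sum => j _; apply: sqintZ; exact: sqint_dL. Qed.

Lemma sqint_wsum K a b c : sqint P (wsum K a b c).
Proof. by apply: sqint_sum => i _; exact: sqint_cdL. Qed.

Lemma measurable_wsum K a b c : measurable_fun [set: T] (wsum K a b c).
Proof. exact: (sqint_wsum K a b c).1. Qed.

Lemma wsum_mean K a b c : ip P (wsum K a b c) (cst 1) = 0.
Proof.
have s1 := sqint_cst P 1.
rewrite ip_suml//; last by move=> i _; exact: sqint_cdL.
rewrite big1// => i _; rewrite ip_suml//; last by move=> j _; apply: sqintZ; exact: sqint_dL.
rewrite big1// => j _; rewrite ipZl//; last exact: sqint_dL.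
by rewrite levy_incr_mean ?mulr0//; [exact: grid_ge0|exact: grid_le].
Qed.

Lemma ip_cdL_orth K i i' (c c' : 'I_m -> R) : (i < i')%N ->
  ip P (\sum_j c j *: incr L (grid K i) (grid K i.+1) j)
       (\sum_j c' j *: incr L (grid K i') (grid K i'.+1) j) = 0.
Proof.
move=> ii'; rewrite ip_suml//; last 2 first.
  by move=> j _; apply: sqintZ; exact: sqint_dL.
  exact: sqint_cdL.
rewrite big1// => j _; rewrite ip_sumr//; last 2 first.
  by move=> k _; apply: sqintZ; exact: sqint_dL.
  by apply: sqintZ; exact: sqint_dL.
rewrite big1// => k _; rewrite ipZl ?ipZr; last 4 first.
- exact: sqint_dL.
- exact: sqint_dL.
- exact: sqint_dL.
- by apply: sqintZ; exact: sqint_dL.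
rewrite levy_incr_orth ?mulr0//; by [exact: grid_ge0|exact: grid_le].
Qed.

Lemma ip_cdL K i (c c' : 'I_m -> R) :
  ip P (\sum_j c j *: incr L (grid K i) (grid K i.+1) j)
       (\sum_j c' j *: incr L (grid K i) (grid K i.+1) j) =
  h / K%:R * cform c c'.
Proof.
rewrite /cform mulr_sumr ip_suml//; last 2 first.
  by move=> j _; apply: sqintZ; exact: sqint_dL.
  exact: sqint_cdL.
apply: eq_bigr => j _; rewrite mulr_sumr ip_sumr//; last 2 first.
  by move=> k _; apply: sqintZ; exact: sqint_dL.
  by apply: sqintZ; exact: sqint_dL.
apply: eq_bigr => k _; rewrite ipZl ?ipZr; last 4 first.
- exact: sqint_dL.
- exact: sqint_dL.
- exact: sqint_dL.
- by apply: sqintZ; exact: sqint_dL.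
rewrite levy_incr_cov//; [|exact: grid_ge0|exact: grid_le].
by rewrite /grid -natr1 /cov1; ring.
Qed.

(** Increments over distinct cells are uncorrelated, so only the diagonal remains. *)
Lemma ip_wsum K a b c c' :
  ip P (wsum K a b c) (wsum K a b c') =
  \sum_(a <= i < b) h / K%:R * cform (c i) (c' i).
Proof.
rewrite ip_suml; [|by move=> i _; exact: sqint_cdL|exact: sqint_wsum].
rewrite !big_nat; apply: eq_bigr => i iab.
rewrite ip_sumr; [|by move=> ? _; exact: sqint_cdL|exact: sqint_cdL].
rewrite (bigD1_seq i) ?mem_index_iota ?iota_uniq//= ip_cdL big1 ?addr0// => i' ii'.
have [lt|lt] := ltnP i i'; first exact: ip_cdL_orth.
by rewrite ipC; apply: ip_cdL_orth; rewrite ltn_neqAle ii'.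
Qed.

Lemma ip_wsum_orth K a b a' b' c c' : (b <= a')%N ->
  ip P (wsum K a b c) (wsum K a' b' c') = 0.
Proof.
move=> ba'; rewrite ip_suml; [|by move=> i _; exact: sqint_cdL|exact: sqint_wsum].
rewrite big_nat big1// => i /andP[_ ib].
rewrite ip_sumr; [|by move=> ? _; exact: sqint_cdL|exact: sqint_cdL].
rewrite big_nat big1// => i' /andP[a'i' _].
by apply: ip_cdL_orth; exact: leq_trans ib (leq_trans ba' a'i').
Qed.

Lemma wsumB K a b c c' :
  wsum K a b c - wsum K a b c' = wsum K a b (fun i j => c i j - c' i j).
Proof.
rewrite /wsum -sumrB; apply: eq_bigr => i _; rewrite -sumrB; apply: eq_bigr => j _.
by rewrite scalerBl.
Qed.

Lemma sum_nat_blocks (V : zmodType) (F : nat -> V) M a b : (a <= b)%N ->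
  \sum_(a <= i < b) \sum_(i * M <= l < i.+1 * M) F l = \sum_(a * M <= l < b * M) F l.
Proof.
elim: b => [|b IH]; first by rewrite leqn0 => /eqP ->; rewrite !big_geq.
rewrite leq_eqVlt => /predU1P[->|]; first by rewrite !big_geq.
rewrite ltnS => ab; rewrite big_nat_recr//= IH//.
by rewrite -big_cat_nat //= leq_mul2r ?ab ?leqnSn orbT.
Qed.

Lemma grid_mul K M i : (0 < M)%N -> grid (K * M) (i * M) = grid K i.
Proof.
move=> M0; rewrite /grid !natrM; have [->|K0] := posnP K.
  by rewrite !mul0r !invr0 !mulr0.
by field; rewrite !pnatr_eq0 -!lt0n K0 M0.
Qed.

Lemma incr_refine K M i j : (0 < M)%N ->
  incr L (grid K i) (grid K i.+1) j =
  \sum_(i * M <= l < i.+1 * M) incr L (grid (K * M) l) (grid (K * M) l.+1) j.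
Proof.
move=> M0; apply/funext => w; rewrite fct_sumE /incr.
rewrite (eq_bigr (fun l => L (grid (K * M) l.+1) w j 0 - L (grid (K * M) l) w j 0)); last first.
  by move=> l _; rewrite !mxE.
rewrite telescope_sumr; last by rewrite leq_mul2r leqnSn orbT.
by rewrite !grid_mul// !mxE.
Qed.

(** Each coarse increment telescopes into the M finer ones. *)
Lemma wsum_refine K M a b c : (0 < M)%N -> (a <= b)%N ->
  wsum K a b c = wsum (K * M) (a * M) (b * M) (fun l => c (l %/ M)%N).
Proof.
move=> M0 ab; rewrite /wsum -sum_nat_blocks//; apply: eq_bigr => i _.
rewrite [RHS]big_nat.
rewrite (eq_bigr (fun l => \sum_j c i j *: incr L (grid (K * M) l) (grid (K * M) l.+1) j)).
  rewrite -big_nat exchange_big /=; apply: eq_bigr => j _.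
  by rewrite (incr_refine _ _ _ M0) scaler_sumr.
move=> l /andP[l1 l2]; suff -> : (l %/ M)%N = i by [].
by apply/eqP; rewrite eqn_leq leq_divRL// l1 -ltnS ltn_divLR// l2.
Qed.

Definition lip_on (B : R) (phi : R -> 'I_m -> R) : Prop :=
  exists2 C, 0 <= C & forall u v j, 0 <= u <= B -> 0 <= v <= B ->
    `|phi u j - phi v j| <= C * `|u - v|.

(** The index K stands for K + 1 cells in each interval of length h, so that no sum is
    degenerate. *)
Definition rsum (a b : nat) (phi : R -> 'I_m -> R) (K : nat) : T -> R :=
  wsum K.+1 (a * K.+1) (b * K.+1) (fun i => phi (grid K.+1 i)).

Lemma ip_wsum_le K a b c e : 0 <= e ->
  (forall i j, (a <= i < b)%N -> `|c i j| <= e) ->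
  ip P (wsum K a b c) (wsum K a b c) <=
  (b - a)%:R * (h / K%:R) * (e ^+ 2 * \sum_j \sum_k `|cov1 j k|).
Proof.
move=> e0 ce; rewrite ip_wsum.
set Q := e ^+ 2 * _.
have -> : (b - a)%:R * (h / K%:R) * Q = \sum_(a <= i < b) h / K%:R * Q.
  by rewrite sumr_const_nat -mulrA mulr_natl.
rewrite !big_nat; apply: ler_sum => i iab; rewrite ler_wpM2l ?hK_ge0//.
rewrite /Q mulr_sumr; apply: ler_sum => j _; rewrite mulr_sumr; apply: ler_sum => k _.
apply: (le_trans (ler_norm _)); rewrite !normrM ler_wpM2r//.
by rewrite expr2 ler_pM// ce.
Qed.

Lemma grid_mul_dist K M l : (0 < M)%N ->
  `|grid K (l %/ M) - grid (K * M) l| <= h / K%:R.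
Proof.
move=> M0.
have h1 : grid K (l %/ M) <= grid (K * M) l by rewrite -(@grid_mul K M (l %/ M))// grid_le// leq_divM.
have h2 : grid (K * M) l <= grid K (l %/ M).+1.
  by rewrite -(@grid_mul K M (l %/ M).+1)// grid_le// ltnW// ltn_ceil.
rewrite distrC ger0_norm ?subr_ge0//.
have -> : h / K%:R = grid K (l %/ M).+1 - grid K (l %/ M) by rewrite /grid -natr1; ring.
by rewrite lerD2r.
Qed.

Lemma grid_end K a : (0 < K)%N -> grid K (a * K) = a%:R * h.
Proof. by move=> K0; rewrite -{1}[K]mul1n grid_mul// /grid divr1. Qed.

(** Seen on the finer grid, the two step functions differ by at most C h / (K + 1), and
    [ip_wsum_le] turns this into a bound that does not depend on M. *)
Lemma rsum_refine_le a b phi : (a <= b)%N -> lip_on (b%:R * h) phi ->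
  exists2 D, 0 <= D & forall K M,
    ip P (rsum a b phi K - rsum a b phi (K.+1 * M.+1).-1)
         (rsum a b phi K - rsum a b phi (K.+1 * M.+1).-1) <= D * (K.+1%:R^-1) ^+ 2.
Proof.
move=> ab [C C0 phiC].
pose S1 := \sum_j \sum_k `|cov1 j k|.
have S10 : 0 <= S1 by apply: sumr_ge0 => j _; apply: sumr_ge0.
exists ((b - a)%:R * h * (C * h) ^+ 2 * S1).
  by rewrite !mulr_ge0// ?sqr_ge0// ltW.
move=> K M; rewrite /rsum prednK// (@wsum_refine K.+1 M.+1) ?leq_mul2r ?ab ?orbT//.
rewrite -(mulnA a K.+1) -(mulnA b K.+1) wsumB.
have e0 : 0 <= C * (h / K.+1%:R) by rewrite mulr_ge0// hK_ge0.
apply: le_trans.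
  apply: (ip_wsum_le _ e0) => l j /andP[_ lb].
  have g1 : 0 <= grid (K.+1 * M.+1) l <= b%:R * h.
    by rewrite grid_ge0 -(@grid_end (K.+1 * M.+1))// grid_le// ltnW.
  have g2 : 0 <= grid K.+1 (l %/ M.+1) <= b%:R * h.
    rewrite grid_ge0 -(@grid_mul _ M.+1)// -(@grid_end (K.+1 * M.+1))// grid_le//.
    by apply: leq_trans (leq_divM _ _) _; exact: ltnW.
  by apply: (le_trans (phiC _ _ _ g2 g1)); rewrite ler_wpM2l// grid_mul_dist.
rewrite -mulnBl -/S1 natrM le_eqVlt; apply/orP; left; apply/eqP.
have xn : (K.+1%:R : R) != 0 by rewrite pnatr_eq0.
have yn : (M.+1%:R : R) != 0 by rewrite pnatr_eq0.
rewrite !natrM; move: (K.+1%:R : R) (M.+1%:R : R) ((b - a)%:R : R) xn yn => x y z xn yn.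
by field; rewrite xn yn.
Qed.

Lemma measurable_rsum a b phi K : measurable_fun [set: T] (rsum a b phi K).
Proof. exact: measurable_wsum. Qed.

Lemma sqint_rsum a b phi K : sqint P (rsum a b phi K).
Proof. exact: sqint_wsum. Qed.

(** As M grows, the difference of the sums of index K and (K + 1)(M + 1) - 1 tends in
    probability to the difference between the first one and I; Fatou's lemma passes
    the bound of [rsum_refine_le] to it. Hence the limit in probability is a limit in L2. *)
Lemma wiener_l2 a b phi I : (a <= b)%N -> lip_on (b%:R * h) phi ->
  measurable_fun [set: T] I -> cvg_prob P (rsum a b phi) I ->
  sqint P I /\ l2cvg P (rsum a b phi) I.
Proof.
move=> ab lphi mI SI; have [D D0 HD] := rsum_refine_le ab lphi.
have H K : sqint P (rsum a b phi K - I) /\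
    ip P (rsum a b phi K - I) (rsum a b phi K - I) <= D * (K.+1%:R^-1) ^+ 2.
  apply: (@cvg_prob_fatou _ _ _ P
    (fun M => rsum a b phi K - rsum a b phi (K.+1 * M.+1).-1)).
  - by move=> M; apply: sqintB; exact: sqint_rsum.
  - by apply: measurable_funB => //; exact: measurable_rsum.
  - apply: (cvg_probB (S := fun=> rsum a b phi K)
             (S' := rsum a b phi \o (fun M => (K.+1 * M.+1).-1))) => //.
    + by move=> ?; exact: measurable_rsum.
    + by move=> ?; exact: measurable_rsum.
    + exact: measurable_rsum.
    + exact: cvg_prob_cst.
    + by apply: cvg_prob_subseq => // n; rewrite mulSn addSn /= -/(addn _ _) leq_addr.
  - by move=> M; exact: HD.
split.
  have [H1 _] := H 0%N.
  rewrite -[I](subKr (rsum a b phi 0)); apply: sqintB => //; exact: sqint_rsum.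
have hc : D * (K.+1%:R^-1) ^+ 2 @[K --> \oo] --> (0 : R).
  rewrite -(mulr0 D) -(mulr0 0); apply: cvgM; first exact: cvg_cst.
  under eq_fun do rewrite expr2.
  by apply: cvgM; exact: cvg_harmonic.
apply: (squeeze_cvgr _ (cvg_cst 0) hc); apply: nearW => K.
by rewrite ip_ge0 /=; case: (H K).
Qed.

Lemma wiener_mean a b phi I : (a <= b)%N -> lip_on (b%:R * h) phi ->
  measurable_fun [set: T] I -> cvg_prob P (rsum a b phi) I -> ip P I (cst 1) = 0.
Proof.
move=> ab lphi mI SI; have [sI cI] := wiener_l2 ab lphi mI SI.
have s1 := sqint_cst P 1.
have c1 : l2cvg P (fun=> cst 1) (cst 1).
  by rewrite /l2cvg; under eq_fun do rewrite subrr ip0l; exact: cvg_cst.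
have := l2cvg_ip (sqint_rsum a b phi) (fun=> s1) sI s1 cI c1.
under eq_fun do rewrite wsum_mean.
by move=> /cvg_lim <- //; exact: lim_cst.
Qed.

Lemma wiener_orth a b a' b' phi psi I J : (a <= b)%N -> (b <= a')%N -> (a' <= b')%N ->
  lip_on (b%:R * h) phi -> lip_on (b'%:R * h) psi ->
  measurable_fun [set: T] I -> cvg_prob P (rsum a b phi) I ->
  measurable_fun [set: T] J -> cvg_prob P (rsum a' b' psi) J ->
  ip P I J = 0.
Proof.
move=> ab ba' ab' lphi lpsi mI SI mJ SJ.
have [sI cI] := wiener_l2 ab lphi mI SI; have [sJ cJ] := wiener_l2 ab' lpsi mJ SJ.
have := l2cvg_ip (sqint_rsum a b phi) (sqint_rsum a' b' psi) sI sJ cI cJ.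
under eq_fun do rewrite ip_wsum_orth ?leq_mul2r ?ba' ?orbT//.
by move=> /cvg_lim <- //; exact: lim_cst.
Qed.

Lemma wiener_isometry a b phi psi I J : (a <= b)%N ->
  lip_on (b%:R * h) phi -> lip_on (b%:R * h) psi ->
  measurable_fun [set: T] I -> cvg_prob P (rsum a b phi) I ->
  measurable_fun [set: T] J -> cvg_prob P (rsum a b psi) J ->
  (\sum_(a * K.+1 <= i < b * K.+1)
     h / K.+1%:R * cform (phi (grid K.+1 i)) (psi (grid K.+1 i))) @[K --> \oo] --> ip P I J.
Proof.
move=> ab lphi lpsi mI SI mJ SJ.
have [sI cI] := wiener_l2 ab lphi mI SI; have [sJ cJ] := wiener_l2 ab lpsi mJ SJ.
have := l2cvg_ip (sqint_rsum a b phi) (sqint_rsum a b psi) sI sJ cI cJ.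
by under eq_fun do rewrite ip_wsum.
Qed.

Lemma Re_normc_le (R' : realType) (z : R'[i]) : `|complex.Re z| <= Normc.normc z.
Proof.
case: z => x y /=; rewrite -sqrtr_sqr ler_wsqrtr// lerDl sqr_ge0 //.
Qed.

Lemma Im_normc_le (R' : realType) (z : R'[i]) : `|complex.Im z| <= Normc.normc z.
Proof.
case: z => x y /=; rewrite -sqrtr_sqr ler_wsqrtr// lerDr sqr_ge0 //.
Qed.

Lemma ReE_sum (R' : realType) I (r : seq I) (Q : pred I) (F : I -> R'[i]) :
  complex.Re (\sum_(i <- r | Q i) F i) = \sum_(i <- r | Q i) complex.Re (F i).
Proof. by apply: (big_morph (@complex.Re R')) => // -[? ?] [? ?]. Qed.

Lemma ImE_sum (R' : realType) I (r : seq I) (Q : pred I) (F : I -> R'[i]) :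
  complex.Im (\sum_(i <- r | Q i) F i) = \sum_(i <- r | Q i) complex.Im (F i).
Proof. by apply: (big_morph (@complex.Im R')) => // -[? ?] [? ?]. Qed.

Definition upart (a b K : nat) : seq R :=
  [seq grid K (a * K + i.+1) | i <- iota 0 ((b - a) * K)].

Lemma size_upart a b K : size (upart a b K) = ((b - a) * K)%N.
Proof. by rewrite size_map size_iota. Qed.

Lemma nth_upart a b K i x : (0 < K)%N -> (i <= (b - a) * K)%N ->
  nth x (a%:R * h :: upart a b K) i = grid K (a * K + i).
Proof.
move=> K0; case: i => [_|i Hi] /=; first by rewrite addn0 grid_end.
by rewrite (nth_map 0%N) ?size_iota// nth_iota// add0n.
Qed.

Lemma upart_partition a b K : (0 < K)%N -> (a <= b)%N ->
  itv_partition (a%:R * h) (b%:R * h) (upart a b K).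
Proof.
move=> K0 ab; split.
  apply/(pathP 0) => i; rewrite size_upart => Hi.
  rewrite nth_upart//; last exact: ltnW.
  have := @nth_upart a b K i.+1 0 K0 Hi => /= ->.
  by rewrite /grid ltr_pM2r ?divr_gt0// ?ltr0n// ltr_nat ltn_add2l.
rewrite (last_nth (0 : R)) size_upart nth_upart// -mulnDl subnKC// grid_end//.
Qed.

Lemma mesh_upart a b K : (0 < K)%N -> (a <= b)%N ->
  mesh (a%:R * h) (upart a b K) (b%:R * h) <= h / K%:R.
Proof.
move=> K0 ab; rewrite /mesh; apply: (big_ind (fun x => x <= h / K%:R)).
- exact: hK_ge0.
- by move=> x y hx hy; rewrite ge_max hx hy.
move=> [i Hi] _; rewrite /= size_upart in Hi *.
rewrite -[nth _ (upart a b K) i]/(nth (b%:R * h) (a%:R * h :: upart a b K) i.+1).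
rewrite !nth_upart//; last exact: ltnW.
by rewrite /grid addnS -natr1 le_eqVlt; apply/orP; left; apply/eqP; ring.
Qed.

(** The increments of L are real, so the real and imaginary parts of the integrand can
    be integrated separately. *)
Lemma riemann_sum_upart d (f : R -> 'M[R[i]]_(d, m)) a b K (i : 'I_d) w :
  (0 < K)%N -> (a <= b)%N ->
  (riemann_sum f L (a%:R * h) (b%:R * h) (upart a b K) w) i 0 =
  Complex (wsum K (a * K) (b * K) (fun l j => complex.Re (f (grid K l) i j)) w)
          (wsum K (a * K) (b * K) (fun l j => complex.Im (f (grid K l) i j)) w).
Proof.
move=> K0 ab; rewrite /riemann_sum summxE.
rewrite (eq_bigr (fun l : 'I_(size (upart a b K)) => \sum_j
   (f (grid K (a * K + l)) i j *
     (real_complex R (incr L (grid K (a * K + l)) (grid K (a * K + l).+1) j w))))); last first.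
  move=> [l Hl] _; rewrite /= size_upart in Hl *.
  rewrite -[nth _ (upart a b K) l]/(nth (b%:R * h) (a%:R * h :: upart a b K) l.+1).
  rewrite !nth_upart//; last exact: ltnW.
  by rewrite mxE; apply: eq_bigr => j _; rewrite addnS /incr !mxE.
rewrite -(big_mkord xpredT (fun l => \sum_j
   (f (grid K (a * K + l)) i j *
     (real_complex R (incr L (grid K (a * K + l)) (grid K (a * K + l).+1) j w))))).
rewrite size_upart mulnBl.
under eq_bigr do rewrite addnC.
rewrite -(big_addn 0 (b * K) (a * K) xpredT (fun l => \sum_j
   (f (grid K l) i j * (real_complex R (incr L (grid K l) (grid K l.+1) j w))))) add0n.
apply/eqP; rewrite eq_complex /= /wsum !fct_sumE; apply/andP; split; apply/eqP.
  rewrite ReE_sum; apply: eq_bigr => l _; rewrite fct_sumE ReE_sum; apply: eq_bigr => j _.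
  by case: (f _ i j) => x y; rewrite /= mulr0 subr0.
rewrite ImE_sum; apply: eq_bigr => l _; rewrite fct_sumE ImE_sum; apply: eq_bigr => j _.
by case: (f _ i j) => x y; rewrite /= mulr0 add0r.
Qed.

(** It suffices to know the limit along the uniform partitions, whose mesh tends to 0. *)
Lemma stoch_integral_cvg d (f : R -> 'M[R[i]]_(d, m)) a b I (i : 'I_d) :
  (a <= b)%N -> is_stoch_integral P f L (a%:R * h) (b%:R * h) I ->
  cvg_prob P (rsum a b (fun u j => complex.Re (f u i j))) (fun w => complex.Re (I w i 0)) /\
  cvg_prob P (rsum a b (fun u j => complex.Im (f u i j))) (fun w => complex.Im (I w i 0)).
Proof.
move=> ab [cI fI].
have main (g : R[i] -> R) : (forall z, `|g z| <= Normc.normc z) ->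
    (forall x y, g (x - y) = g x - g y) ->
    (forall K, measurable_fun [set: T] (fun w =>
       g (riemann_sum f L (a%:R * h) (b%:R * h) (upart a b K.+1) w i 0))) ->
    measurable_fun [set: T] (fun w => g (I w i 0)) ->
    cvg_prob P (fun K w => g (riemann_sum f L (a%:R * h) (b%:R * h) (upart a b K.+1) w i 0))
     (fun w => g (I w i 0)).
  move=> gle gB mgS mgI e1 e2 e10 e20.
  have [eta eta0 H] := fI i e1 e2 e10 e20.
  have h_eta : 0 <= h / eta by rewrite divr_ge0// ltW.
  exists (Num.bound (h / eta)) => K HK.
  have hKe : h / K.+1%:R < eta.
    rewrite ltr_pdivrMr// mulrC -ltr_pdivrMr//.
    by apply: (lt_trans (archi_boundP h_eta)); rewrite ltr_nat ltnS.
  have part := @upart_partition a b K.+1 isT ab.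
  apply: le_trans (H _ part (le_lt_trans (@mesh_upart a b K.+1 isT ab) hKe)).
  apply: le_measure; rewrite ?inE.
  - by apply: measurable_dist_set; [exact: mgS|exact: mgI].
  - apply: measurable_ge_set.
    have -> : (fun w => Normc.normc ((riemann_sum f L (a%:R * h) (b%:R * h)
        (upart a b K.+1) w - I w) i 0)) =
      (fun w => Num.sqrt (complex.Re ((riemann_sum f L (a%:R * h) (b%:R * h)
        (upart a b K.+1) w - I w) i 0) ^+ 2 +
          complex.Im ((riemann_sum f L (a%:R * h) (b%:R * h)
        (upart a b K.+1) w - I w) i 0) ^+ 2)).
      by apply/funext => w; case: (_ i 0).
    apply: measurableT_comp => //.
      by apply: continuous_measurable_fun; exact: sqrt_continuous.
    apply: measurable_funD; apply: measurable_funX.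
      rewrite (_ : (fun w => _) = wsum K.+1 (a * K.+1) (b * K.+1)
         (fun l j => complex.Re (f (grid K.+1 l) i j)) - (fun w => complex.Re (I w i 0))).
        by apply: measurable_funB; [exact: measurable_wsum|case: (cI i)].
      by apply/funext => w; rewrite !fctE 2!mxE riemann_sum_upart//; case: (I w i 0).
    rewrite (_ : (fun w => _) = wsum K.+1 (a * K.+1) (b * K.+1)
         (fun l j => complex.Im (f (grid K.+1 l) i j)) - (fun w => complex.Im (I w i 0))).
      by apply: measurable_funB; [exact: measurable_wsum|case: (cI i)].
    by apply/funext => w; rewrite !fctE 2!mxE riemann_sum_upart//; case: (I w i 0).
  - move=> w /= /le_trans; apply; rewrite -gB.
    by rewrite (_ : _ - _ = (riemann_sum f L (a%:R * h) (b%:R * h)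
        (upart a b K.+1) w - I w) i 0) ?gle// 2!mxE.
have [mRe mIm] := cI i.
have eRe K : (fun w => complex.Re (riemann_sum f L (a%:R * h) (b%:R * h)
   (upart a b K.+1) w i 0)) = rsum a b (fun u j => complex.Re (f u i j)) K.
  by apply/funext => w; rewrite riemann_sum_upart.
have eIm K : (fun w => complex.Im (riemann_sum f L (a%:R * h) (b%:R * h)
   (upart a b K.+1) w i 0)) = rsum a b (fun u j => complex.Im (f u i j)) K.
  by apply/funext => w; rewrite riemann_sum_upart.
split.
  rewrite (_ : rsum _ _ _ = fun K => rsum a b (fun u j => complex.Re (f u i j)) K)//.
  under eq_fun do rewrite -eRe; apply: main => //.
  - exact: Re_normc_le.
  - by move=> [? ?] [? ?].
  - by move=> K; rewrite eRe; exact: measurable_rsum.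
rewrite (_ : rsum _ _ _ = fun K => rsum a b (fun u j => complex.Im (f u i j)) K)//.
under eq_fun do rewrite -eIm; apply: main => //.
- exact: Im_normc_le.
- by move=> [? ?] [? ?].
- by move=> K; rewrite eIm; exact: measurable_rsum.
Qed.

End WienerIntegral.

(** * Bounded Lipschitz functions and Riemann sums *)

Section BoundedLipschitz.
Context {R : realType}.
Implicit Types (g : R -> R) (B : R).

(** Boundedness is included in order that products remain in the class. *)
Definition lipb B g : Prop := exists2 C : R, 0 <= C &
  (forall u, 0 <= u <= B -> `|g u| <= C) /\
  (forall u v, 0 <= u <= B -> 0 <= v <= B -> `|g u - g v| <= C * `|u - v|).

Lemma lipb_cst B (a : R) : lipb B (fun=> a).
Proof.
exists `|a| => //; split => // u v _ _.
by rewrite subrr normr0 mulr_ge0.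
Qed.

Lemma lipbD B g1 g2 : lipb B g1 -> lipb B g2 -> lipb B (fun u => g1 u + g2 u).
Proof.
move=> [C1 C10 [b1 l1]] [C2 C20 [b2 l2]]; exists (C1 + C2); first exact: addr_ge0.
split=> [u uB|u v uB vB]; first by rewrite (le_trans (ler_normD _ _))// lerD ?b1 ?b2.
rewrite opprD addrACA (le_trans (ler_normD _ _))// mulrDl lerD ?l1 ?l2//.
Qed.

Lemma lipbM B g1 g2 : lipb B g1 -> lipb B g2 -> lipb B (fun u => g1 u * g2 u).
Proof.
move=> [C1 C10 [b1 l1]] [C2 C20 [b2 l2]]; exists (C1 * C2 + C1 * C2).
  by rewrite addr_ge0// mulr_ge0.
split=> [u uB|u v uB vB].
  rewrite normrM; apply: (@le_trans _ _ (C1 * C2)); first by rewrite ler_pM ?b1 ?b2.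
  by rewrite lerDl mulr_ge0.
rewrite (_ : _ - _ = g1 u * (g2 u - g2 v) + (g1 u - g1 v) * g2 v); last ring.
rewrite (le_trans (ler_normD _ _))// !normrM mulrDl lerD//.
  by rewrite -mulrA ler_pM ?b1 ?l2.
by rewrite mulrAC ler_pM ?b2 ?l1.
Qed.

Lemma lipb_sum B (I : Type) (r : seq I) (F : I -> R -> R) :
  (forall i, lipb B (F i)) -> lipb B (fun u => \sum_(i <- r) F i u).
Proof.
move=> lF; elim: r => [|i r IH].
  by under eq_fun do rewrite big_nil; exact: lipb_cst.
by under eq_fun do rewrite big_cons; exact: lipbD.
Qed.

Lemma lipbN B g : lipb B g -> lipb B (fun u => - g u).
Proof.
by move=> lg; under eq_fun do rewrite -mulN1r; apply: lipbM => //; exact: lipb_cst.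
Qed.

Lemma lipb_rev B g : lipb B g -> lipb B (fun u => g (B - u)).
Proof.
have e u : 0 <= u <= B -> 0 <= B - u <= B by lra.
move=> [C C0 [b l]]; exists C => //; split=> [u uB|u v uB vB]; first by rewrite b ?e.
apply: (le_trans (l _ _ (e _ uB) (e _ vB))).
by rewrite (_ : B - u - (B - v) = v - u) 1?distrC//; ring.
Qed.

Lemma lipb_le B B' g : B' <= B -> lipb B g -> lipb B' g.
Proof.
have e u : B' <= B -> 0 <= u <= B' -> 0 <= u <= B by lra.
move=> BB [C C0 [b l]]; exists C => //; split=> [u uB|u v uB vB]; first exact/b/e.
by apply: l; apply: e.
Qed.

Local Notation mu := (@lebesgue_measure R).

Lemma lipb_integrable B g : 0 <= B -> lipb B g -> mu.-integrable `[0, B] (EFin \o g).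
Proof.
move=> B0 [C C0 [_ l]]; apply: continuous_compact_integrable; first exact: segment_compact.
apply/subspace_continuousP => x /=; rewrite in_itv /= => xB.
apply/cvgrPdist_le => e e0.
have d0 : 0 < e / (C + 1) by rewrite divr_gt0//; lra.
near=> u.
have uB : 0 <= u <= B.
  have : (`[0, B]%classic u) by near: u; exact: withinT.
  by rewrite /= in_itv.
apply: (le_trans (l _ _ xB uB)).
have : `|x - u| <= e / (C + 1).
  near: u; apply: (@cvg_within _ (nbhs x)).
  by move/cvgrPdist_le : (@cvg_id _ (nbhs x)) => /(_ _ d0).
rewrite ler_pdivlMr; last lra.
by have := normr_ge0 (x - u); nra.
Unshelve. all: by end_near. Qed.

(** The integrand deviates from its value at the right end by at most C (b - a). *)
Lemma riemann_cell g C (a b B : R) : 0 <= a -> a < b -> b <= B ->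
  mu.-integrable `[0, B] (EFin \o g) ->
  (forall u v, 0 <= u <= B -> 0 <= v <= B -> `|g u - g v| <= C * `|u - v|) -> 0 <= C ->
  `|\int[mu]_(x in `[0, b]) g x - \int[mu]_(x in `[0, a]) g x - (b - a) * g b|
     <= C * (b - a) ^+ 2.
Proof.
move=> a0 ab bB ig lg C0.
have ig1 : mu.-integrable `[0, b] (EFin \o g).
  by apply: integrableS ig => //; apply: subset_itvl; rewrite bnd_simp.
rewrite Rintegral_itvB ?bnd_simp ?(ltW ab)//.
have ig2 : mu.-integrable `]a, b] (EFin \o g).
  by apply: integrableS ig1 => //; apply: subset_itvr; rewrite bnd_simp.
have mE : mu `]a, b] = (b - a)%:E by rewrite lebesgue_measure_itv /= lte_fin ab.
have mF : fine (mu `]a, b]) = b - a by rewrite mE.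
have ic (c : R) : mu.-integrable `]a, b] (EFin \o cst c).
  have mEy : (mu `]a, b] < +oo)%E by rewrite mE ltry.
  apply: (@measurable_bounded_integrable _ _ _ mu (cst c) `]a, b]) => //.
  exact: bounded_cst.
rewrite (_ : (b - a) * g b = \int[mu]_(x in `]a, b]) cst (g b) x); last first.
  by rewrite Rintegral_cst// [fine _]mF mulrC.
rewrite -RintegralB//.
have igB : mu.-integrable `]a, b] (EFin \o (fun x => g x - cst (g b) x)).
  apply: eq_integrable (integrableB _ ig2 (ic (g b))) => //.
apply: (le_trans (le_normr_Rintegral _ _)) => //.
have -> : C * (b - a) ^+ 2 = \int[mu]_(x in `]a, b]) cst (C * (b - a)) x.
  by rewrite Rintegral_cst// [fine _]mF; ring.
apply: le_Rintegral => //.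
  exact: integrable_norm igB.
move=> x /=; rewrite in_itv /= => /andP[ax xb].
apply: (le_trans (lg _ _ _ _)); [by lra|by lra|].
by rewrite ler_wpM2l// distrC ger0_norm; lra.
Qed.

(** Right endpoints occur because the kernels run backwards in time, with n h - u in
    place of u. *)
Lemma riemann_sum_cvg h g : 0 < h -> lipb h g ->
  (\sum_(0 <= i < K.+1) h / K.+1%:R * g (i.+1%:R * (h / K.+1%:R))) @[K --> \oo]
    --> \int[mu]_(x in `[0, h]) g x.
Proof.
move=> h0 lg; have ig := lipb_integrable (ltW h0) lg; have [C C0 [_ l]] := lg.
pose J x := \int[mu]_(x in `[0, x]) g x.
pose t K i : R := i%:R * (h / K.+1%:R).
have tD K i : t K i.+1 - t K i = h / K.+1%:R by rewrite /t -natr1; ring.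
have hK K : 0 < h / K.+1%:R by rewrite divr_gt0.
have tK K : t K K.+1 = h by rewrite /t mulrC divfK// pnatr_eq0.
have JE K : J h = \sum_(0 <= i < K.+1) (J (t K i.+1) - J (t K i)).
  rewrite telescope_sumr// tK /t mul0r /J set_itv1 Rintegral_set1 subr0 //.
have bound K : `|J h - \sum_(0 <= i < K.+1) h / K.+1%:R * g (t K i.+1)| <= C * h ^+ 2 * K.+1%:R^-1.
  rewrite (JE K) -sumrB (le_trans (ler_norm_sum _ _ _))//.
  have -> : C * h ^+ 2 * K.+1%:R^-1 = \sum_(0 <= i < K.+1) C * (h / K.+1%:R) ^+ 2.
    rewrite sumr_const_nat subn0 -mulr_natl; field.
    by rewrite addrC natr1 pnatr_eq0.
  rewrite !big_nat; apply: ler_sum => i /andP[_ iK].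
  rewrite -(tD K i); apply: riemann_cell ig l C0.
  - by rewrite /t mulr_ge0// ltW.
  - by rewrite -subr_gt0 tD.
  - by rewrite -[leRHS](tK K) /t ler_pM2r ?hK// ler_nat.
have b0 : C * h ^+ 2 * K.+1%:R^-1 @[K --> \oo] --> (0 : R).
  by rewrite -(mulr0 (C * h ^+ 2)); apply: cvgM; [exact: cvg_cst|exact: cvg_harmonic].
apply/cvgrPdist_le => e e0.
move/cvgrPdist_le : b0 => /(_ e e0); apply: filterS => K.
rewrite sub0r normrN => H; apply: le_trans (bound K) (le_trans (ler_norm _) H).
Qed.

End BoundedLipschitz.

(** * The matrix exponential *)

Section ComplexConvergence.
Context {R : realType}.
Implicit Types (u v : nat -> R[i]) (l : R[i]).

Definition ccvg u l : Prop :=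
  (complex.Re (u N) @[N --> \oo] --> complex.Re l) /\
  (complex.Im (u N) @[N --> \oo] --> complex.Im l).

Lemma ccvgD u v l l' : ccvg u l -> ccvg v l' -> ccvg (fun N => u N + v N) (l + l').
Proof.
move=> [ur ui] [vr vi]; split.
  rewrite (_ : complex.Re (l + l') = complex.Re l + complex.Re l'); last by case: l l' {ur ui vr vi} => ? ? [].
  rewrite (_ : (fun N => _) = fun N => complex.Re (u N) + complex.Re (v N)); first exact: cvgD.
  by apply/funext => N; case: (u N) (v N) => ? ? [].
rewrite (_ : complex.Im (l + l') = complex.Im l + complex.Im l'); last by case: l l' {ur ui vr vi} => ? ? [].
rewrite (_ : (fun N => _) = fun N => complex.Im (u N) + complex.Im (v N)); first exact: cvgD.
by apply/funext => N; case: (u N) (v N) => ? ? [].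
Qed.

Lemma ccvgM u v l l' : ccvg u l -> ccvg v l' -> ccvg (fun N => u N * v N) (l * l').
Proof.
move=> [ur ui] [vr vi]; split.
  rewrite (_ : complex.Re (l * l') = complex.Re l * complex.Re l' - complex.Im l * complex.Im l');
    last by case: l l' {ur ui vr vi} => ? ? [].
  rewrite (_ : (fun N => _) = fun N => complex.Re (u N) * complex.Re (v N)
     - complex.Im (u N) * complex.Im (v N)); first by apply: cvgB; exact: cvgM.
  by apply/funext => N; case: (u N) (v N) => ? ? [].
rewrite (_ : complex.Im (l * l') = complex.Re l * complex.Im l' + complex.Im l * complex.Re l');
  last by case: l l' {ur ui vr vi} => ? ? [].
rewrite (_ : (fun N => _) = fun N => complex.Re (u N) * complex.Im (v N)
   + complex.Im (u N) * complex.Re (v N)); first by apply: cvgD; exact: cvgM.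
by apply/funext => N; case: (u N) (v N) => ? ? [].
Qed.

Lemma ccvg_cst l : ccvg (fun=> l) l.
Proof. by split; exact: cvg_cst. Qed.

Lemma ccvg_sum (I : Type) (r : seq I) (u : I -> nat -> R[i]) (l : I -> R[i]) :
  (forall i, ccvg (u i) (l i)) ->
  ccvg (fun N => \sum_(i <- r) u i N) (\sum_(i <- r) l i).
Proof.
move=> ul; elim: r => [|i r IH].
  by under eq_fun do rewrite big_nil; rewrite big_nil; exact: ccvg_cst.
by under eq_fun do rewrite big_cons; rewrite big_cons; exact: ccvgD.
Qed.

Lemma ccvg_unique u l l' : ccvg u l -> ccvg u l' -> l = l'.
Proof.
move=> [ur ui] [ur' ui']; apply/eqP; rewrite eq_complex; apply/andP; split; apply/eqP.
  exact: cvg_unique ur ur'.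
exact: cvg_unique ui ui'.
Qed.

Lemma ccvg_squeeze u (v : nat -> R) : (forall N, Normc.normc (u N) <= v N) ->
  v @ \oo --> 0 -> ccvg u 0.
Proof.
move=> uv v0; split; apply/norm_cvg0P; apply: (squeeze_cvgr _ (cvg_cst 0) v0);
    apply: nearW => N; rewrite normr_ge0 /= (le_trans _ (uv N))//.
  exact: Re_normc_le.
exact: Im_normc_le.
Qed.

End ComplexConvergence.

(** The terms of a Cauchy product, by antidiagonals and by rows. *)
Lemma sum_triangle (V : nmodType) (f : nat -> nat -> V) N :
  \sum_(0 <= n < N) \sum_(0 <= i < n.+1) f i (n - i)%N =
  \sum_(0 <= i < N) \sum_(0 <= j < N - i) f i j.
Proof.
elim: N => [|N IH]; first by rewrite !big_geq.
rewrite big_nat_recr//= IH [RHS]big_nat_recr//= subSnn big_nat1.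
rewrite [X in _ + X = _]big_nat_recr//= subnn addrA; congr (_ + _).
rewrite -big_split /= !big_nat; apply: eq_bigr => i /andP[_ iN].
by rewrite subSn ?(ltnW iN)// big_nat_recr.
Qed.

(** The binomial formula divided by n!. *)
Lemma exp_term_add (F : numFieldType) (x y : F) n :
  \sum_(0 <= i < n.+1) (i`!%:R^-1 * x ^+ i) * ((n - i)`!%:R^-1 * y ^+ (n - i)) =
  n`!%:R^-1 * (x + y) ^+ n.
Proof.
have fn0 k : k`!%:R != 0 :> F by rewrite pnatr_eq0 -lt0n fact_gt0.
rewrite addrC exprDn mulr_sumr big_mkord; apply: eq_bigr => i _.
have iN : (i <= n)%N by rewrite -ltnS.
rewrite -mulr_natr -(bin_fact iN) !natrM.
have C0 : 'C(n, i)%:R != 0 :> F by rewrite pnatr_eq0 -lt0n bin_gt0.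
by field; rewrite !fn0 C0.
Qed.

(** What the product of two partial exponential sums contains in excess of the partial
    sum of the exponential of x + y. In [expmD] the sequence v consists of the entries
    of the powers of a matrix, and then of the powers of its size, for which the
    same formula dominates the first one and tends to 0. *)
Lemma exp_partial_mul (F : numFieldType) (x y : F) (v : nat -> F) N :
  \sum_(0 <= i < N) \sum_(0 <= j < N)
     (i`!%:R^-1 * x ^+ i) * (j`!%:R^-1 * y ^+ j) * v (i + j)%N -
  \sum_(0 <= n < N) n`!%:R^-1 * (x + y) ^+ n * v n =
  \sum_(0 <= i < N) \sum_(N - i <= j < N)
     (i`!%:R^-1 * x ^+ i) * (j`!%:R^-1 * y ^+ j) * v (i + j)%N.
Proof.
have -> : \sum_(0 <= n < N) n`!%:R^-1 * (x + y) ^+ n * v n =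
   \sum_(0 <= i < N) \sum_(0 <= j < N - i)
     (i`!%:R^-1 * x ^+ i) * (j`!%:R^-1 * y ^+ j) * v (i + j)%N.
  rewrite -sum_triangle; apply: eq_bigr => n _; rewrite -exp_term_add mulr_suml.
  by rewrite !big_nat; apply: eq_bigr => i /andP[_ iN]; rewrite subnKC// -ltnS.
rewrite -sumrB; apply: eq_bigr => i _.
by rewrite (big_cat_nat (leq0n (N - i)) (leq_subr i N)) /= addrAC subrr add0r.
Qed.

Lemma mxpowZ (F : comPzRingType) (d k : nat) (a : F) (M : 'M[F]_d) :
  (a *: M) ^+ k = a ^+ k *: M ^+ k.
Proof.
elim: k => [|k IH]; first by rewrite !expr0 scale1r.
rewrite !exprS IH -[LHS]/((a *: M) *m (a ^+ k *: M ^+ k)).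
by rewrite -scalemxAl -scalemxAr scalerA.
Qed.

Section Exponential.
Context {R : realType} {d : nat}.
Variable M : 'M[R[i]]_d.

(** It dominates every row sum of absolute values, whence the bound mxsize ^+ k on the
    entries of M ^+ k. *)
Definition mxsize : R := \sum_i \sum_j Normc.normc (M i j).

Lemma normc_ge0 (z : R[i]) : 0 <= Normc.normc z.
Proof. by case: z => x y; exact: sqrtr_ge0. Qed.

Lemma normc_sum (I : Type) (r : seq I) (Q : pred I) (F : I -> R[i]) :
  Normc.normc (\sum_(i <- r | Q i) F i) <= \sum_(i <- r | Q i) Normc.normc (F i).
Proof.
elim/big_rec2: _ => [|i x y _ H]; first by rewrite Normc.normc0.
by apply: (le_trans (le_normcD _ _)); rewrite lerD2l.
Qed.

Lemma mxsize_ge0 : 0 <= mxsize.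
Proof. by apply: sumr_ge0 => i _; apply: sumr_ge0 => j _; exact: normc_ge0. Qed.

Lemma normc_mxpow_le k i j : Normc.normc ((M ^+ k) i j) <= mxsize ^+ k.
Proof.
elim: k i j => [|k IH] i j.
  rewrite !expr0 mxE; case: (i == j); first by rewrite Normc.normc1.
  by rewrite Normc.normc0.
rewrite !exprS mxE (le_trans (normc_sum _ _ _))//.
apply: (@le_trans _ _ ((\sum_l Normc.normc (M i l)) * mxsize ^+ k)).
  rewrite mulr_suml; apply: ler_sum => l _; rewrite Normc.normcM ler_wpM2l//.
  exact: normc_ge0.
rewrite ler_wpM2r ?exprn_ge0 ?mxsize_ge0// /mxsize [leRHS](bigD1 i)//= lerDl.
by apply: sumr_ge0 => a _; apply: sumr_ge0 => b _; exact: normc_ge0.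
Qed.

Definition psum (x : nat -> R) (u : R) (N : nat) : R :=
  \sum_(0 <= k < N) k`!%:R^-1 * u ^+ k * x k.

Lemma expm_partial (u : R) N i j :
  (\sum_(k < N) ((k`!)%:R^-1 : R[i]) *: (real_complex R u *: M) ^+ k) i j =
  \sum_(0 <= k < N) (k`!%:R^-1 * (real_complex R u) ^+ k) * (M ^+ k) i j.
Proof.
rewrite big_mkord summxE; apply: eq_bigr => k _.
by rewrite mxpowZ !mxE mulrA.
Qed.

Lemma expm_term_real (u : R) k :
  (k`!%:R^-1 * (real_complex R u) ^+ k : R[i]) = real_complex R (k`!%:R^-1 * u ^+ k).
Proof. by rewrite rmorphM fmorphV rmorphXn rmorph_nat. Qed.

Lemma expm_partialE (u : R) N i j :
  (\sum_(k < N) ((k`!)%:R^-1 : R[i]) *: (real_complex R u *: M) ^+ k) i j =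
  Complex (psum (fun k => complex.Re ((M ^+ k) i j)) u N)
          (psum (fun k => complex.Im ((M ^+ k) i j)) u N).
Proof.
rewrite expm_partial; apply/eqP; rewrite eq_complex /= ReE_sum ImE_sum.
apply/andP; split; apply/eqP; apply: eq_bigr => k _; rewrite expm_term_real;
  by case: ((M ^+ k) i j) => a b; rewrite /= mul0r ?subr0 ?addr0.
Qed.

End Exponential.

Section ExpSeries.
Context {R : realType}.
Variables (x : nat -> R) (c : R).
Hypothesis c0 : 0 <= c.
Hypothesis xc : forall k, `|x k| <= c ^+ k.

Lemma psum_expR_le (t : R) N : 0 <= t -> \sum_(0 <= k < N) k`!%:R^-1 * t ^+ k <= expR t.
Proof.
move=> t0; rewrite expRE.
have -> : \sum_(0 <= k < N) k`!%:R^-1 * t ^+ k = pseries (fun n => n`!%:R^-1) t N by [].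
apply: nondecreasing_cvgn_le.
  apply: nondecreasing_series => n _ _.
  by rewrite mulr_ge0// ?invr_ge0// exprn_ge0.
by rewrite /pseries -exp_coeffE; exact: is_cvg_series_exp_coeff.
Qed.

Lemma psum_cvg u : cvgn (psum x u).
Proof.
apply: (@normed_cvg _ R^o).
have := @is_cvg_series_exp_coeff R (`|u| * c).
apply: series_le_cvg => [n|n|n]; first exact: normr_ge0.
  by apply: exp_coeff_ge0; rewrite mulr_ge0.
rewrite /= !normrM normfV normr_nat normrX /exp_coeff /= exprMn [leRHS]mulrC -mulrA.
by rewrite ler_wpM2l ?invr_ge0// ler_wpM2l// exprn_ge0.
Qed.

(** On [0, B] one has |u^(k+1) - v^(k+1)| <= (k + 1) B^k |u - v|, so the partial sums
    have a common Lipschitz constant, which the limit inherits. *)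
Lemma psum_lipb B : 0 <= B -> lipb B (fun u => limn (psum x u)).
Proof.
move=> B0; have e0 : 0 <= expR (B * c) by exact: expR_ge0.
exists (expR (B * c) + c * expR (B * c)).
  by rewrite addr_ge0// mulr_ge0.
have Bc : 0 <= B * c by rewrite mulr_ge0.
have lims u v (D : R) : (forall N, `|psum x u N - psum x v N| <= D) ->
    `|limn (psum x u) - limn (psum x v)| <= D.
  move=> H.
  have Hc : `|psum x u N - psum x v N| @[N --> \oo] --> `|limn (psum x u) - limn (psum x v)|.
    by apply: cvg_norm; apply: cvgB; exact: psum_cvg.
  rewrite -(cvg_lim _ Hc)//; apply: limr_le; first by apply/cvg_ex; eexists; exact: Hc.
  by apply: nearW => N; exact: H.
split=> [u /andP[u0 uB]|u v /andP[u0 uB] /andP[v0 vB]].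
  have p0 N : psum x u N - psum (fun=> 0) u N = psum x u N.
    by rewrite /psum [X in _ - X]big1 ?subr0// => k _; rewrite mulr0.
  have Hc : `|psum x u N| @[N --> \oo] --> `|limn (psum x u)|.
    by apply: cvg_norm; exact: psum_cvg.
  rewrite -(cvg_lim _ Hc)//; apply: limr_le; first by apply/cvg_ex; eexists; exact: Hc.
  apply: nearW => N; apply: (@le_trans _ _ (expR (B * c))); last by rewrite lerDl mulr_ge0.
  apply: le_trans (psum_expR_le N Bc).
  apply: (le_trans (ler_norm_sum _ _ _)); apply: ler_sum => k _.
  rewrite !normrM normfV normr_nat normrX (ger0_norm u0) exprMn -mulrA.
  rewrite ler_wpM2l ?invr_ge0// ler_pM ?exprn_ge0//.
  by rewrite lerXn2r ?nnegrE.
apply: lims => N.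
apply: (@le_trans _ _ (c * expR (B * c) * `|u - v|)); last first.
  by rewrite ler_wpM2r// lerDr.
rewrite /psum -sumrB.
case: N => [|N]; first by rewrite big_geq// normr0 !mulr_ge0.
rewrite big_nat_recl//= !expr0 subrr add0r.
apply: (le_trans (ler_norm_sum _ _ _)).
apply: (@le_trans _ _ (\sum_(0 <= k < N) c * (k`!%:R^-1 * (B * c) ^+ k) * `|u - v|)); last first.
  by rewrite -mulr_suml -mulr_sumr ler_wpM2r// ler_wpM2l// psum_expR_le.
apply: ler_sum => k _.
rewrite -mulrBl -mulrBr subrXX !normrM normfV normr_nat.
(* The cofactor of u - v in u^(k+1) - v^(k+1) *)
have H1 : `|\sum_(i < k.+1) u ^+ (k.+1.-1 - i) * v ^+ i| <= k.+1%:R * B ^+ k.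
  apply: (le_trans (ler_norm_sum _ _ _)).
  have -> : k.+1%:R * B ^+ k = \sum_(i < k.+1) B ^+ k.
    by rewrite sumr_const card_ord mulr_natl.
  apply: ler_sum => -[i /=]; rewrite ltnS => ik _.
  rewrite normrM !normrX (ger0_norm u0) (ger0_norm v0).
  rewrite -[in leRHS](subnK ik) exprD ler_pM ?exprn_ge0//.
    by rewrite lerXn2r ?nnegrE.
  by rewrite lerXn2r ?nnegrE.
have kf : k.+1%:R * k.+1`!%:R^-1 = k`!%:R^-1 :> R.
  rewrite factS natrM; field.
  by rewrite addrC natr1 !pnatr_eq0 -lt0n fact_gt0.
have f0 : 0 <= k.+1`!%:R^-1 :> R by rewrite invr_ge0.
apply: (@le_trans _ _ (k.+1`!%:R^-1 * (`|u - v| * (k.+1%:R * B ^+ k)) * c ^+ k.+1)).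
  apply: ler_pM; [|exact: normr_ge0| |exact: xc].
    by apply: mulr_ge0 => //; exact: mulr_ge0.
  by rewrite ler_wpM2l// ler_wpM2l.
by rewrite le_eqVlt; apply/orP; left; apply/eqP; rewrite -kf exprS exprMn; ring.
Qed.

End ExpSeries.

Section MatrixExponential.
Context {R : realType} {d : nat}.
Implicit Types (M : 'M[R[i]]_d) (u v : R).

Let xr M i j k := complex.Re ((M ^+ k) i j).
Let xi M i j k := complex.Im ((M ^+ k) i j).

Lemma xr_le M i j k : `|xr M i j k| <= mxsize M ^+ k.
Proof. by apply: le_trans (normc_mxpow_le M k i j); exact: Re_normc_le. Qed.

Lemma xi_le M i j k : `|xi M i j k| <= mxsize M ^+ k.
Proof. by apply: le_trans (normc_mxpow_le M k i j); exact: Im_normc_le. Qed.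

Lemma expmE u M i j : expm (real_complex R u *: M) i j =
  Complex (limn (psum (xr M i j) u)) (limn (psum (xi M i j) u)).
Proof.
rewrite mxE; congr Complex.
  rewrite (_ : (fun N : nat => complex.Re _) = psum (xr M i j) u)//.
  by apply/funext => N; rewrite expm_partialE.
rewrite (_ : (fun N : nat => complex.Im _) = psum (xi M i j) u)//.
by apply/funext => N; rewrite expm_partialE.
Qed.

Lemma expm_ccvg u M i j :
  ccvg (fun N => (\sum_(k < N) ((k`!)%:R^-1 : R[i]) *: (real_complex R u *: M) ^+ k) i j)
       (expm (real_complex R u *: M) i j).
Proof.
rewrite expmE; split => /=; under eq_fun do rewrite expm_partialE /=.
  exact: (psum_cvg (mxsize_ge0 M) (xr_le M i j)).
exact: (psum_cvg (mxsize_ge0 M) (xi_le M i j)).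
Qed.

Lemma expm_lipb_Re B M i j : 0 <= B ->
  lipb B (fun u => complex.Re (expm (real_complex R u *: M) i j)).
Proof.
move=> B0; under eq_fun do rewrite expmE /=.
exact: (psum_lipb (mxsize_ge0 M) (xr_le M i j)).
Qed.

Lemma expm_lipb_Im B M i j : 0 <= B ->
  lipb B (fun u => complex.Im (expm (real_complex R u *: M) i j)).
Proof.
move=> B0; under eq_fun do rewrite expmE /=.
exact: (psum_lipb (mxsize_ge0 M) (xi_le M i j)).
Qed.

Lemma expm0 M : expm (real_complex R 0 *: M) = 1%:M.
Proof.
apply/matrixP => i j; apply: ccvg_unique (expm_ccvg 0 M i j) _.
have H N : (\sum_(k < N.+1) ((k`!)%:R^-1 : R[i]) *: (real_complex R 0 *: M) ^+ k) i j
   = (1%:M : 'M[R[i]]_d) i j.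
  rewrite big_ord_recl big1 ?addr0; last first.
    by move=> k _; rewrite rmorph0 scale0r expr0n scaler0.
  by rewrite expr0 fact0 invr1 scale1r.
split; apply/cvg_ballP => e e0; exists 1%N => // -[//|N] _ /=; rewrite H; exact: ballxx.
Qed.

(** The excess of the product of partial sums over the partial sum for u + v is at most
    the same excess for the scalar exponential series of the numbers |u| mxsize M and
    |v| mxsize M, and this tends to 0 by the functional equation of expR. *)
Lemma expmD u v M : expm (real_complex R u *: M) *m expm (real_complex R v *: M) =
  expm (real_complex R (u + v) *: M).
Proof.
apply/matrixP => i j.
pose S w N : 'M[R[i]]_d := \sum_(k < N) ((k`!)%:R^-1 : R[i]) *: (real_complex R w *: M) ^+ k.
have cprod : ccvg (fun N => (S u N *m S v N) i j)
    ((expm (real_complex R u *: M) *m expm (real_complex R v *: M)) i j).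
  under eq_fun do rewrite mxE; rewrite mxE; apply: ccvg_sum => l.
  by apply: ccvgM; exact: expm_ccvg.
apply: ccvg_unique cprod _.
have -> : (fun N => (S u N *m S v N) i j) =
    fun N => ((S u N *m S v N) i j - S (u + v) N i j) + S (u + v) N i j.
  by apply/funext => N; rewrite subrK.
rewrite -[X in ccvg _ X]add0r; apply: ccvgD; last exact: expm_ccvg.
pose c := mxsize M.
pose s w N : R := psum (fun k => c ^+ k) w N.
apply: (@ccvg_squeeze _ _ (fun N => s `|u| N * s `|v| N - s (`|u| + `|v|) N)).
  move=> N.
  have -> : (S u N *m S v N) i j = \sum_(0 <= p < N) \sum_(0 <= q < N)
     (p`!%:R^-1 * (real_complex R u) ^+ p) * (q`!%:R^-1 * (real_complex R v) ^+ q) *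
       (M ^+ (p + q)) i j.
    rewrite /S mulmx_suml summxE big_mkord; apply: eq_bigr => p _.
    rewrite mulmx_sumr summxE big_mkord; apply: eq_bigr => q _.
    rewrite !mxpowZ !scalerA -scalemxAl -scalemxAr scalerA mxE exprD.
    by congr (_ * _).
  have -> : S (u + v) N i j = \sum_(0 <= n < N)
     n`!%:R^-1 * (real_complex R u + real_complex R v) ^+ n * (M ^+ n) i j.
    by rewrite /S expm_partial rmorphD.
  rewrite exp_partial_mul.
  have -> : s `|u| N * s `|v| N - s (`|u| + `|v|) N =
     \sum_(0 <= p < N) \sum_(N - p <= q < N)
     (p`!%:R^-1 * `|u| ^+ p) * (q`!%:R^-1 * `|v| ^+ q) * c ^+ (p + q).
    rewrite -exp_partial_mul; congr (_ - _); rewrite /s /psum mulr_suml.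
    apply: eq_bigr => p _; rewrite mulr_sumr; apply: eq_bigr => q _.
    by rewrite exprD; ring.
  apply: (le_trans (normc_sum _ _ _)); apply: ler_sum => p _.
  apply: (le_trans (normc_sum _ _ _)); apply: ler_sum => q _.
  rewrite !expm_term_real -rmorphM Normc.normcM.
  have -> : Normc.normc (real_complex R (p`!%:R^-1 * u ^+ p * (q`!%:R^-1 * v ^+ q))) =
     p`!%:R^-1 * `|u| ^+ p * (q`!%:R^-1 * `|v| ^+ q).
    by rewrite /= expr0n addr0 sqrtr_sqr !normrM !normfV !normr_nat !normrX.
  by rewrite ler_wpM2l ?normc_mxpow_le// !mulr_ge0 ?invr_ge0// exprn_ge0.
have sE w : 0 <= w -> s w N @[N --> \oo] --> expR (w * c).
  move=> w0; have -> : s w = series (exp_coeff (w * c)).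
    apply/funext => N; rewrite /s /psum /series /=; apply: eq_bigr => k _.
    by rewrite /exp_coeff /= exprMn [RHS]mulrC mulrA.
  exact: is_cvg_series_exp_coeff.
rewrite -[X in _ --> X](subrr (expR ((`|u| + `|v|) * c))) {1}mulrDl expRD.
by apply: cvgB; [apply: cvgM|]; apply: sE; rewrite ?addr_ge0.
Qed.

Lemma expm_mulD n u v t M (A : 'M[R[i]]_(d, n)) : u + v = t ->
  expm (real_complex R t *: M) *m A =
  expm (real_complex R u *: M) *m (expm (real_complex R v *: M) *m A).
Proof. by move=> <-; rewrite -(expmD u v M) -mulmxA. Qed.

Lemma expm_adj u M : expm (real_complex R u *: M ^t*) = (expm (real_complex R u *: M)) ^t*.
Proof.
apply/matrixP => i j; apply: ccvg_unique (expm_ccvg u _ i j) _.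
have [cr ci] := expm_ccvg u M j i.
have e N : (\sum_(k < N) ((k`!)%:R^-1 : R[i]) *: (real_complex R u *: M ^t*) ^+ k) i j =
   ((\sum_(k < N) ((k`!)%:R^-1 : R[i]) *: (real_complex R u *: M) ^+ k) j i)^*%C.
  have pw k a b : ((M ^t*) ^+ k) a b = ((M ^+ k) b a)^*%C.
    elim: k a b => [|k IH] a b; first by rewrite !expr0 !mxE eq_sym rmorph_nat.
    rewrite exprS exprSr !mxE rmorph_sum; apply: eq_bigr => l _.
    by rewrite rmorphM /= IH !mxE mulrC.
  rewrite 2!expm_partial [RHS](rmorph_sum (@conjc R)); apply: eq_bigr => k _.
  by rewrite pw rmorphM /= expm_term_real; congr (_ * _); rewrite /real_complex_def /= oppr0.
rewrite 2!mxE; split; under eq_fun do rewrite e.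
  rewrite (_ : complex.Re _ = complex.Re (expm (real_complex R u *: M) j i)).
    rewrite (_ : (fun N => _) = (fun N => complex.Re ((\sum_(k < N) ((k`!)%:R^-1 : R[i]) *:
      (real_complex R u *: M) ^+ k) j i))) //.
    by apply/funext => N; case: (_ j i).
  by case: (expm _ j i).
rewrite (_ : complex.Im _ = - complex.Im (expm (real_complex R u *: M) j i)).
  rewrite (_ : (fun N => _) = (fun N => - complex.Im ((\sum_(k < N) ((k`!)%:R^-1 : R[i]) *:
      (real_complex R u *: M) ^+ k) j i))); first exact: cvgN.
  by apply/funext => N; case: (_ j i).
by case: (expm _ j i).
Qed.

End MatrixExponential.

(** * The discrete-time autoregressive coefficients *)

Section ARfilter.
Context {F : comPzRingType} {d : nat}.
Variables (E : 'M[F]_d) (Ph : nat -> 'M[F]_d).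

(** The impulse response of the filter: the weight that the noise of s steps ago keeps
    when the state has transition matrix E and the lags up to s are subtracted. *)
Definition Gcoef (s : nat) : 'M[F]_d :=
  E ^+ s - \sum_(1 <= j < s.+1) Ph j *m E ^+ (s - j).

Lemma Gcoef0 : Gcoef 0 = 1%:M.
Proof. by rewrite /Gcoef big_geq// subr0 expr0. Qed.

Lemma GcoefS s : Gcoef s.+1 = Gcoef s *m E - Ph s.+1.
Proof.
have ES n : E ^+ n *m E = E ^+ n.+1 by rewrite exprSr.
rewrite /Gcoef mulmxBl ES big_nat_recr//= subnn expr0 mulmx1 opprD addrA.
congr (_ - _ - _); rewrite mulmx_suml !big_nat; apply: eq_bigr => j /andP[_ js].
by rewrite -mulmxA ES subSn.
Qed.

(** By induction on the number of lags: the state at time n - s is replaced by the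
    recursion, and the lag s + 1 is then subtracted. *)
Lemma AR_recursion (y e : nat -> 'cV[F]_d) n s : (s <= n)%N ->
  (forall t, y t.+1 = E *m y t + e t.+1) ->
  y n - \sum_(1 <= j < s.+1) Ph j *m y (n - j)%N =
  Gcoef s *m y (n - s)%N + \sum_(0 <= r < s) Gcoef r *m e (n - r)%N.
Proof.
move=> sn rec; elim: s sn => [_|s IH sn].
  by rewrite !big_geq// Gcoef0 mul1mx subn0 subr0 addr0.
rewrite big_nat_recr//= opprD addrA IH ?(ltnW sn)// [in RHS]big_nat_recr//=.
have -> : (n - s = (n - s.+1).+1)%N by rewrite subnSK.
rewrite rec GcoefS mulmxDr (mulmxBl (Gcoef s *m E)) (mulmxA (Gcoef s)).
have aux (V : zmodType) (a b c c' : V) : a + c + b - c' = a - c' + (b + c).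
  by rewrite -!addrA; congr (_ + _); rewrite addrCA [RHS]addrC -addrA.
exact: aux.
Qed.

(** The relation is multiplied by E ^+ p on the right, where E is the inverse of E', and
    normalized by Q on the left. *)
Lemma AR_coefficients (E' Q : 'M[F]_d) (Ps : nat -> 'M[F]_d) (p : nat) : E' *m E = 1%:M ->
  \sum_(0 <= i < p.+1) Ps (p - i)%N *m E' ^+ i = 0 ->
  Q *m Ps p = 1%:M ->
  \sum_(1 <= j < p.+1) (- (Q *m Ps (p - j)%N)) *m E ^+ (p - j) = E ^+ p.
Proof.
move=> EE rel pu.
have cancel i n : E' ^+ i *m E ^+ (i + n) = E ^+ n.
  elim: i => [|i IH]; first by rewrite expr0 mul1mx.
  have -> : E' ^+ i.+1 = E' ^+ i *m E' by rewrite exprSr.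
  have -> : E ^+ (i.+1 + n) = E *m E ^+ (i + n) by rewrite addSn exprS.
  by rewrite -mulmxA (mulmxA E') EE mul1mx.
have := congr1 (fun A => Q *m (A *m E ^+ p)) rel.
rewrite mul0mx mulmx0 mulmx_suml big_nat_recl//= subn0 expr0 mulmx1.
rewrite mulmxDr mulmxA pu mul1mx => /eqP; rewrite addr_eq0 => /eqP ->.
rewrite mulmx_sumr -sumrN big_add1 /= !big_nat; apply: eq_bigr => i /andP[_ ip].
by rewrite -{4}(subnKC ip) -(mulmxA (Ps _)) cancel mulNmx mulmxA.
Qed.

End ARfilter.

Section DiscreteCoefficients.
Context {R : realType} {d p : nat}.
Variables (h : R) (S : 'I_p -> 'M[R[i]]_d).
Hypothesis p0 : (0 < p)%N.
Hypothesis V_unit :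
  block_vandermonde (fun k => expm (real_complex R (- h) *: S k)) \in unitmx.

Local Notation E x k := (expm (real_complex R x *: S k)).

Lemma expm_expn (x : R) k n : (E x k) ^+ n = E (n%:R * x) k.
Proof.
elim: n => [|n IH]; first by rewrite expr0 mul0r expm0.
rewrite exprS IH -mulmxE expmD {IH} (_ : x + n%:R * x = n.+1%:R * x); last by rewrite -natr1; ring.
reflexivity.
Qed.

Lemma Psi_rowE (i : 'I_p) : submxrow (Psi_row h S) i = Psi h S (p - i).
Proof.
have ip := ltn_ord i.
rewrite /Psi subn_eq0 leqNgt ip /= subKn ?(ltnW ip)//.
by rewrite (insubT (fun x => x < p)%N ip) /=; congr (submxrow _ _); apply: val_inj.
Qed.

Lemma Psi_vandermonde k :
  \sum_(i < p) Psi h S (p - i) *m E (- (i%:R * h)) k = - E (- (p%:R * h)) k.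
Proof.
have H : Psi_row h S *m block_vandermonde (fun k => E (- h) k) =
    - (\mxrow_(k < p) E (- (p%:R * h)) k) by rewrite /Psi_row mulmxKV.
move: H; rewrite -[Psi_row h S]submxrowK mul_mxrow_mxblock -mxrowN.
move=> /eq_mxrowP /(_ k) <-; apply: eq_bigr => i _.
by rewrite Psi_rowE expm_expn mulrN.
Qed.

(** The term i = p is the right-hand side of [Psi_vandermonde], since Psi_0 = 1. *)
Lemma Psi_relation k : \sum_(0 <= i < p.+1) Psi h S (p - i) *m E (- (i%:R * h)) k = 0.
Proof.
rewrite big_nat_recr//= big_mkord Psi_vandermonde subnn /Psi eqxx mul1mx.
by rewrite addNr.
Qed.

Lemma unitmx_lker n (A : 'M[R[i]]_n) :
  (forall x : 'rV_n, x *m A = 0 -> x = 0) -> A \in unitmx.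
Proof.
move=> H; rewrite -row_free_unit -kermx_eq0; apply/rowV0P => v /sub_kermxP; exact: H.
Qed.

(** If x Psi_p = 0, the relation loses its term i = 0. Multiplied by e^{h R_k} it says
    that x [Psi_{p-1}, ..., Psi_0] annihilates the invertible Vandermonde matrix, and
    the last block gives x Psi_0 = x = 0. *)
Lemma Psi_unit : Psi h S p \in unitmx.
Proof.
apply: unitmx_lker => x x0.
have rel k : \sum_(i < p) (x *m Psi h S (p - i.+1)) *m E (- h) k ^+ i = 0.
  have := congr1 (fun A => x *m A *m E h k) (Psi_relation k).
  rewrite mulmx0 mul0mx big_nat_recl//= subn0 mul0r oppr0 expm0 mulmx1.
  rewrite mulmxDr x0 add0r mulmx_sumr mulmx_suml big_mkord => H; rewrite -[RHS]H {H}.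
  apply: eq_bigr => i _; rewrite expm_expn -!mulmxA expmD.
  rewrite (_ : i%:R * - h = - (i.+1%:R * h) + h); last by rewrite -natr1; ring.
  reflexivity.
have : (\mxrow_(i < p) (x *m Psi h S (p - i.+1))) *m
    block_vandermonde (fun k => E (- h) k) = 0.
  rewrite mul_mxrow_mxblock -mxrow0; apply/eq_mxrowP => k; exact: rel.
move=> /(congr1 (mulmx^~ (invmx (block_vandermonde (fun k => E (- h) k))))).
rewrite mulmxK// mul0mx -mxrow0 => /eq_mxrowP.
have pp : (p.-1 < p)%N by rewrite prednK.
move=> /(_ (Ordinal pp)); rewrite /= prednK// subnn /Psi eqxx mulmx1.
by [].
Qed.

Lemma expm_nat k n : E (h * n%:R) k = (E h k) ^+ n.
Proof. by rewrite expm_expn mulrC. Qed.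

Lemma Phi_relation k : \sum_(1 <= j < p.+1) Phi h S j *m E h k ^+ (p - j) = E h k ^+ p.
Proof.
have EE : E (- h) k *m E h k = 1%:M by rewrite expmD addNr expm0.
apply: (AR_coefficients EE); last by rewrite mulVmx// Psi_unit.
rewrite -[RHS](Psi_relation k); apply: eq_bigr => i _; rewrite expm_expn mulrN.
reflexivity.
Qed.

(** After all p lags the response to the initial state vanishes: the coefficients Phi_j
    are made for this. *)
Lemma Gcoef_p k : Gcoef (E h k) (Phi h S) p = 0.
Proof. by rewrite /Gcoef Phi_relation subrr. Qed.

(** The factor on the right turns the exponents r - j, possibly negative, into the
    nonnegative r + l - j. *)
Lemma MAcoefE r l k :
  MAcoef h S r l (S k) *m E (h * l%:R) k = Gcoef (E h k) (Phi h S) (r + l).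
Proof.
rewrite /MAcoef /Gcoef mulmxBl expmD -expm_nat -mulrDr -natrD; congr (_ - _).
rewrite mulmx_suml !big_nat; apply: eq_bigr => j /andP[_ jrl].
rewrite -mulmxA expmD -expm_nat.
rewrite (_ : h * (r%:R - j%:R) + h * l%:R = h * (r + l - j)%:R); first reflexivity.
by rewrite natrB// natrD; ring.
Qed.

Lemma MAcoef0E r k : MAcoef h S r 0 (S k) = Gcoef (E h k) (Phi h S) r.
Proof. by have := MAcoefE r 0 k; rewrite mulr0 expm0 mulmx1 addn0. Qed.

(** The initial state has disappeared, so the filtered series is a moving average of the
    last p noises. *)
Lemma ARfilter k (y e : nat -> 'cV[R[i]]_d) n : (p <= n)%N ->
  (forall t, y t.+1 = E h k *m y t + e t.+1) ->
  y n - \sum_(1 <= j < p.+1) Phi h S j *m y (n - j)%N =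
  \sum_(0 <= r < p) Gcoef (E h k) (Phi h S) r *m e (n - r)%N.
Proof.
by move=> pn rec; rewrite (AR_recursion (Phi h S) pn rec) Gcoef_p mul0mx add0r.
Qed.

End DiscreteCoefficients.

(** * Covariances of complex random vectors *)

Section ComplexCovariance.
Context {dT : measure_display} {T : measurableType dT} {R : realType}.
Variable P : probability T R.
Implicit Types X Y Z : T -> R[i].

Definition rRe X : T -> R := fun w => complex.Re (X w).
Definition rIm X : T -> R := fun w => complex.Im (X w).

Definition sqc X : Prop := sqint P (rRe X) /\ sqint P (rIm X).

Definition centered X : Prop :=
  ip P (rRe X) (cst 1) = 0 /\ ip P (rIm X) (cst 1) = 0.

(** The expectation of X times the conjugate of Y, in real and imaginary parts. *)
Definition cip X Y : R[i] :=
  Complex (ip P (rRe X) (rRe Y) + ip P (rIm X) (rIm Y))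
          (ip P (rIm X) (rRe Y) - ip P (rRe X) (rIm Y)).

Lemma rReZ a X : rRe (fun w => a * X w) = complex.Re a *: rRe X - complex.Im a *: rIm X.
Proof.
apply/funext => w; rewrite -[RHS]/(complex.Re a * complex.Re (X w) - complex.Im a * complex.Im (X w)).
by rewrite /rRe; case: a (X w) => ? ? [].
Qed.

Lemma rImZ a X : rIm (fun w => a * X w) = complex.Re a *: rIm X + complex.Im a *: rRe X.
Proof.
apply/funext => w; rewrite -[RHS]/(complex.Re a * complex.Im (X w) + complex.Im a * complex.Re (X w)).
by rewrite /rIm; case: a (X w) => ? ? [].
Qed.

Lemma rRe_sum (I : Type) (r : seq I) (F : I -> T -> R[i]) :
  rRe (fun w => \sum_(i <- r) F i w) = \sum_(i <- r) rRe (F i).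
Proof. by apply/funext => w; rewrite fct_sumE /rRe ReE_sum. Qed.

Lemma rIm_sum (I : Type) (r : seq I) (F : I -> T -> R[i]) :
  rIm (fun w => \sum_(i <- r) F i w) = \sum_(i <- r) rIm (F i).
Proof. by apply/funext => w; rewrite fct_sumE /rIm ImE_sum. Qed.

Lemma sqcZ a X : sqc X -> sqc (fun w => a * X w).
Proof.
move=> [sr si]; rewrite /sqc rReZ rImZ; split.
  by apply: sqintB; exact: sqintZ.
by apply: sqintD; exact: sqintZ.
Qed.

Lemma sqc_sum (I : Type) (r : seq I) (F : I -> T -> R[i]) :
  (forall i, sqc (F i)) -> sqc (fun w => \sum_(i <- r) F i w).
Proof.
move=> sF; rewrite /sqc rRe_sum rIm_sum.
by split; apply: sqint_sum => i _; case: (sF i).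
Qed.

Lemma centeredZ a X : sqc X -> centered X -> centered (fun w => a * X w).
Proof.
move=> [sr si] [cr ci]; have s1 := sqint_cst P 1.
rewrite /centered rReZ rImZ ipBl ?ipDl ?ipZl ?cr ?ci//; try exact: sqintZ.
by rewrite !mulr0 subr0 addr0.
Qed.

Lemma centered_sum (I : Type) (r : seq I) (F : I -> T -> R[i]) :
  (forall i, sqc (F i)) -> (forall i, centered (F i)) ->
  centered (fun w => \sum_(i <- r) F i w).
Proof.
move=> sF cF; have s1 := sqint_cst P 1; rewrite /centered rRe_sum rIm_sum.
rewrite !ip_suml//; try by move=> i _; case: (sF i).
by split; rewrite big1// => i _; case: (cF i).
Qed.

Lemma cipZl a X Y : sqc X -> sqc Y -> cip (fun w => a * X w) Y = a * cip X Y.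
Proof.
move=> [xr xi] [yr yi]; rewrite /cip rReZ rImZ !ipBl ?ipDl ?ipZl//; try exact: sqintZ.
case: a => a b; apply/eqP; rewrite eq_complex /=; apply/andP; split; apply/eqP; ring.
Qed.

Lemma cip_suml (I : Type) (r : seq I) (F : I -> T -> R[i]) Y :
  (forall i, sqc (F i)) -> sqc Y ->
  cip (fun w => \sum_(i <- r) F i w) Y = \sum_(i <- r) cip (F i) Y.
Proof.
move=> sF [yr yi]; rewrite /cip rRe_sum rIm_sum !ip_suml//; try by move=> i _; case: (sF i).
apply/eqP; rewrite eq_complex ReE_sum ImE_sum /= big_split /= sumrB.
by rewrite !eqxx.
Qed.

Lemma cipC X Y : cip Y X = (cip X Y)^*%C.
Proof.
apply/eqP; rewrite eq_complex /= !(ipC P (rRe Y)) !(ipC P (rIm Y)) opprB.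
by rewrite !eqxx.
Qed.

Lemma sqc_ae X Y : measurable_fun [set: T] (rRe Y) -> measurable_fun [set: T] (rIm Y) ->
  {ae P, forall w, X w = Y w} -> sqc X -> sqc Y.
Proof.
move=> mr mi XY [sr si]; split; [move: sr|move: si]; apply: sqint_ae => //;
  by move: XY; apply: filterS => w; rewrite /rRe /rIm => ->.
Qed.

Lemma rRe_ae X Y : {ae P, forall w, X w = Y w} -> {ae P, forall w, rRe X w = rRe Y w}.
Proof. by apply: filterS => w; rewrite /rRe => ->. Qed.

Lemma rIm_ae X Y : {ae P, forall w, X w = Y w} -> {ae P, forall w, rIm X w = rIm Y w}.
Proof. by apply: filterS => w; rewrite /rIm => ->. Qed.

Lemma cip_ae X X' Y Y' : sqc X -> sqc X' -> sqc Y -> sqc Y' ->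
  {ae P, forall w, X w = X' w} -> {ae P, forall w, Y w = Y' w} -> cip X Y = cip X' Y'.
Proof.
move=> [[? _] [? _]] [[? _] [? _]] [[? _] [? _]] [[? _] [? _]] eX eY.
have := rRe_ae eX; have := rIm_ae eX; have := rRe_ae eY; have := rIm_ae eY => *.
by rewrite /cip; congr (Complex (_ + _) (_ - _)); apply: ip_ae.
Qed.

Lemma centered_ae X Y : sqc X -> sqc Y ->
  {ae P, forall w, X w = Y w} -> centered X -> centered Y.
Proof.
move=> [[? _] [? _]] [[? _] [? _]] eX [cr ci]; have [m1 _] := sqint_cst P (1 : R).
have e1 : {ae P, forall w, (cst 1 : T -> R) w = cst 1 w} by apply: aeW.
split; [rewrite -cr|rewrite -ci]; apply: ip_ae => //.
  by have := rRe_ae eX; apply: filterS => w ->.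
by have := rIm_ae eX; apply: filterS => w ->.
Qed.

Definition row_of (n : nat) (U : T -> 'cV[R[i]]_n) (i : 'I_n) : T -> R[i] := fun w => U w i 0.

Definition sqv (n : nat) (U : T -> 'cV[R[i]]_n) : Prop := forall i, sqc (row_of U i).
Definition centeredv (n : nat) (U : T -> 'cV[R[i]]_n) : Prop :=
  forall i, centered (row_of U i).

Definition vcip (m n : nat) (U : T -> 'cV[R[i]]_m) (W : T -> 'cV[R[i]]_n) : 'M[R[i]]_(m, n) :=
  \matrix_(i, j) cip (row_of U i) (row_of W j).

Lemma row_of_mul (m n : nat) (A : 'M[R[i]]_(m, n)) (U : T -> 'cV[R[i]]_n) i :
  row_of (fun w => A *m U w) i = fun w => \sum_j A i j * row_of U j w.
Proof. by apply/funext => w; rewrite /row_of mxE. Qed.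

Lemma row_of_sum (n : nat) (I : Type) (r : seq I) (F : I -> T -> 'cV[R[i]]_n) i :
  row_of (fun w => \sum_(k <- r) F k w) i = fun w => \sum_(k <- r) row_of (F k) i w.
Proof. by apply/funext => w; rewrite /row_of summxE. Qed.

Lemma sqv_mul (m n : nat) (A : 'M[R[i]]_(m, n)) (U : T -> 'cV[R[i]]_n) :
  sqv U -> sqv (fun w => A *m U w).
Proof. by move=> sU i; rewrite row_of_mul; apply: sqc_sum => j; exact: sqcZ. Qed.

Lemma sqv_sum (n : nat) (I : Type) (r : seq I) (F : I -> T -> 'cV[R[i]]_n) :
  (forall k, sqv (F k)) -> sqv (fun w => \sum_(k <- r) F k w).
Proof. by move=> sF i; rewrite row_of_sum; apply: sqc_sum => k; exact: sF. Qed.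

Lemma centeredv_mul (m n : nat) (A : 'M[R[i]]_(m, n)) (U : T -> 'cV[R[i]]_n) :
  sqv U -> centeredv U -> centeredv (fun w => A *m U w).
Proof.
move=> sU cU i; rewrite row_of_mul; apply: centered_sum => j; first exact: sqcZ.
by apply: centeredZ; [exact: sU|exact: cU].
Qed.

Lemma centeredv_sum (n : nat) (I : Type) (r : seq I) (F : I -> T -> 'cV[R[i]]_n) :
  (forall k, sqv (F k)) -> (forall k, centeredv (F k)) ->
  centeredv (fun w => \sum_(k <- r) F k w).
Proof.
by move=> sF cF i; rewrite row_of_sum; apply: centered_sum => k; [exact: sF|exact: cF].
Qed.

Lemma vcip_mull (m n k : nat) (A : 'M[R[i]]_(m, n)) (U : T -> 'cV[R[i]]_n) (W : T -> 'cV[R[i]]_k) :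
  sqv U -> sqv W -> vcip (fun w => A *m U w) W = A *m vcip U W.
Proof.
move=> sU sW; apply/matrixP => i j; rewrite !mxE row_of_mul cip_suml//.
- by apply: eq_bigr => l _; rewrite cipZl ?mxE.
- by move=> l; exact: sqcZ.
Qed.

Lemma vcip_suml (m n : nat) (I : Type) (r : seq I) (F : I -> T -> 'cV[R[i]]_m) (W : T -> 'cV[R[i]]_n) :
  (forall k, sqv (F k)) -> sqv W ->
  vcip (fun w => \sum_(k <- r) F k w) W = \sum_(k <- r) vcip (F k) W.
Proof.
move=> sF sW; apply/matrixP => i j; rewrite !mxE row_of_sum summxE cip_suml//.
  by apply: eq_bigr => l _; rewrite mxE.
by move=> l; exact: sF.
Qed.

Lemma vcipC (m n : nat) (U : T -> 'cV[R[i]]_m) (W : T -> 'cV[R[i]]_n) :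
  vcip W U = (vcip U W) ^t*.
Proof. by apply/matrixP => i j; rewrite !mxE cipC. Qed.

Lemma adj_mul (m n k : nat) (A : 'M[R[i]]_(m, n)) (B : 'M[R[i]]_(n, k)) :
  (A *m B) ^t* = B ^t* *m A ^t*.
Proof. by rewrite trmx_mul map_mxM. Qed.

Lemma adj_sum (m n : nat) (I : Type) (r : seq I) (F : I -> 'M[R[i]]_(m, n)) :
  (\sum_(k <- r) F k) ^t* = \sum_(k <- r) (F k) ^t*.
Proof. by apply/matrixP => i j; rewrite !(mxE, summxE) rmorph_sum; apply: eq_bigr => k _; rewrite !mxE. Qed.

Lemma vcip_mulr (m n k : nat) (A : 'M[R[i]]_(m, n)) (U : T -> 'cV[R[i]]_n) (W : T -> 'cV[R[i]]_k) :
  sqv U -> sqv W -> vcip W (fun w => A *m U w) = vcip W U *m A ^t*.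
Proof. by move=> sU sW; rewrite vcipC vcip_mull// adj_mul -vcipC. Qed.

Lemma vcip_sumr (m n : nat) (I : Type) (r : seq I) (F : I -> T -> 'cV[R[i]]_m) (W : T -> 'cV[R[i]]_n) :
  (forall k, sqv (F k)) -> sqv W ->
  vcip W (fun w => \sum_(k <- r) F k w) = \sum_(k <- r) vcip W (F k).
Proof.
by move=> sF sW; rewrite vcipC vcip_suml// adj_sum; apply: eq_bigr => k _; rewrite -vcipC.
Qed.

(** For centered vectors, covariances are second moments. *)
Lemma has_cov_vcip (m n : nat) (U : T -> 'cV[R[i]]_m) (W : T -> 'cV[R[i]]_n) :
  sqv U -> sqv W -> centeredv U -> centeredv W -> has_cov P U W (vcip U W).
Proof.
have L2 k (Z : T -> 'cV[R[i]]_k) : sqv Z -> cvec_L2 P Z.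
  move=> sZ; split.
    by move=> i; have [[mr _] [mi _]] := sZ i; split.
  move=> i; have [sr si] := sZ i.
  have iZ : P.-integrable [set: T] (EFin \o (rRe (row_of Z i) * rRe (row_of Z i)
      + rIm (row_of Z i) * rIm (row_of Z i))).
    apply: (@integrableD _ _ _ _ _ _ (EFin \o (rRe (row_of Z i) * rRe (row_of Z i))%R)
      (EFin \o (rIm (row_of Z i) * rIm (row_of Z i))%R)) => //; [exact: sr.2|exact: si.2].
  move/integrableP : iZ => [_]; congr (_ < _)%E; apply: eq_integral => w _.
  rewrite /= !fctE ger0_norm -?expr2 ?addr_ge0 ?sqr_ge0//; congr EFin.
  rewrite /rRe /rIm /row_of; case: (Z w i 0) => x y /=.
  by rewrite sqr_sqrtr// addr_ge0 ?sqr_ge0.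
have E0 k (Z : T -> 'cV[R[i]]_k) : centeredv Z -> cexpect P Z = 0.
  move=> cZ; apply/matrixP => i j; rewrite ord1 !mxE.
  have [cr ci] := cZ i; rewrite /cintegral.
  apply/eqP; rewrite eq_complex /=; apply/andP; split; apply/eqP;
    [rewrite -[RHS]cr | rewrite -[RHS]ci];
    by apply: eq_Rintegral => w _; rewrite mulr1.
move=> sU sW cU cW; split; [exact: L2|exact: L2|].
rewrite /ccov !E0//; apply/matrixP => i j; rewrite !mxE /cintegral /cip.
have [ur ui] := sU i; have [wr wi] := sW j.
congr Complex.
  rewrite /ip -RintegralD//; [|exact: sqint_mul|exact: sqint_mul].
  apply: eq_Rintegral => w _; rewrite !subr0 mxE big_ord1 !mxE /rRe /rIm /row_of.
  by case: (U w i 0) => a b; case: (W w j 0) => a' b' /=; ring.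
rewrite /ip -RintegralB//; [|exact: sqint_mul|exact: sqint_mul].
apply: eq_Rintegral => w _; rewrite !subr0 mxE big_ord1 !mxE /rRe /rIm /row_of.
by case: (U w i 0) => a b; case: (W w j 0) => a' b' /=; ring.
Qed.

End ComplexCovariance.

(** * Matrix-valued integrands *)

Section MatrixWiener.
Context {dT : measure_display} {T : measurableType dT} {R : realType}.
Variables (P : probability T R) (m : nat) (L : R -> T -> 'cV[R]_m).
Hypothesis levyL : levy_process P L.
Hypothesis sq1 : forall j : 'I_m, sqint P (incr L 0 1 j).
Hypothesis mean1 : forall j : 'I_m, ip P (incr L 0 1 j) (cst 1) = 0.
Variable h : R.
Hypothesis h0 : 0 < h.

Definition lipm (d : nat) (B : R) (f : R -> 'M[R[i]]_(d, m)) : Prop := forall i j,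
  lipb B (fun u => complex.Re (f u i j)) /\ lipb B (fun u => complex.Im (f u i j)).

(** The sum of the Lipschitz constants of the coordinates serves all of them. *)
Lemma lip_on_lipb B (phi : R -> 'I_m -> R) :
  (forall j, lipb B (fun u => phi u j)) -> lip_on B phi.
Proof.
move=> H; have /choice[C HC] : forall j, exists C : R, 0 <= C /\
    forall u v, 0 <= u <= B -> 0 <= v <= B -> `|phi u j - phi v j| <= C * `|u - v|.
  by move=> j; have [C C0 [_ l]] := H j; exists C.
exists (\sum_j C j); first by apply: sumr_ge0 => j _; case: (HC j).
move=> u v j uB vB; have [Cj l] := HC j; apply: (le_trans (l _ _ uB vB)).
rewrite ler_wpM2r// (bigD1 j)//= lerDl; apply: sumr_ge0 => k _; by case: (HC k).
Qed.

Lemma lipm_Re d B (f : R -> 'M[R[i]]_(d, m)) i : lipm B f ->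
  lip_on B (fun u j => complex.Re (f u i j)).
Proof. by move=> lf; apply: lip_on_lipb => j; case: (lf i j). Qed.

Lemma lipm_Im d B (f : R -> 'M[R[i]]_(d, m)) i : lipm B f ->
  lip_on B (fun u j => complex.Im (f u i j)).
Proof. by move=> lf; apply: lip_on_lipb => j; case: (lf i j). Qed.

Section OneIntegral.
Variables (d a b : nat) (f : R -> 'M[R[i]]_(d, m)) (I : T -> 'cV[R[i]]_d).
Hypothesis ab : (a <= b)%N.
Hypothesis lf : lipm (b%:R * h) f.
Hypothesis fI : is_stoch_integral P f L (a%:R * h) (b%:R * h) I.

Lemma stoch_measurable i : measurable_fun [set: T] (rRe (row_of I i)) /\
  measurable_fun [set: T] (rIm (row_of I i)).
Proof. by case: fI => cI _; exact: cI. Qed.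

Lemma stoch_cvg i :
  cvg_prob P (rsum L h a b (fun u j => complex.Re (f u i j))) (rRe (row_of I i)) /\
  cvg_prob P (rsum L h a b (fun u j => complex.Im (f u i j))) (rIm (row_of I i)).
Proof. exact: (stoch_integral_cvg levyL sq1 h0 i ab fI). Qed.

Lemma stoch_sqv : sqv P I.
Proof.
move=> i; have [mr mi] := stoch_measurable i; have [cr ci] := stoch_cvg i; split.
  by have [] := wiener_l2 levyL sq1 mean1 h0 ab (lipm_Re i lf) mr cr.
by have [] := wiener_l2 levyL sq1 mean1 h0 ab (lipm_Im i lf) mi ci.
Qed.

Lemma stoch_centeredv : centeredv P I.
Proof.
move=> i; have [mr mi] := stoch_measurable i; have [cr ci] := stoch_cvg i; split.
  exact: (wiener_mean levyL sq1 mean1 h0 ab (lipm_Re i lf) mr cr).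
exact: (wiener_mean levyL sq1 mean1 h0 ab (lipm_Im i lf) mi ci).
Qed.

End OneIntegral.

Lemma stoch_orth d1 d2 a b a' b' (f : R -> 'M[R[i]]_(d1, m)) (g : R -> 'M[R[i]]_(d2, m)) I J :
  (a <= b)%N -> (b <= a')%N -> (a' <= b')%N ->
  lipm (b%:R * h) f -> lipm (b'%:R * h) g ->
  is_stoch_integral P f L (a%:R * h) (b%:R * h) I ->
  is_stoch_integral P g L (a'%:R * h) (b'%:R * h) J ->
  vcip P I J = 0.
Proof.
move=> ab ba' ab' lf lg fI gJ; apply/matrixP => i j; rewrite !mxE.
have [mr mi] := stoch_measurable fI i; have [cr ci] := stoch_cvg ab fI i.
have [mr' mi'] := stoch_measurable gJ j; have [cr' ci'] := stoch_cvg ab' gJ j.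
have o phi psi X Y := @wiener_orth _ _ _ P m L levyL sq1 mean1 h h0 a b a' b' phi psi X Y ab ba' ab'.
rewrite /cip (o _ _ _ _ (lipm_Re i lf) (lipm_Re j lg) mr cr mr' cr').
rewrite (o _ _ _ _ (lipm_Im i lf) (lipm_Im j lg) mi ci mi' ci').
rewrite (o _ _ _ _ (lipm_Im i lf) (lipm_Re j lg) mi ci mr' cr').
rewrite (o _ _ _ _ (lipm_Re i lf) (lipm_Im j lg) mr cr mi' ci').
by rewrite addr0 subr0.
Qed.

(** The substitution u |-> (n + 1) h - u maps the left ends of the cells of the block to
    the right ends of the cells of [0, h]. *)
Lemma sum_rev_grid (G : R -> R) n K :
  \sum_(n * K.+1 <= l < n.+1 * K.+1) h / K.+1%:R * G (n.+1%:R * h - grid h K.+1 l) =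
  \sum_(0 <= i < K.+1) h / K.+1%:R * G (i.+1%:R * (h / K.+1%:R)).
Proof.
rewrite -{1}[(n * K.+1)%N]add0n big_addn mulSn addnK [RHS]big_nat_rev /= !big_nat.
apply: eq_bigr => i /andP[_ iK]; congr (_ * G _).
rewrite add0n subnSK// /grid natrB ?(ltnW iK)// natrD natrM -natr1.
have K0 : K.+1%:R != 0 :> R by rewrite pnatr_eq0.
move: K0; move: (K.+1%:R : R) => x x0; field; exact: x0.
Qed.

Lemma lipb_cform B (x y : R -> 'I_m -> R) :
  (forall j, lipb B (fun u => x u j)) -> (forall j, lipb B (fun u => y u j)) ->
  lipb B (fun u => cform P L (x u) (y u)).
Proof.
move=> lx ly; apply: lipb_sum => j; apply: lipb_sum => k.
by apply: lipbM; [exact: lipbM|exact: lipb_cst].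
Qed.

Lemma wiener_block n (phi psi : R -> 'I_m -> R) I J :
  (forall j, lipb (n.+1%:R * h) (fun u => phi u j)) ->
  (forall j, lipb (n.+1%:R * h) (fun u => psi u j)) ->
  measurable_fun [set: T] I ->
  cvg_prob P (rsum L h n n.+1 (fun u => phi (n.+1%:R * h - u))) I ->
  measurable_fun [set: T] J ->
  cvg_prob P (rsum L h n n.+1 (fun u => psi (n.+1%:R * h - u))) J ->
  ip P I J = \int[@lebesgue_measure R]_(u in `[0, h]) cform P L (phi u) (psi u).
Proof.
move=> lp lq mI SI mJ SJ.
have hn : h <= n.+1%:R * h by rewrite ler_peMl ?ler1n// ltW.
have lp' : lip_on (n.+1%:R * h) (fun u => phi (n.+1%:R * h - u)).
  by apply: lip_on_lipb => j; exact: (lipb_rev (lp j)).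
have lq' : lip_on (n.+1%:R * h) (fun u => psi (n.+1%:R * h - u)).
  by apply: lip_on_lipb => j; exact: (lipb_rev (lq j)).
have H := wiener_isometry levyL sq1 mean1 h0 (leqnSn n) lp' lq' mI SI mJ SJ.
have lG : lipb h (fun u => cform P L (phi u) (psi u)).
  by apply: (lipb_le hn); exact: lipb_cform.
have H' := riemann_sum_cvg h0 lG.
move: H; under eq_fun do rewrite (sum_rev_grid (fun u => cform P L (phi u) (psi u))).
move=> H; rewrite -(cvg_lim _ H)//; exact: cvg_lim H'.
Qed.

Definition Sigma1 : 'M[R]_m := \matrix_(j, k) cov1 P L j k.

(** Entries of A Sigma B^* in terms of the real bilinear form of Sigma; their four parts
    are those of [cip]. *)
Lemma sandwich_entry d1 d2 (A : 'M[R[i]]_(d1, m)) (B : 'M[R[i]]_(d2, m)) i j :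
  (A *m Cmx Sigma1 *m B ^t*) i j =
  Complex (cform P L (fun l => complex.Re (A i l)) (fun l => complex.Re (B j l)) +
           cform P L (fun l => complex.Im (A i l)) (fun l => complex.Im (B j l)))
          (cform P L (fun l => complex.Im (A i l)) (fun l => complex.Re (B j l)) -
           cform P L (fun l => complex.Re (A i l)) (fun l => complex.Im (B j l))).
Proof.
have -> : (A *m Cmx Sigma1 *m B ^t*) i j =
    \sum_l \sum_k A i l * real_complex R (cov1 P L l k) * ((B j k)^*)%C.
  rewrite mxE exchange_big /=; apply: eq_bigr => k _; rewrite mxE mulr_suml.
  by apply: eq_bigr => l _; rewrite !mxE.
rewrite /cform -!big_split -!sumrB /=.
apply/eqP; rewrite eq_complex ReE_sum ImE_sum /=; apply/andP; split; apply/eqP;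
  apply: eq_bigr => l _; rewrite ?ReE_sum ?ImE_sum -?big_split -?sumrB /=;
  apply: eq_bigr => k _; case: (A i l) => x y; case: (B j k) => x' y' /=; ring.
Qed.

(** Stationarity over the blocks: the covariance does not depend on n, because time is
    counted backwards from the end of the block. *)
Lemma stoch_isometry n d1 d2 (f : R -> 'M[R[i]]_(d1, m)) (g : R -> 'M[R[i]]_(d2, m)) I J :
  lipm (n.+1%:R * h) f -> lipm (n.+1%:R * h) g ->
  is_stoch_integral P (fun u => f (n.+1%:R * h - u)) L (n%:R * h) (n.+1%:R * h) I ->
  is_stoch_integral P (fun u => g (n.+1%:R * h - u)) L (n%:R * h) (n.+1%:R * h) J ->
  vcip P I J = mx_integral (@lebesgue_measure R) `[0, h]
    (fun u => f u *m Cmx Sigma1 *m (g u) ^t*).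
Proof.
move=> lf lg fI gJ; apply/matrixP => i j; rewrite !mxE.
have [mr mi] := stoch_measurable fI i; have [cr ci] := stoch_cvg (leqnSn n) fI i.
have [mr' mi'] := stoch_measurable gJ j; have [cr' ci'] := stoch_cvg (leqnSn n) gJ j.
have lfr l := (lf i l).1; have lfi l := (lf i l).2.
have lgr l := (lg j l).1; have lgi l := (lg j l).2.
have hn : h <= n.+1%:R * h by rewrite ler_peMl ?ler1n// ltW.
have int x y : (forall l, lipb (n.+1%:R * h) (fun u => x u l)) ->
   (forall l, lipb (n.+1%:R * h) (fun u => y u l)) ->
   (@lebesgue_measure R).-integrable `[0, h] (EFin \o (fun u => cform P L (x u) (y u))).
  move=> lx ly; apply: lipb_integrable; first exact: ltW.
  by apply: (lipb_le hn); exact: lipb_cform.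
rewrite /cip (wiener_block (phi := fun u l => complex.Re (f u i l))
   (psi := fun u l => complex.Re (g u j l)) lfr lgr mr cr mr' cr').
rewrite (wiener_block (phi := fun u l => complex.Im (f u i l))
   (psi := fun u l => complex.Im (g u j l)) lfi lgi mi ci mi' ci').
rewrite (wiener_block (phi := fun u l => complex.Im (f u i l))
   (psi := fun u l => complex.Re (g u j l)) lfi lgr mi ci mr' cr').
rewrite (wiener_block (phi := fun u l => complex.Re (f u i l))
   (psi := fun u l => complex.Im (g u j l)) lfr lgi mr cr mi' ci').
rewrite /cintegral -RintegralD//; [|exact: int|exact: int].
rewrite -RintegralB//; [|exact: int|exact: int].
by congr Complex; apply: eq_Rintegral => u _; rewrite sandwich_entry.
Qed.

Lemma rsum_linear (r a b K : nat) (al be : 'I_r -> R) (phi : R -> 'I_m -> R)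
    (phi1 phi2 : 'I_r -> R -> 'I_m -> R) :
  (forall u j, phi u j = \sum_l (al l * phi1 l u j - be l * phi2 l u j)) ->
  rsum L h a b phi K =
  \sum_l (al l *: rsum L h a b (phi1 l) K - be l *: rsum L h a b (phi2 l) K).
Proof.
move=> E; rewrite /rsum /wsum.
under [RHS]eq_bigr do rewrite !scaler_sumr -sumrB.
rewrite [RHS]exchange_big; apply: eq_bigr => i _ /=.
under [RHS]eq_bigr do rewrite !scaler_sumr -sumrB.
rewrite [RHS]exchange_big; apply: eq_bigr => j _ /=.
rewrite E scaler_suml; apply: eq_bigr => l _.
by rewrite !scalerA scalerBl.
Qed.

Lemma rsum_cat a b c phi K : (a <= b)%N -> (b <= c)%N ->
  rsum L h a c phi K = rsum L h a b phi K + rsum L h b c phi K.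
Proof.
move=> ab bc; rewrite /rsum /wsum (@big_cat_nat _ _ _ (b * K.+1)) //= ?leq_mul2r ?ab ?bc ?orbT//.
Qed.

(** Both sides are limits in probability of the same Riemann sums, split at time t h
    with E taken out of the first part. *)
Lemma stoch_integral_step (d t : nat) (E : 'M[R[i]]_d) (f g : R -> 'M[R[i]]_(d, m))
    (I J N : T -> 'cV[R[i]]_d) :
  (forall u, g u = E *m f u) ->
  is_stoch_integral P f L (0%:R * h) (t%:R * h) I ->
  is_stoch_integral P g L (0%:R * h) (t.+1%:R * h) J ->
  is_stoch_integral P g L (t%:R * h) (t.+1%:R * h) N ->
  {ae P, forall w, J w = E *m I w + N w}.
Proof.
move=> gE fI gJ gN.
have mI i := stoch_measurable fI i; have cI i := stoch_cvg (leq0n t) fI i.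
have mJ i := stoch_measurable gJ i; have cJ i := stoch_cvg (leq0n t.+1) gJ i.
have mN i := stoch_measurable gN i; have cN i := stoch_cvg (leqnSn t) gN i.
have meas (al be : 'I_d -> R) (X Y : 'I_d -> T -> R) :
    (forall l, measurable_fun [set: T] (X l)) -> (forall l, measurable_fun [set: T] (Y l)) ->
    forall l, measurable_fun [set: T] (al l *: X l - be l *: Y l).
  by move=> mX mY l; apply: measurable_funB; apply: measurable_funM => //; exact: measurable_cst.
have step (al be : 'I_d -> R) phi (phi1 phi2 : 'I_d -> R -> 'I_m -> R) (X Y : 'I_d -> T -> R) V W :
   (forall u j, phi u j = \sum_l (al l * phi1 l u j - be l * phi2 l u j)) ->
   (forall l, measurable_fun [set: T] (X l)) -> (forall l, measurable_fun [set: T] (Y l)) ->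
   measurable_fun [set: T] V -> measurable_fun [set: T] W ->
   (forall l, cvg_prob P (rsum L h 0 t (phi1 l)) (X l)) ->
   (forall l, cvg_prob P (rsum L h 0 t (phi2 l)) (Y l)) ->
   cvg_prob P (rsum L h t t.+1 phi) V -> cvg_prob P (rsum L h 0 t.+1 phi) W ->
   {ae P, forall w, W w = (\sum_l (al l *: X l - be l *: Y l) + V) w}.
  move=> phiE mX mY mV mW cX cY cV cW.
  have mr a b ph K : measurable_fun [set: T] (rsum L h a b ph K) by exact: (measurable_rsum levyL sq1 h0).
  apply: cvg_prob_unique cW _ => //.
    apply: measurable_funD => //; rewrite fct_sumE; apply: measurable_sum.
    exact: meas.
  rewrite (_ : rsum L h 0 t.+1 phi = (fun K =>
    \sum_l (al l *: rsum L h 0 t (phi1 l) K - be l *: rsum L h 0 t (phi2 l) K) +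
      rsum L h t t.+1 phi K)); last first.
    by apply/funext => K; rewrite (rsum_cat _ _ (leq0n t) (leqnSn t)) (rsum_linear _ _ _ phiE).
  apply: cvg_probD => //.
  - by move=> K; rewrite fct_sumE; apply: measurable_sum; exact: meas.
  - by rewrite fct_sumE; apply: measurable_sum; exact: meas.
  apply: cvg_prob_sum => //.
  - by move=> l K; exact: (meas al be (fun l => rsum L h 0 t (phi1 l) K) (fun l => rsum L h 0 t (phi2 l) K)).
  - exact: meas.
  move=> l; apply: cvg_probB; try exact: cvg_probZ.
  - by move=> K; apply: measurable_funM => //; exact: measurable_cst.
  - by move=> K; apply: measurable_funM => //; exact: measurable_cst.
  - by apply: measurable_funM => //; exact: measurable_cst.
  - by apply: measurable_funM => //; exact: measurable_cst.
have Hre i : {ae P, forall w, complex.Re (J w i 0) = complex.Re ((E *m I w + N w) i 0)}.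
  have := step (fun l => complex.Re (E i l)) (fun l => complex.Im (E i l))
    (fun u j => complex.Re (g u i j)) (fun l u j => complex.Re (f u l j))
    (fun l u j => complex.Im (f u l j)) (fun l => rRe (row_of I l)) (fun l => rIm (row_of I l))
    (rRe (row_of N i)) (rRe (row_of J i)).
  move=> /(_ _ (fun l => (mI l).1) (fun l => (mI l).2) (mN i).1 (mJ i).1
    (fun l => (cI l).1) (fun l => (cI l).2) (cN i).1 (cJ i).1) H.
  have {}H := H _.
  apply: filterS (H _) => [w Hw|u j].
    rewrite -[LHS]/(rRe (row_of J i) w) Hw !mxE fctE fct_sumE.
    rewrite (_ : complex.Re (_ + _) = complex.Re (\sum_l E i l * I w l 0) + complex.Re (N w i 0)); last first.
      by case: (\sum_l _) (N w i 0) => ? ? [].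
    rewrite ReE_sum; congr (_ + _); apply: eq_bigr => l _.
    rewrite -[LHS]/(complex.Re (E i l) * complex.Re (I w l 0) - complex.Im (E i l) * complex.Im (I w l 0)).
    by case: (E i l) (I w l 0) => ? ? [].
  rewrite gE mxE ReE_sum; apply: eq_bigr => l _.
  by case: (E i l) (f u l j) => ? ? [].
have Him i : {ae P, forall w, complex.Im (J w i 0) = complex.Im ((E *m I w + N w) i 0)}.
  have := step (fun l => complex.Re (E i l)) (fun l => - complex.Im (E i l))
    (fun u j => complex.Im (g u i j)) (fun l u j => complex.Im (f u l j))
    (fun l u j => complex.Re (f u l j)) (fun l => rIm (row_of I l)) (fun l => rRe (row_of I l))
    (rIm (row_of N i)) (rIm (row_of J i)).
  move=> /(_ _ (fun l => (mI l).2) (fun l => (mI l).1) (mN i).2 (mJ i).2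
    (fun l => (cI l).2) (fun l => (cI l).1) (cN i).2 (cJ i).2) H.
  apply: filterS (H _) => [w Hw|u j].
    rewrite -[LHS]/(rIm (row_of J i) w) Hw !mxE fctE fct_sumE.
    rewrite (_ : complex.Im (_ + _) = complex.Im (\sum_l E i l * I w l 0) + complex.Im (N w i 0)); last first.
      by case: (\sum_l _) (N w i 0) => ? ? [].
    rewrite ImE_sum; congr (_ + _); apply: eq_bigr => l _.
    rewrite -[LHS]/(complex.Re (E i l) * complex.Im (I w l 0) - (- complex.Im (E i l)) * complex.Re (I w l 0)).
    by case: (E i l) (I w l 0) => ? ? [? ?] /=; rewrite mulNr opprK.
  rewrite gE mxE ImE_sum; apply: eq_bigr => l _.
  by case: (E i l) (f u l j) => ? ? [? ?] /=; rewrite mulNr opprK.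
have Hre' : {ae P, forall w, forall i, complex.Re (J w i 0) = complex.Re ((E *m I w + N w) i 0)}.
  exact: filter_forall.
have Him' : {ae P, forall w, forall i, complex.Im (J w i 0) = complex.Im ((E *m I w + N w) i 0)}.
  exact: filter_forall.
move: Hre' Him'; apply: filterS2 => w Hr Hi; apply/matrixP => i j; rewrite ord1.
by apply/eqP; rewrite eq_complex Hr Hi !eqxx.
Qed.

Lemma expm_lipm d B (M : 'M[R[i]]_d) (A : 'M[R[i]]_(d, m)) : 0 <= B ->
  lipm B (fun u => expm (real_complex R u *: M) *m A).
Proof.
move=> B0 i j; split.
  rewrite (_ : (fun u => _) = fun u => \sum_l (complex.Re (expm (real_complex R u *: M) i l) *
     complex.Re (A l j) + - (complex.Im (expm (real_complex R u *: M) i l) * complex.Im (A l j)))).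
    apply: lipb_sum => l; apply: lipbD; [|apply: lipbN].
      by apply: lipbM; [exact: expm_lipb_Re|exact: lipb_cst].
    by apply: lipbM; [exact: expm_lipb_Im|exact: lipb_cst].
  apply/funext => u; rewrite mxE ReE_sum; apply: eq_bigr => l _.
  by case: (expm _ i l) (A l j) => ? ? [].
rewrite (_ : (fun u => _) = fun u => \sum_l (complex.Re (expm (real_complex R u *: M) i l) *
     complex.Im (A l j) + complex.Im (expm (real_complex R u *: M) i l) * complex.Re (A l j))).
  apply: lipb_sum => l; apply: lipbD.
    by apply: lipbM; [exact: expm_lipb_Re|exact: lipb_cst].
  by apply: lipbM; [exact: expm_lipb_Im|exact: lipb_cst].
apply/funext => u; rewrite mxE ImE_sum; apply: eq_bigr => l _.
by case: (expm _ i l) (A l j) => ? ? [].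
Qed.

Lemma lipm_rev d B (f : R -> 'M[R[i]]_(d, m)) : lipm B f -> lipm B (fun u => f (B - u)).
Proof. by move=> lf i j; have [l1 l2] := lf i j; split; [exact: (lipb_rev l1)|exact: (lipb_rev l2)]. Qed.

End MatrixWiener.

(** * Covariances of moving averages *)

(** The noises of times n + l - s and n - r coincide exactly when s = r + l. *)
Lemma sum_diagonal (V : nmodType) (F : nat -> nat -> V) n l p : (p <= n)%N ->
  \sum_(0 <= s < p) \sum_(0 <= r < p) (if (n + l - s == n - r)%N then F s r else 0) =
  \sum_(0 <= r < p - l) F (r + l)%N r.
Proof.
move=> pn; rewrite exchange_big_nat /=.
rewrite (big_nat_widen _ _ _ _ _ (leq_subr l p)) /= [RHS]big_mkcond /= !big_nat.
apply: eq_bigr => r /andP[_ rp]; rewrite ltn_subRL (addnC l r).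
have rn : (r <= n)%N by exact: leq_trans (ltnW rp) pn.
have cond s : (s < p)%N -> (n + l - s == n - r)%N = (s == r + l)%N.
  move=> sp; have sn : (s <= n)%N by exact: leq_trans (ltnW sp) pn.
  have snl : (s <= n + l)%N by exact: leq_trans sn (leq_addr _ _).
  rewrite -(eqn_add2r s) subnK// -(eqn_add2r r) [(n - r + s + r)%N]addnAC subnK//.
  by rewrite -addnA eqn_add2l eq_sym addnC.
have [rl|rl] := ltnP (r + l) p.
  rewrite (bigD1_seq (r + l)%N) ?mem_index_iota ?iota_uniq//= cond// eqxx big_nat_cond big1 ?addr0// => s.
  by move=> /andP[/andP[_ sp] srl]; rewrite cond// (negbTE srl).
rewrite big_nat big1// => s /andP[_ sp]; rewrite cond//.
by case: eqP => // sE; move: sp; rewrite sE ltnNge rl.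
Qed.

(** Advancing a solution e z + I of the state equation by one time step. *)
Lemma affine_step (F : comPzRingType) d (E e0 e1 : 'M[F]_d) (y y' z I J N : 'cV[F]_d) :
  y = e0 *m z + I -> y' = e1 *m z + J -> J = E *m I + N ->
  e1 *m z = E *m (e0 *m z) -> y' = E *m y + N.
Proof. by move=> -> -> -> ->; rewrite mulmxDr addrA. Qed.

Section MovingAverage.
Context {dT : measure_display} {T : measurableType dT} {R : realType}.
Variables (P : probability T R) (d p : nat).
Variables (N : 'I_p -> nat -> T -> 'cV[R[i]]_d) (G : 'I_p -> nat -> 'M[R[i]]_d).
Variable Sg : 'I_p -> 'I_p -> 'M[R[i]]_d.
Hypothesis sqN : forall k n, (0 < n)%N -> sqv P (N k n).
Hypothesis centeredN : forall k n, (0 < n)%N -> centeredv P (N k n).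
Hypothesis covN : forall nu mu n, (0 < n)%N -> vcip P (N nu n) (N mu n) = Sg nu mu.
Hypothesis orthN : forall nu mu n n', (0 < n)%N -> (0 < n')%N -> n != n' ->
  vcip P (N nu n) (N mu n') = 0.

Definition moving_average (n : nat) (w : T) : 'cV[R[i]]_d :=
  \sum_k \sum_(0 <= r < p) G k r *m N k (n - r)%N w.

(** Extended by 0 to all r: the lemmas on sums of random vectors ask for moments at
    every index. *)
Definition MAnoise k n r : T -> 'cV[R[i]]_d :=
  fun w => if (r < p)%N then G k r *m N k (n - r)%N w else 0.

Lemma moving_averageE n : moving_average n = fun w => \sum_k \sum_(0 <= r < p) MAnoise k n r w.
Proof.
apply/funext => w; apply: eq_bigr => k _; rewrite !big_nat; apply: eq_bigr => r /andP[_ rp].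
by rewrite /MAnoise rp.
Qed.

Lemma sqv0 : sqv P (fun=> 0 : 'cV[R[i]]_d).
Proof.
move=> i; rewrite /sqc (_ : rRe _ = cst 0); last by apply/funext => w; rewrite /rRe /row_of mxE.
rewrite (_ : rIm _ = cst 0); last by apply/funext => w; rewrite /rIm /row_of mxE.
by split; exact: sqint_cst.
Qed.

Lemma centeredv0 : centeredv P (fun=> 0 : 'cV[R[i]]_d).
Proof.
move=> i; rewrite /centered (_ : rRe _ = 0); last by apply/funext => w; rewrite /rRe /row_of mxE.
rewrite (_ : rIm _ = 0); last by apply/funext => w; rewrite /rIm /row_of mxE.
by rewrite ip0l.
Qed.

Lemma MAnoise_gt0 n r : (p <= n)%N -> (r < p)%N -> (0 < n - r)%N.
Proof. by move=> pn rp; rewrite subn_gt0 (leq_trans rp). Qed.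

Lemma sqv_MAnoise k n r : (p <= n)%N -> sqv P (MAnoise k n r).
Proof.
move=> pn; have [rp|rp] := boolP (r < p)%N.
  have := sqv_mul (G k r) (sqN k (MAnoise_gt0 pn rp)).
  by rewrite /MAnoise rp.
by rewrite /MAnoise (negbTE rp); exact: sqv0.
Qed.

Lemma centeredv_MAnoise k n r : (p <= n)%N -> centeredv P (MAnoise k n r).
Proof.
move=> pn; have [rp|rp] := boolP (r < p)%N.
  have np := MAnoise_gt0 pn rp.
  have := centeredv_mul (G k r) (sqN k np) (centeredN k np).
  by rewrite /MAnoise rp.
by rewrite /MAnoise (negbTE rp); exact: centeredv0.
Qed.

Lemma sqv_moving_average n : (p <= n)%N -> sqv P (moving_average n).
Proof.
move=> pn; rewrite moving_averageE; apply: sqv_sum => k; apply: sqv_sum => r.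
exact: sqv_MAnoise.
Qed.

Lemma centeredv_moving_average n : (p <= n)%N -> centeredv P (moving_average n).
Proof.
move=> pn; rewrite moving_averageE; apply: centeredv_sum => k.
  by apply: sqv_sum => r; exact: sqv_MAnoise.
by apply: centeredv_sum => r; [exact: sqv_MAnoise|exact: centeredv_MAnoise].
Qed.

Lemma vcip_moving_average n l : (p <= n)%N ->
  vcip P (moving_average (n + l)) (moving_average n) =
  \sum_nu \sum_(0 <= r < p - l) \sum_mu G nu (r + l) *m Sg nu mu *m (G mu r) ^t*.
Proof.
move=> pn; have pnl : (p <= n + l)%N by rewrite (leq_trans pn)// leq_addr.
have sn k r := @sqv_MAnoise k n r pn; have snl k r := @sqv_MAnoise k (n + l) r pnl.
have sns k : sqv P (fun w => \sum_(0 <= r < p) MAnoise k n r w) by exact: sqv_sum.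
have snls k : sqv P (fun w => \sum_(0 <= r < p) MAnoise k (n + l) r w) by exact: sqv_sum.
rewrite !moving_averageE vcip_suml; [|exact: snls|exact: sqv_sum].
apply: eq_bigr => nu _; rewrite vcip_sumr; [|exact: sns|exact: snls].
rewrite [RHS]exchange_big /=; apply: eq_bigr => mu _.
rewrite -(sum_diagonal (fun s r => G nu s *m Sg nu mu *m (G mu r) ^t*) l pn).
rewrite vcip_suml; [|exact: snl|exact: sns].
rewrite !big_nat; apply: eq_bigr => s /andP[_ sp].
rewrite vcip_sumr; [|exact: sn|exact: snl].
rewrite !big_nat; apply: eq_bigr => r /andP[_ rp].
have np := MAnoise_gt0 pn rp; have np' := MAnoise_gt0 pnl sp.
rewrite /MAnoise rp sp vcip_mulr; [|exact: sqN|by apply: sqv_mul; exact: sqN].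
rewrite vcip_mull; [|exact: sqN|exact: sqN].
case: eqP => [->|/eqP ne]; first by rewrite covN.
by rewrite orthN// mulmx0 mul0mx.
Qed.

End MovingAverage.

(** * Covariances up to almost sure equality *)

Section Transfer.
Context {dT : measure_display} {T : measurableType dT} {R : realType}.
Variable P : probability T R.

Definition mcv (n : nat) (U : T -> 'cV[R[i]]_n) : Prop := forall i,
  measurable_fun [set: T] (rRe (row_of U i)) /\ measurable_fun [set: T] (rIm (row_of U i)).

Lemma mcv_mul (m n : nat) (A : 'M[R[i]]_(m, n)) (U : T -> 'cV[R[i]]_n) :
  mcv U -> mcv (fun w => A *m U w).
Proof.
move=> mU i; rewrite row_of_mul rRe_sum rIm_sum; split; rewrite fct_sumE;
  apply: measurable_sum => j; rewrite ?rReZ ?rImZ; have [mr mi] := mU j.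
  by apply: measurable_funB; apply: measurable_funM => //; exact: measurable_cst.
by apply: measurable_funD; apply: measurable_funM => //; exact: measurable_cst.
Qed.

Lemma mcv_sum (n : nat) (I : Type) (r : seq I) (F : I -> T -> 'cV[R[i]]_n) :
  (forall k, mcv (F k)) -> mcv (fun w => \sum_(k <- r) F k w).
Proof.
move=> mF i; rewrite row_of_sum rRe_sum rIm_sum; split; rewrite fct_sumE;
  by apply: measurable_sum => k; case: (mF k i).
Qed.

Lemma mcvB (n : nat) (U V : T -> 'cV[R[i]]_n) : mcv U -> mcv V -> mcv (fun w => U w - V w).
Proof.
move=> mU mV i; have [ur ui] := mU i; have [vr vi] := mV i; split.
  rewrite (_ : rRe _ = rRe (row_of U i) - rRe (row_of V i)); first exact: measurable_funB.
  apply/funext => w; rewrite -[RHS]/(complex.Re (U w i 0) - complex.Re (V w i 0)) /rRe /row_of !mxE.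
  by case: (U w i 0) (V w i 0) => ? ? [].
rewrite (_ : rIm _ = rIm (row_of U i) - rIm (row_of V i)); first exact: measurable_funB.
apply/funext => w; rewrite -[RHS]/(complex.Im (U w i 0) - complex.Im (V w i 0)) /rIm /row_of !mxE.
by case: (U w i 0) (V w i 0) => ? ? [].
Qed.

Lemma mcv_Cmx (n : nat) (U : T -> 'cV[R]_n) : rvec U -> mcv (fun w => Cmx (U w)).
Proof.
move=> mU i; split.
  rewrite (_ : rRe _ = fun w => U w i 0); first exact: mU.
  by apply/funext => w; rewrite /rRe /row_of mxE.
rewrite (_ : rIm _ = cst 0); first exact: measurable_cst.
by apply/funext => w; rewrite /rIm /row_of mxE.
Qed.

Lemma row_of_ae (n : nat) (U V : T -> 'cV[R[i]]_n) i :
  {ae P, forall w, U w = V w} -> {ae P, forall w, row_of U i w = row_of V i w}.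
Proof. by apply: filterS => w; rewrite /row_of => ->. Qed.

(** Measurability is not inherited through almost sure equality, as the probability
    space is not assumed complete. *)
Lemma has_cov_ae (m n : nat) (U U' : T -> 'cV[R[i]]_m) (W W' : T -> 'cV[R[i]]_n) :
  mcv U' -> mcv W' -> sqv P U -> sqv P W -> centeredv P U -> centeredv P W ->
  {ae P, forall w, U w = U' w} -> {ae P, forall w, W w = W' w} ->
  has_cov P U' W' (vcip P U W).
Proof.
move=> mU mW sU sW cU cW eU eW.
have sq k (Z Z' : T -> 'cV[R[i]]_k) : mcv Z' -> sqv P Z ->
    {ae P, forall w, Z w = Z' w} -> sqv P Z'.
  by move=> mZ sZ eZ i; have [? ?] := mZ i; apply: sqc_ae (row_of_ae i eZ) (sZ i).
have ct k (Z Z' : T -> 'cV[R[i]]_k) : sqv P Z -> sqv P Z' -> centeredv P Z ->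
    {ae P, forall w, Z w = Z' w} -> centeredv P Z'.
  by move=> sZ sZ' cZ eZ i; apply: centered_ae (row_of_ae i eZ) (cZ i).
have sU' := sq _ _ _ mU sU eU; have sW' := sq _ _ _ mW sW eW.
have -> : vcip P U W = vcip P U' W'.
  apply/matrixP => i j; rewrite !mxE; apply: cip_ae => //;
    by [exact: row_of_ae].
by apply: has_cov_vcip => //; [exact: ct cU eU|exact: ct cW eW].
Qed.

End Transfer.

(** * Moments of L(1) *)

Section LevyAtOne.
Context {dT : measure_display} {T : measurableType dT} {R : realType}.
Variables (P : probability T R) (m : nat) (L : R -> T -> 'cV[R]_m).
Hypothesis levyL : levy_process P L.
Hypothesis L2 : (\int[P]_w (\sum_i (L 1 w i 0) ^+ 2)%:E < +oo)%E.
Hypothesis L1mean : forall i : 'I_m, ('E_P[(fun w => L 1 w i 0)%R] = 0)%E.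

Let X (j : 'I_m) : T -> R := fun w => L 1 w j 0.

Lemma measurable_L1 j : measurable_fun [set: T] (X j).
Proof. by case: levyL => /= mL _ _ _ _; exact: mL. Qed.

Lemma L1_incr j : {ae P, forall w, X j w = incr L 0 1 j w}.
Proof.
case: levyL => /= _ L0 _ _ _; move: L0; apply: filterS => w L0.
by rewrite /X /incr L0 subr0.
Qed.

Lemma sqint_L1 j : sqint P (X j).
Proof.
split; first exact: measurable_L1.
apply: (@integrable_dominated _ _ _ _ _ (fun w => \sum_i (L 1 w i 0) ^+ 2)).
- by apply: measurable_funM; exact: measurable_L1.
- move=> w; rewrite fctE ger0_norm -?expr2 ?sqr_ge0// (bigD1 j)//= lerDl.
  by apply: sumr_ge0 => i _; exact: sqr_ge0.
apply/integrableP; split.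
  apply/measurable_EFinP; apply: measurable_sum => i; apply: measurable_funX.
  exact: measurable_L1.
move: L2; congr (_ < _)%E; apply: eq_integral => w _ /=.
by rewrite ger0_norm// sumr_ge0// => i _; exact: sqr_ge0.
Qed.

Lemma sqint_incr1 j : sqint P (incr L 0 1 j).
Proof.
apply: sqint_ae (L1_incr j) (sqint_L1 j).
exact: (measurable_incr levyL).
Qed.

Lemma mean_incr1 j : ip P (incr L 0 1 j) (cst 1) = 0.
Proof.
have <- : ip P (X j) (cst 1) = ip P (incr L 0 1 j) (cst 1).
  apply: ip_ae (L1_incr j) _; try exact: measurable_cst.
  - exact: measurable_L1.
  - exact: (sqint_incr1 j).1.
  - exact: aeW.
have := L1mean j; rewrite unlock => H.
by rewrite /ip /Rintegral; under eq_integral do rewrite mulr1; rewrite H.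
Qed.

(** L(1) is centered and almost surely equal to its increment from time 0. *)
Lemma cov_mx_L1 : cov_mx P (L 1) = Sigma1 P L.
Proof.
apply/matrixP => i j; rewrite !mxE /cov1.
have <- : ip P (X i) (X j) = ip P (incr L 0 1 i) (incr L 0 1 j).
  by apply: ip_ae (L1_incr i) (L1_incr j); first [exact: measurable_L1|exact: (sqint_incr1 _).1].
rewrite covariance.unlock !L1mean /= expectation.unlock /ip /Rintegral.
by congr fine; apply: eq_integral => w _; rewrite -[LHS]/(((X i w - 0) * (X j w - 0))%:E) !subr0.
Qed.

End LevyAtOne.

(** * The autocovariance formula *)

Theorem proposition3p10
    (R : realType) (dT : measure_display) (T : measurableType dT)
    (P : probability T R) (d m p q : nat)
    (A : nat -> 'M[R]_d) (B : nat -> 'M[R]_(d, m))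
    (L : R -> T -> 'cV[R]_m)
    (Rs : 'I_p -> 'M[R[i]]_d) (Gamma : 'I_p -> R -> R[i])
    (Yk : 'I_p -> R -> T -> 'cV[R[i]]_d) (Y : R -> T -> 'cV[R]_d)
    (h : R) (N : 'I_p -> nat -> T -> 'cV[R[i]]_d) :
  (0 < d)%N -> (0 < m)%N -> (0 < q)%N -> (q < p)%N ->
  let Ac := fun j => Cmx (A j) in
  let Bc := fun j => Cmx (B j) in
  let Res := fun k => residue (transfer p q Ac Bc) (Gamma k) in
  left_coprime (ARpoly p Ac) (MApoly q Bc) ->
  complete_solvents Ac Rs ->
  (forall k, regular_solvent p Ac (Rs k)) ->
  (forall k, solvent_contour p Ac (Rs k) (Gamma k)) ->
  levy_process P L ->
  (\int[P]_w (\sum_i (L 1 w i 0) ^+ 2)%:E < +oo)%E ->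
  (forall i : 'I_m, ('E_P[(fun w => L 1 w i 0)%R] = 0)%E) ->
  (forall k t, 0 <= t -> crvec (Yk k t)) ->
  (forall k t, 0 <= t -> exists I : T -> 'cV[R[i]]_d,
     is_stoch_integral P
       (fun u => expm (real_complex R (t - u) *: Rs k) *m Res k) L 0 t I /\
     {ae P, forall w,
        Yk k t w = expm (real_complex R t *: Rs k) *m Yk k 0 w + I w}) ->
  {ae P, forall w,
     block_vandermonde Rs *m (\mxcol_(k < p) Yk k 0 w) \is a mxOver Num.real} ->
  MCARMA P p q A B L Y ->
  (forall t, 0 <= t -> {ae P, forall w, Cmx (Y t w) = \sum_k Yk k t w}) ->
  0 < h ->
  block_vandermonde (fun k => expm (real_complex R (- h) *: Rs k)) \in unitmx ->
  (forall k n, (0 < n)%N ->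
     is_stoch_integral P
       (fun u => expm (real_complex R (n%:R * h - u) *: Rs k) *m Res k) L
       (n.-1%:R * h) (n%:R * h) (N k n)) ->
  let U := fun (n : nat) (w : T) =>
    Cmx (Y (n%:R * h) w)
    - \sum_(1 <= j < p.+1) Phi h Rs j *m Cmx (Y ((n - j)%:R * h) w) in
  let SigmaL := Cmx (cov_mx P (L 1)) in
  let Sigma := fun nu mu : 'I_p =>
    mx_integral (@lebesgue_measure R) `[0, h] (fun u =>
      expm (real_complex R u *: Rs nu) *m Res nu *m SigmaL *m (Res mu) ^t*
        *m expm (real_complex R u *: (Rs mu) ^t*)) in
  [/\ (forall nu mu, has_cov P (N nu 1%N) (N mu 1%N) (Sigma nu mu)),
      (forall n l, (p <= n)%N -> (l < p)%N ->
         has_cov P (U (n + l)%N) (U n)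
           (\sum_nu \sum_(r < p - l) \sum_mu
              MAcoef h Rs r l (Rs nu) *m expm (real_complex R (h * l%:R) *: Rs nu)
                *m Sigma nu mu *m (MAcoef h Rs r 0 (Rs mu)) ^t*)) &
      (forall n l, (p <= n)%N -> (p <= l)%N ->
         has_cov P (U (n + l)%N) (U n) 0)].
Proof.
move=> d0 m0 q0 qp Ac Bc Res _ _ _ _ levyL L2 L1mean mYk YkI _ [mY _] YE h0 Vu NI U SigmaL Sigma.
clearbody Res.
have sq1 := sqint_incr1 levyL L2; have mean1 := mean_incr1 levyL L2 L1mean.
have p0 : (0 < p)%N by exact: leq_trans qp.
have hn n : 0 <= n%:R * h by rewrite mulr_ge0// ltW.
pose E k := expm (real_complex R h *: Rs k).
pose f k (u : R) := expm (real_complex R u *: Rs k) *m Res k.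
have lf k n : lipm (n%:R * h) (f k) by exact: expm_lipm.
have NI' k n : is_stoch_integral P (fun u => f k (n.+1%:R * h - u)) L (n%:R * h)
    (n.+1%:R * h) (N k n.+1) by exact: NI.
have sqN k n : (0 < n)%N -> sqv P (N k n).
  by case: n => // n _; exact: (stoch_sqv levyL sq1 mean1 h0 (leqnSn n) (lipm_rev (lf k n.+1)) (NI' k n)).
have ceN k n : (0 < n)%N -> centeredv P (N k n).
  by case: n => // n _; exact: (stoch_centeredv levyL sq1 mean1 h0 (leqnSn n) (lipm_rev (lf k n.+1)) (NI' k n)).
have covN nu mu n : (0 < n)%N -> vcip P (N nu n) (N mu n) = Sigma nu mu.
  case: n => // n _.
  rewrite (stoch_isometry levyL sq1 mean1 h0 (lf nu n.+1) (lf mu n.+1) (NI' nu n) (NI' mu n)).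
  rewrite /Sigma /SigmaL (cov_mx_L1 levyL L2 L1mean); congr mx_integral; apply/funext => u.
  by rewrite /f adj_mul -expm_adj !mulmxA.
have orthN nu mu n n' : (0 < n)%N -> (0 < n')%N -> n != n' ->
    vcip P (N nu n) (N mu n') = 0.
  have lt k k' a b : (a < b)%N -> vcip P (N k a.+1) (N k' b.+1) = 0.
    move=> ab; exact: (stoch_orth levyL sq1 mean1 h0 (leqnSn a) ab (leqnSn b)
      (lipm_rev (lf k a.+1)) (lipm_rev (lf k' b.+1)) (NI' k a) (NI' k' b)).
  case: n => // a _; case: n' => // b _; rewrite eqSS neq_ltn => /orP[ab|ba]; first exact: lt.
  by rewrite vcipC lt// trmx0 map_mx0.
pose G k r := Gcoef (E k) (Phi h Rs) r.
pose V := moving_average N G.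
have rec k t : {ae P, forall w,
    Yk k (t.+1%:R * h) w = E k *m Yk k (t%:R * h) w + N k t.+1 w}.
  have [I [sI eI]] := YkI k _ (hn t); have [J [sJ eJ]] := YkI k _ (hn t.+1).
  have gE u : f k (t.+1%:R * h - u) = E k *m f k (t%:R * h - u).
    by apply: expm_mulD; rewrite -natr1; ring.
  have sI' : is_stoch_integral P (fun u => f k (t%:R * h - u)) L (0%:R * h) (t%:R * h) I.
    by rewrite mul0r; exact: sI.
  have sJ' : is_stoch_integral P (fun u => f k (t.+1%:R * h - u)) L (0%:R * h) (t.+1%:R * h) J.
    by rewrite mul0r; exact: sJ.
  have := stoch_integral_step levyL sq1 h0 gE sI' sJ' (NI' k t).
  move: eI eJ; apply: filterS3 => w eI eJ eN.
  by apply: (affine_step eI eJ eN); apply: expm_mulD; rewrite -natr1; ring.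
(* Countably many almost sure identities hold off one common null set *)
have eUV n : (p <= n)%N -> {ae P, forall w, V n w = U n w}.
  move=> pn.
  have Yall : {ae P, forall w t, Cmx (Y (t%:R * h) w) = \sum_k Yk k (t%:R * h) w}.
    by apply: ae_foralln => t; exact: YE.
  have recall : {ae P, forall w t k,
      Yk k (t.+1%:R * h) w = E k *m Yk k (t%:R * h) w + N k t.+1 w}.
    by apply: ae_foralln => t; apply: filter_forall => k; exact: rec.
  move: Yall recall; apply: filterS2 => w Yw rw.
  have eS : \sum_(1 <= j < p.+1) Phi h Rs j *m Cmx (Y ((n - j)%:R * h) w) =
      \sum_(1 <= j < p.+1) \sum_k Phi h Rs j *m Yk k ((n - j)%:R * h) w.
    by apply: eq_bigr => j _; rewrite Yw mulmx_sumr.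
  rewrite /U Yw eS.
  rewrite [in RHS]exchange_big -sumrB; apply: eq_bigr => k _.
  by rewrite (@ARfilter _ _ _ h Rs p0 Vu k (fun t => Yk k (t%:R * h) w) (fun t => N k t w) n pn (fun t => rw t k)).
have mU n : mcv (U n).
  apply: mcvB; first by apply: mcv_Cmx; exact: mY.
  by apply: mcv_sum => j; apply: mcv_mul; apply: mcv_Cmx; exact: mY.
have covU n l : (p <= n)%N -> has_cov P (U (n + l)%N) (U n)
    (\sum_nu \sum_(0 <= r < p - l) \sum_mu G nu (r + l)%N *m Sigma nu mu *m (G mu r) ^t*).
  move=> pn; have pnl : (p <= n + l)%N by rewrite (leq_trans pn)// leq_addr.
  rewrite -(vcip_moving_average G sqN covN orthN l pn).
  apply: has_cov_ae => //; try exact: eUV.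
  - exact: sqv_moving_average.
  - exact: sqv_moving_average.
  - exact: centeredv_moving_average.
  - exact: centeredv_moving_average.
split.
- by move=> nu mu; rewrite -(covN nu mu 1%N)//; apply: has_cov_vcip; first [exact: sqN|exact: ceN].
- move=> n l pn lp; have := covU n l pn; congr (has_cov P _ _ _).
  apply: eq_bigr => nu _; rewrite big_mkord; apply: eq_bigr => r _; apply: eq_bigr => mu _.
  apply: (congr2 (fun X Z => X *m Sigma nu mu *m Z ^t*)).
    exact: esym (MAcoefE h Rs r l nu).
  exact: esym (MAcoef0E h Rs r mu).
move=> n l pn pl; have := covU n l pn; congr (has_cov P _ _ _).
rewrite big1// => nu _; rewrite big_geq//.
by move: pl; rewrite -subn_eq0 => /eqP ->.
Qed.
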